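(* Define the functional $D\colon BV(I;\mathbb{R}^d)^2\times\bar\Gamma^2\to\mathbb{R}\cup\{+\infty\}$ by $$D(c_1,c_2;\varphi_1,\varphi_2):=\begin{cases} d(c_1\circ\varphi_1,c_2\circ\varphi_2)^2 & \text{if } c_i\in AC(I;\mathbb{R}^d)\text{ and }\varphi_i\in\Gamma \text{ for } i=1,2,\\ +\infty & \text{else.}\end{cases}$$ Then the lower semi-continuous hull of $D$ with respect to strict convergence on $BV(I;\mathbb{R}^d)$ (in $c_1$ and in $c_2$) and uniform convergence on $\bar\Gamma$ (in $\varphi_1$ and in $\varphi_2$) is the functional $$\hat D(c_1,c_2;\varphi_1,\varphi_2)=\inf_{g_1\in[c_1,\varphi_1],\,g_2\in[c_2,\varphi_2]}\hat d(g_1,g_2)=\hat d([c_1,\varphi_1],[c_2,\varphi_2]).$$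
   Context: $I=[0,1]$. $AC$ and $BV$ denote absolutely continuous curves and curves of bounded variation. For $c\in BV(I;\mathbb{R}^d)$, $\mathrm{len}(c):=|Dc|(I)$ is the total variation of the distributional derivative $Dc$, and $c^\ell(x),c^r(x)$ are the left and right essential limits of $c$ at $x\in I$ (with the convention $c^\ell(0):=c^r(0)$, $c^r(1):=c^\ell(1)$). For $p,q\in\mathbb{R}^d$, $[p,q]$ is the line segment from $p$ to $q$. Functions in $BV$ are identified with any good representative, i.e. a pointwise defined representative $c$ with $c(x)\in[c^\ell(x),c^r(x)]$ for all $x\in I$. Strict convergence $c^{(k)}\to^s c$ in $BV(I;\mathbb{R}^d)$ means $\|c^{(k)}-c\|_{L^1}\to0$ and $\mathrm{len}(c^{(k)})\to\mathrm{len}(c)$. $\Gamma=\{\gamma\in AC(I;I):\gamma(0)=0,\gamma(1)=1,\gamma'>0\text{ a.e.}\}$ and $\bar\Gamma=\{\gamma\in AC(I;I):\gamma(0)=0,\gamma(1)=1,\gamma'\ge0\text{ a.e.}\}$. For $c_1,c_2\in AC(I;\mathbb{R}^d)$: $S(c_1,c_2)=\int_I\langle\frac{\dot c_1}{|\dot c_1|},\frac{\dot c_2}{|\dot c_2|}\rangle\sqrt{|\dot c_1||\dot c_2|}\,dx$ (integrand zero where $\dot c_1=0$ or $\dot c_2=0$), and $d(c_1,c_2)^2=\mathrm{len}(c_1)+\mathrm{len}(c_2)-2S(c_1,c_2)$, equivalently $d(c_1,c_2)=\|\dot c_1/\sqrt{|\dot c_1|}-\dot c_2/\sqrt{|\dot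 c_2|}\|_{L^2}$. For $c_1,c_2\in BV(I;\mathbb{R}^d)$: $\hat S(c_1,c_2)=\sup\{\limsup_kS(c_1^{(k)},c_2^{(k)}):c_i^{(k)}\in AC(I;\mathbb{R}^d),\,c_i^{(k)}\to^sc_i\}$ and $\hat d(c_1,c_2)=\mathrm{len}(c_1)+\mathrm{len}(c_2)-2\hat S(c_1,c_2)$. For $c\in BV(I;\mathbb{R}^d)$, $\varphi\in\bar\Gamma$: $$[c,\varphi]:=\{g\in BV(I;\mathbb{R}^d): g(x)\in[c^\ell(\varphi(x)),c^r(\varphi(x))]\text{ for all }x\in I,\ \mathrm{len}(g)=\mathrm{len}(c)\},$$ and $\hat d([c_1,\varphi_1],[c_2,\varphi_2]):=\inf_{g_i\in[c_i,\varphi_i]}\hat d(g_1,g_2)$. The lower semi-continuous hull of $D$ is the largest functional $\le D$ that is lower semi-continuous for the stated convergence; its value at $(c_1,c_2;\varphi_1,\varphi_2)$ is the infimum of $\liminf_kD(c_1^{(k)},c_2^{(k)};\varphi_1^{(k)},\varphi_2^{(k)})$ over all sequences with $c_i^{(k)}\to^sc_i$ and $\varphi_i^{(k)}\to\varphi_i$ uniformly. *)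

(* Defs.v *)
From HB Require Import structures.
From mathcomp Require Import all_boot all_order all_algebra.
From mathcomp Require Import all_classical all_reals all_analysis.

Set Implicit Arguments.
Unset Strict Implicit.
Unset Printing Implicit Defensive.
Import Order.TTheory GRing.Theory Num.Theory.
Import numFieldTopology.Exports numFieldNormedType.Exports.

Local Open Scope classical_set_scope.
Local Open Scope ring_scope.

(* Curves on I = [0, 1] are total functions on R; every notion below depends
   only on their restriction to I. *)
Definition I01 (R : realType) : set R := `[0, 1]%classic.
Arguments I01 R : clear implicits.

Definition dotv (R : realType) (d : nat) (u v : 'rV[R]_d) : R :=
  \sum_(i < d) u 0 i * v 0 i.

(* The library norm on 'rV[R]_d is the sup norm, whence this definition. *)
Definition enorm (R : realType) (d : nat) (u : 'rV[R]_d) : R :=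
  Num.sqrt (dotv u u).

Definition segment (R : realType) (d : nat) (p q : 'rV[R]_d) :
    set 'rV[R]_d :=
  [set (1 - t) *: p + t *: q | t in I01 R].

Definition velocity (R : realType) (d : nat) (c : R -> 'rV[R]_d) (x : R) :
    'rV[R]_d :=
  \row_i derive1 (fun y => c y 0 i) x.

(* N is the norm on V measuring increments. *)
Definition abs_cont (R : realType) (V : zmodType) (N : V -> R) (f : R -> V) :
    Prop :=
  forall e : R, 0 < e -> exists2 delta : R, 0 < delta &
    forall (n : nat) (a b : 'I_n -> R),
      (forall i, [/\ 0 <= a i, a i <= b i & b i <= 1]) ->
      trivIset setT (fun i => `]a i, b i[%classic) ->
      \sum_(i < n) (b i - a i) < delta ->
      \sum_(i < n) N (f (b i) - f (a i)) < e.

Definition AC (R : realType) (d : nat) (c : R -> 'rV[R]_d) : Prop :=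
  abs_cont (@enorm R d) c.

(* The class C^1_c(]0, 1[; R^d). *)
Definition test_field (R : realType) (d : nat) (psi : R -> 'rV[R]_d) : Prop :=
  (forall (i : 'I_d) (x : R), derivable (fun y => psi y 0 i) x 1) /\
  (forall i : 'I_d, continuous (derive1 (fun y => psi y 0 i))) /\
  (exists a b : R, [/\ 0 < a, b < 1 &
     forall x : R, ~ (a <= x <= b) -> psi x = 0]).

(* The action of the distributional derivative Dc on psi. *)
Definition distr_deriv (R : realType) (d : nat) (c psi : R -> 'rV[R]_d) : R :=
  - \int[lebesgue_measure]_(x in I01 R) dotv (c x) (velocity psi x).

(* |Dc|(I), the total variation of Dc, as the supremum of Dc over the test
   fields of Euclidean norm at most 1. *)
Definition len (R : realType) (d : nat) (c : R -> 'rV[R]_d) : \bar R :=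
  ereal_sup [set (distr_deriv c psi)%:E | psi in
    [set psi | test_field psi /\ forall x : R, enorm (psi x) <= 1]].

Definition BV (R : realType) (d : nat) (c : R -> 'rV[R]_d) : Prop :=
  (forall i : 'I_d, lebesgue_measure.-integrable (I01 R)
     (fun x => (c x 0 i)%:E)) /\
  (len c < +oo)%E.

Definition is_left_ess_lim (R : realType) (d : nat) (c : R -> 'rV[R]_d)
    (x : R) (p : 'rV[R]_d) : Prop :=
  forall e : R, 0 < e -> exists2 delta : R, 0 < delta &
    {ae (@lebesgue_measure R), forall y, x - delta < y < x ->
       enorm (c y - p) < e}.

Definition is_right_ess_lim (R : realType) (d : nat) (c : R -> 'rV[R]_d)
    (x : R) (p : 'rV[R]_d) : Prop :=
  forall e : R, 0 < e -> exists2 delta : R, 0 < delta &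
    {ae (@lebesgue_measure R), forall y, x < y < x + delta ->
       enorm (c y - p) < e}.

Definition ess_left (R : realType) (d : nat) (c : R -> 'rV[R]_d) (x : R) :
    'rV[R]_d :=
  if x == 0 then get (is_right_ess_lim c 0) else get (is_left_ess_lim c x).

Definition ess_right (R : realType) (d : nat) (c : R -> 'rV[R]_d) (x : R) :
    'rV[R]_d :=
  if x == 1 then get (is_left_ess_lim c 1) else get (is_right_ess_lim c x).

Definition good_rep (R : realType) (d : nat) (c : R -> 'rV[R]_d) : Prop :=
  forall x : R, I01 R x -> segment (ess_left c x) (ess_right c x) (c x).

(* An element of BV(I; R^d), given by a good representative. *)
Record bv_curve (R : realType) (d : nat) := BVCurve {
  bv_fun :> R -> 'rV[R]_d;
  bv_funP : BV bv_fun;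
  bv_fun_good : good_rep bv_fun }.

Definition strict_cvg (R : realType) (d : nat) (c_ : nat -> R -> 'rV[R]_d)
    (c : R -> 'rV[R]_d) : Prop :=
  (\int[lebesgue_measure]_(x in I01 R) (enorm (c_ k x - c x))%:E)%E
     @[k --> \oo] --> 0%E /\
  len (c_ k) @[k --> \oo] --> len c.

Definition is_Gamma (R : realType) (g : R -> R) : Prop :=
  [/\ forall x, I01 R x -> I01 R (g x), abs_cont Num.norm g, g 0 = 0, g 1 = 1 &
      {ae (@lebesgue_measure R), forall x, I01 R x ->
         derivable g x 1 /\ 0 < derive1 g x}].

Definition is_Gammabar (R : realType) (g : R -> R) : Prop :=
  [/\ forall x, I01 R x -> I01 R (g x), abs_cont Num.norm g, g 0 = 0, g 1 = 1 &
      {ae (@lebesgue_measure R), forall x, I01 R x ->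
         derivable g x 1 /\ 0 <= derive1 g x}].

Record Gammabar (R : realType) := MkGammabar {
  gammabar_fun :> R -> R;
  gammabar_funP : is_Gammabar gammabar_fun }.

(* The integrand vanishes where one of the velocities does, as 0^-1 = 0. *)
Definition matchS (R : realType) (d : nat) (c1 c2 : R -> 'rV[R]_d) : R :=
  \int[lebesgue_measure]_(x in I01 R)
    (dotv ((enorm (velocity c1 x))^-1 *: velocity c1 x)
          ((enorm (velocity c2 x))^-1 *: velocity c2 x)
     * Num.sqrt (enorm (velocity c1 x) * enorm (velocity c2 x))).

(* The square of the distance d. *)
Definition dist_sq (R : realType) (d : nat) (c1 c2 : R -> 'rV[R]_d) : \bar R :=
  (len c1 + len c2 - 2%:E * (matchS c1 c2)%:E)%E.

Definition hatS (R : realType) (d : nat) (c1 c2 : R -> 'rV[R]_d) : \bar R :=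
  ereal_sup [set s | exists c1_ c2_ : nat -> R -> 'rV[R]_d,
    [/\ forall k, AC (c1_ k) /\ AC (c2_ k),
        strict_cvg c1_ c1, strict_cvg c2_ c2 &
        s = limn_esup (fun k => (matchS (c1_ k) (c2_ k))%:E)]].

Definition hatd (R : realType) (d : nat) (c1 c2 : R -> 'rV[R]_d) : \bar R :=
  (len c1 + len c2 - 2%:E * hatS c1 c2)%E.

(* The set [c, phi]. *)
Definition reparam (R : realType) (d : nat) (c : bv_curve R d)
    (phi : Gammabar R) : set (bv_curve R d) :=
  [set g | (forall x, I01 R x ->
              segment (ess_left c (phi x)) (ess_right c (phi x)) (g x)) /\
           len g = len c].

Definition hatd_set (R : realType) (d : nat) (A B : set (bv_curve R d)) :
    \bar R :=
  ereal_inf [set hatd g1 g2 | g1 in A & g2 in B].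

Definition functional (R : realType) (d : nat) :=
  bv_curve R d -> bv_curve R d -> Gammabar R -> Gammabar R -> \bar R.

Definition matching_functional (R : realType) (d : nat) : functional R d :=
  fun c1 c2 phi1 phi2 =>
    if `[< [/\ AC c1, AC c2, is_Gamma phi1 & is_Gamma phi2] >]
    then dist_sq (c1 \o phi1) (c2 \o phi2) else +oo%E.

Definition relaxed_functional (R : realType) (d : nat) : functional R d :=
  fun c1 c2 phi1 phi2 => hatd_set (reparam c1 phi1) (reparam c2 phi2).

Definition lsc (R : realType) (d : nat) (F : functional R d) : Prop :=
  forall (c1_ c2_ : nat -> bv_curve R d) (phi1_ phi2_ : nat -> Gammabar R)
         (c1 c2 : bv_curve R d) (phi1 phi2 : Gammabar R),
    strict_cvg (fun k => c1_ k) c1 ->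
    strict_cvg (fun k => c2_ k) c2 ->
    {uniform I01 R, (fun k => phi1_ k : R -> R) @ \oo --> (phi1 : R -> R)} ->
    {uniform I01 R, (fun k => phi2_ k : R -> R) @ \oo --> (phi2 : R -> R)} ->
    (F c1 c2 phi1 phi2 <=
       limn_einf (fun k => F (c1_ k) (c2_ k) (phi1_ k) (phi2_ k)))%E.

Definition functional_le (R : realType) (d : nat) (F G : functional R d) :
    Prop :=
  forall c1 c2 phi1 phi2, (F c1 c2 phi1 phi2 <= G c1 c2 phi1 phi2)%E.

Definition is_lsc_hull (R : realType) (d : nat) (F H : functional R d) : Prop :=
  [/\ functional_le H F, lsc H &
      forall G : functional R d, functional_le G F -> lsc G ->
        functional_le G H].

(* Main.v *)
(* The proof replaces measures by monotone functions: c has bounded variation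
   iff, on a set E of full measure, its increments are dominated by those of a
   nondecreasing T, and [len c] is the least total growth of such a T. Hence
   any selection p of the segments [c^l(x), c^r(x)] has variation at most
   [len c], and if c_k -> c strictly, x_k -> x and p_k -> p with p_k in the
   segment of c_k at x_k, then p lies in the segment of c at x: replacing c_k
   by the constant p_k near x_k does not lengthen it, and in the limit a detour
   through p would cost more than the jump of c.

   Relaxed <= matching: c_i o phi_i belongs to [c_i, phi_i].
   Lower semicontinuity: along an ultrafilter, near-optimal g_k in
   [c_k, phi_k] converge at every point to some g, which lies in [c, phi] by
   the segment statement; the control functions converge as well, whence
   strict convergence, and hatS is upper semicontinuous by a diagonal argument.
   Maximality: given absolutely continuous h_m -> g strictly with g in [c, phi],
   put phi_m = (phi + x/m) / (1 + 1/m), which is strictly increasing, and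
   c_m = h_m o phi_m^-1; then c_m o phi_m = h_m, and c_m -> c at each point
   where c has no jump, again by the segment statement. *)
Require Import Defs.
From HB Require Import structures.
From mathcomp Require Import all_boot all_order all_algebra.
From mathcomp Require Import all_classical all_reals all_analysis.
From mathcomp Require Import measurable_realfun ring lra.

Set Implicit Arguments.
Unset Strict Implicit.
Unset Printing Implicit Defensive.
Import Order.TTheory GRing.Theory Num.Theory.
Import numFieldTopology.Exports numFieldNormedType.Exports.

Local Open Scope classical_set_scope.
Local Open Scope ring_scope.

(** * The Euclidean norm *)

(** Curves are seen by [len] only through test fields, while the argument compares values at points.
    Two passages link these views. From test fields to increments: a plateau field whose ramps sit
    at Lebesgue points [x < y] nearly evaluates [c y - c x], and fields with separated supports add
    up. From increments to test fields: an integration by parts that never differentiates [c],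
    summed over a fine partition.

    Two obstacles shape the rest. Membership in [[c, phi]] demands [len g = len c], whereas a limit
    only yields [len g <= len c]; the converse comes from writing [c], almost everywhere, as [g]
    composed with a monotone right inverse of [phi], which is legitimate because [g] is continuous
    wherever [phi] meets a point without jump. And compactness is pointwise along an ultrafilter,
    where dominated convergence may fail; there a uniform bound on the variations, with a finite
    grid, turns pointwise into L1 convergence.

    Windows around 0 or 1 overhang [I], which is why controls live on the whole line. *)

Section enorm.
Context (R : realType) (d : nat).
Implicit Types (u v w p q : 'rV[R]_d) (a : R).

Lemma dotvC u v : dotv u v = dotv v u.
Proof. by apply: eq_bigr => i _; rewrite mulrC. Qed.

Lemma dotvDl u v w : dotv (u + v) w = dotv u w + dotv v w.
Proof. by rewrite /dotv -big_split/=; apply: eq_bigr => i _; rewrite mxE mulrDl. Qed.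

Lemma dotvDr u v w : dotv w (u + v) = dotv w u + dotv w v.
Proof. by rewrite dotvC dotvDl !(dotvC w). Qed.

Lemma dotvZl a u v : dotv (a *: u) v = a * dotv u v.
Proof. by rewrite /dotv mulr_sumr; apply: eq_bigr => i _; rewrite mxE mulrA. Qed.

Lemma dotvZr a u v : dotv u (a *: v) = a * dotv u v.
Proof. by rewrite dotvC dotvZl dotvC. Qed.

Lemma dotvNl u v : dotv (- u) v = - dotv u v.
Proof. by rewrite -scaleN1r dotvZl mulN1r. Qed.

Lemma dotvNr u v : dotv u (- v) = - dotv u v.
Proof. by rewrite dotvC dotvNl dotvC. Qed.

Lemma dotv0l u : dotv 0 u = 0.
Proof. by rewrite -(scale0r 0) dotvZl mul0r. Qed.

Lemma dotvv_ge0 u : 0 <= dotv u u.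
Proof. by apply: sumr_ge0 => i _; rewrite -expr2 sqr_ge0. Qed.

Lemma dotvv_eq0 u : dotv u u = 0 -> u = 0.
Proof.
move=> /eqP; rewrite psumr_eq0; last by move=> i _; rewrite -expr2 sqr_ge0.
move=> /allP u0; apply/rowP => i; rewrite mxE.
by have := u0 i (mem_index_enum _); rewrite -expr2 sqrf_eq0 => /eqP.
Qed.

Lemma enorm_ge0 u : 0 <= enorm u.
Proof. exact: sqrtr_ge0. Qed.

Lemma enorm_sqr u : enorm u ^+ 2 = dotv u u.
Proof. by rewrite sqr_sqrtr// dotvv_ge0. Qed.

Lemma enorm0 : enorm (0 : 'rV[R]_d) = 0.
Proof. by rewrite /enorm dotv0l sqrtr0. Qed.

Lemma enorm0_eq0 u : enorm u = 0 -> u = 0.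
Proof. by move=> u0; apply: dotvv_eq0; rewrite -enorm_sqr u0 expr0n. Qed.

Lemma enormZ a u : enorm (a *: u) = `|a| * enorm u.
Proof.
by rewrite /enorm dotvZl dotvZr mulrA -expr2 sqrtrM ?sqr_ge0// sqrtr_sqr.
Qed.

Lemma enormN u : enorm (- u) = enorm u.
Proof. by rewrite -scaleN1r enormZ normrN1 mul1r. Qed.

Lemma enormBC u v : enorm (u - v) = enorm (v - u).
Proof. by rewrite -enormN opprB. Qed.

(** Expanding the square of [enorm v *: u - enorm u *: v] gives [2 * enorm u * enorm v] times the
    desired difference. Dividing requires both norms to be nonzero, hence the degenerate cases. *)
Lemma dotv_le u v : dotv u v <= enorm u * enorm v.
Proof.
have [u0|u0] := eqVneq (enorm u) 0.
  by rewrite (enorm0_eq0 u0) dotv0l enorm0 mul0r.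
have up : 0 < enorm u by rewrite lt_def u0 enorm_ge0.
have := dotvv_ge0 (enorm v *: u - enorm u *: v).
rewrite !(dotvDl, dotvDr, dotvNl, dotvNr, dotvZl, dotvZr) -!enorm_sqr (dotvC v u).
have [v0|v0] := eqVneq (enorm v) 0.
  by rewrite (enorm0_eq0 v0) dotvC dotv0l enorm0 mulr0.
have vp : 0 < enorm v by rewrite lt_def v0 enorm_ge0.
have uv : 0 < enorm u * enorm v by rewrite mulr_gt0.
move=> H; rewrite -subr_ge0 -(pmulr_rge0 _ uv) -(pmulr_rge0 _ (ltr0n R 2)).
rewrite (le_trans H)// le_eqVlt; apply/orP; left; apply/eqP; ring.
Qed.

Lemma normr_dotv_le u v : `|dotv u v| <= enorm u * enorm v.
Proof.
by rewrite ler_norml dotv_le andbT lerNl -dotvNl (le_trans (dotv_le _ _))// enormN.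
Qed.

Lemma enormD u v : enorm (u + v) <= enorm u + enorm v.
Proof.
rewrite -(@ler_pXn2r _ 2)// ?nnegrE ?addr_ge0 ?enorm_ge0//.
rewrite enorm_sqr dotvDl !dotvDr -!enorm_sqr (dotvC v u).
have := dotv_le u v; nra.
Qed.

Lemma enormB u v : enorm (u - v) <= enorm u + enorm v.
Proof. by rewrite (le_trans (enormD _ _))// enormN. Qed.

Lemma enorm_dist3 w u v : enorm (u - v) <= enorm (u - w) + enorm (w - v).
Proof. by rewrite (le_trans _ (enormD _ _))// addrA subrK. Qed.

Lemma enorm_dual u : {v | enorm v <= 1 & dotv v u = enorm u}.
Proof.
exists ((enorm u)^-1 *: u).
  rewrite enormZ normfV ger0_norm ?enorm_ge0//.
  have [->|u0] := eqVneq (enorm u) 0; first by rewrite mulr0 ler01.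
  by rewrite mulVf.
rewrite dotvZl -enorm_sqr; have [->|u0] := eqVneq (enorm u) 0.
  by rewrite expr0n mulr0.
by rewrite expr2 mulrA mulVf// mul1r.
Qed.

Lemma normr_enorm u i : `|u 0 i| <= enorm u.
Proof.
rewrite -(@ler_pXn2r _ 2)// ?nnegrE ?enorm_ge0// enorm_sqr real_normK ?num_real//.
rewrite /dotv (bigD1 i)//= -expr2 lerDl; apply: sumr_ge0 => j _.
by rewrite -expr2 sqr_ge0.
Qed.

Lemma enorm_sum u : enorm u <= \sum_i `|u 0 i|.
Proof.
have [v v1 <-] := enorm_dual u; rewrite /dotv; apply: ler_sum => i _.
rewrite (le_trans (ler_norm _))// normrM ler_piMl//.
exact: le_trans (normr_enorm _ _) v1.
Qed.

Lemma segment_enorm p q w :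
  segment p q w -> enorm (w - p) + enorm (q - w) = enorm (q - p).
Proof.
move=> [t]; rewrite /I01 /= in_itv/= => /andP[t0 t1] <-.
have -> : (1 - t) *: p + t *: q - p = t *: (q - p).
  by apply/rowP => i; rewrite !mxE; ring.
have -> : q - ((1 - t) *: p + t *: q) = (1 - t) *: (q - p).
  by apply/rowP => i; rewrite !mxE; ring.
by rewrite !enormZ ger0_norm// ger0_norm ?subr_ge0// -mulrDl addrC subrK mul1r.
Qed.

(** Equality in the triangle inequality forces equality in Cauchy-Schwarz, and then the square
    expanded in [dotv_le] vanishes. Parallelism is stated without a quotient so as to cover zero
    vectors. *)
Lemma enormD_eq u v : enorm u + enorm v <= enorm (u + v) ->
  dotv u v = enorm u * enorm v /\ enorm v *: u = enorm u *: v.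
Proof.
move=> uv; have duv : dotv u v = enorm u * enorm v.
  apply/eqP; rewrite eq_le dotv_le/=; move: uv.
  rewrite -(@ler_pXn2r _ 2)// ?nnegrE ?addr_ge0 ?enorm_ge0//.
  rewrite enorm_sqr dotvDl !dotvDr -!enorm_sqr (dotvC v u); nra.
split=> //; apply/eqP; rewrite -subr_eq0; apply/eqP/dotvv_eq0.
rewrite !(dotvDl, dotvDr, dotvNl, dotvNr, dotvZl, dotvZr) (dotvC v u) duv -!enorm_sqr.
ring.
Qed.

(** Converse of [segment_enorm]: no detour means that [w - p] and [q - w] point the same way. This
    rests on strict convexity and would fail for the sup norm in dimension at least 2. *)
Lemma enorm_segment p q w :
  enorm (w - p) + enorm (q - w) <= enorm (q - p) -> segment p q w.
Proof.
set a : 'rV[R]_d := w - p; set b : 'rV[R]_d := q - w => ab.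
have E : q - p = a + b by apply/rowP => i; rewrite /a /b !mxE; ring.
have a0 := enorm_ge0 a; have b0 := enorm_ge0 b.
have [dab par] := enormD_eq (eq_ind _ (fun z => enorm a + enorm b <= enorm z) ab _ E).
(* The parameter of [w] will be [enorm a / (enorm a + enorm b)]; a zero denominator means that the
   three points coincide. *)
have [s0|s0] := eqVneq (enorm a + enorm b) 0.
  have a00 : enorm a = 0 by lra.
  exists 0; first by rewrite /I01/= in_itv/= lexx ler01.
  rewrite subr0 scale1r scale0r addr0.
  by move/enorm0_eq0 : a00 => /eqP; rewrite subr_eq0 => /eqP.
have sp : 0 < enorm a + enorm b by rewrite lt_def s0 addr_ge0.
exists (enorm a / (enorm a + enorm b)).
  by rewrite /I01/= in_itv/= divr_ge0 ?addr_ge0//= ler_pdivrMr// mul1r lerDl.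
have -> : w = p + a by apply/rowP => i; rewrite /a !mxE; ring.
rewrite scalerBl scale1r -addrA; congr (_ + _).
rewrite addrC -scalerBr E scalerDr mulrC -!scalerA -par !scalerA -scalerDl.
by rewrite -mulrDr mulVf// scale1r.
Qed.

Lemma segmentxx p w : segment p p w -> w = p.
Proof.
move=> /segment_enorm; rewrite subrr enorm0 => h.
have : enorm (w - p) = 0 by have := enorm_ge0 (w - p); have := enorm_ge0 (p - w); lra.
by move/enorm0_eq0/eqP; rewrite subr_eq0 => /eqP.
Qed.

Lemma segment_l p q : segment p q p.
Proof.
exists 0; first by rewrite /I01/= in_itv/= lexx ler01.
by rewrite subr0 scale1r scale0r addr0.
Qed.

End enorm.

(** * Smooth test fields *)

Section plateau.
Context (R : realType).
Implicit Types (x t h : R).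

(** A truncated square: of class C^1, as test fields have to be, and piecewise polynomial, so that
    estimates reduce to sign cases. *)
Definition sqp t : R := Num.max 0 t ^+ 2.

Lemma is_derive_sqp x : is_derive x 1 sqp (2 * Num.max 0 x).
Proof.
suff H : h^-1 *: ((sqp \o shift x) (h *: (1:R)) - sqp x) @[h --> 0^'] --> 2 * Num.max 0 x.
  by apply: DeriveDef; [apply: cvgP; exact: H|exact/cvg_lim].
apply/cvgrPdist_le => e e0; near=> h.
have h0 : h != 0 by near: h; exact: nbhs_dnbhs_neq.
have he : `|h| <= e by near: h; apply: dnbhs0_le.
rewrite /= /shift/= /GRing.scale/= mulr1.
have -> : 2 * Num.max 0 x - h^-1 * (sqp (h + x) - sqp x)
  = - h^-1 * (sqp (h + x) - sqp x - 2 * Num.max 0 x * h) by field.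
(* The remainder of the first-order expansion is at most [h ^+ 2] in each of the four sign cases. *)
rewrite normrM normrN normfV ler_pdivrMl ?normr_gt0// (@le_trans _ _ (`|h| ^+ 2))//.
  rewrite real_normK ?num_real// ler_norml /sqp.
  by case: (leP 0 x); case: (leP 0 (h + x)) => H1 H2; apply/andP; split; nra.
by rewrite expr2 ler_wpM2l.
Unshelve. all: by end_near. Qed.

(** The hat function on [[0, 1]] with peak 2 at the midpoint, hence of integral 1, as a second
    difference of truncated lines; [smoothstep] is its primitive. *)
Definition tent t : R :=
  4 * (Num.max 0 t - 2 * Num.max 0 (t - 2^-1) + Num.max 0 (t - 1)).

Definition smoothstep t : R := 2 * (sqp t - 2 * sqp (t - 2^-1) + sqp (t - 1)).

Lemma is_derive_smoothstep x : is_derive x 1 smoothstep (tent x).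
Proof.
have sh a : is_derive x 1 (fun t => sqp (t - a)) (2 * Num.max 0 (x - a)).
  have := @is_derive1_comp _ sqp (fun t => t - a) x _ _ (is_derive_sqp (x - a)) _.
  move=> /(_ 1); rewrite mulr1; apply.
  have -> : (fun t => t - a) = (id - cst a) by [].
  by apply: is_derive_eq; rewrite subr0.
rewrite /smoothstep /tent.
have h1 := is_derive_sqp x; have h2 := sh 2^-1; have h3 := sh 1.
apply: is_derive_eq; rewrite /GRing.scale/=; ring.
Qed.

Lemma continuous_max0 a : continuous (fun t => Num.max 0 (t - a) : R).
Proof.
have -> : (fun t => Num.max 0 (t - a)) = (fun t => (t - a + `|t - a|) / 2).
  by apply/funext => t; rewrite maxr_absE add0r sub0r normrN.
move=> x; have h : {for x, continuous (fun t : R => t - a)}.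
  by apply: cvgB; [exact: cvg_id|exact: cvg_cst].
apply: cvgM; last exact: cvg_cst.
by apply: cvgD => //; exact: cvg_norm.
Qed.

Lemma continuous_tent : continuous tent.
Proof.
move=> x; rewrite /tent.
have h a := @continuous_max0 a x.
apply: cvgM; first exact: cvg_cst.
apply: cvgD; last exact: h.
apply: cvgB; last by apply: cvgM; [exact: cvg_cst|exact: h].
by have := h 0; rewrite (_ : (fun t => _) = (fun t => Num.max 0 t)) ?subr0//; apply/funext => t; rewrite subr0.
Qed.

Lemma tent_ge0 t : 0 <= tent t.
Proof.
rewrite /tent; case: (leP 0 t); case: (leP 0 (t - 2^-1)); case: (leP 0 (t - 1)); lra.
Qed.

Lemma tent_le2 t : tent t <= 2.
Proof.
rewrite /tent; case: (leP 0 t); case: (leP 0 (t - 2^-1)); case: (leP 0 (t - 1)); lra.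
Qed.

Lemma tent_out t : t <= 0 \/ 1 <= t -> tent t = 0.
Proof.
rewrite /tent; case: (leP 0 t); case: (leP 0 (t - 2^-1)); case: (leP 0 (t - 1)); lra.
Qed.

Lemma smoothstep0 t : t <= 0 -> smoothstep t = 0.
Proof.
rewrite /smoothstep /sqp; case: (leP 0 t); case: (leP 0 (t - 2^-1)); case: (leP 0 (t - 1)); nra.
Qed.

Lemma smoothstep1 t : 1 <= t -> smoothstep t = 1.
Proof.
rewrite /smoothstep /sqp; case: (leP 0 t); case: (leP 0 (t - 2^-1)); case: (leP 0 (t - 1)) => *;
  try (exfalso; lra); by field.
Qed.

Lemma smoothstep_itv t : 0 <= smoothstep t <= 1.
Proof.
rewrite /smoothstep /sqp; case: (leP 0 t); case: (leP 0 (t - 2^-1)); case: (leP 0 (t - 1)) => *;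
  apply/andP; split; nra.
Qed.

(** A C^1 cutoff rising on [[x, x + h]], falling on [[y - h, y]] and equal to 1 in between. Its
    derivative is a difference of two averaging kernels, so that pairing it with a curve compares
    means near [x] and near [y]. *)
Definition plateau x y h t : R :=
  smoothstep ((t - x) / h) - smoothstep ((t - (y - h)) / h).

Definition dplateau x y h t : R :=
  h^-1 * tent ((t - x) / h) - h^-1 * tent ((t - (y - h)) / h).

Lemma is_derive_smoothstep_affine s h t :
  is_derive t 1 (fun t => smoothstep ((t - s) / h)) (h^-1 * tent ((t - s) / h)).
Proof.
have := @is_derive1_comp _ smoothstep (fun t => (t - s) / h) t _ _ (is_derive_smoothstep _) _.
move=> /(_ h^-1); rewrite mulrC; apply.
have -> : (fun t0 : R => (t0 - s) / h) = (h^-1 \*: (id - cst s)).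
  by apply/funext => u; rewrite mulrC.
by apply: is_derive_eq; rewrite subr0 /GRing.scale/= mulr1.
Qed.

Lemma continuous_tent_affine s h : continuous (fun t => h^-1 * tent ((t - s) / h)).
Proof.
move=> t; apply: cvgM; first exact: cvg_cst.
apply: (@continuous_comp _ _ _ (fun t => (t - s) / h) tent); last exact: continuous_tent.
by apply: cvgM; [apply: cvgB; [exact: cvg_id|exact: cvg_cst]|exact: cvg_cst].
Qed.

Lemma is_derive_plateau x y h t : is_derive t 1 (plateau x y h) (dplateau x y h t).
Proof.
have h1 := is_derive_smoothstep_affine x h t.
have h2 := is_derive_smoothstep_affine (y - h) h t.
exact: is_deriveB.
Qed.

Lemma continuous_dplateau x y h : continuous (dplateau x y h).
Proof. by move=> t; apply: cvgB; exact: continuous_tent_affine. Qed.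

Lemma plateau_itv x y h t : 0 < h -> x + h <= y - h -> 0 <= plateau x y h t <= 1.
Proof.
move=> h0 xy; rewrite /plateau.
have := smoothstep_itv ((t - x) / h); have := smoothstep_itv ((t - (y - h)) / h).
have [t1|t1] := leP ((t - (y - h)) / h) 0.
  by rewrite (smoothstep0 t1) subr0.
have -> : smoothstep ((t - x) / h) = 1.
  apply: smoothstep1; rewrite ler_pdivlMr// mul1r.
  by move: t1; rewrite pmulr_lgt0 ?invr_gt0//; lra.
by move=> /andP[? ?] _; apply/andP; split; lra.
Qed.

Lemma plateau_out x y h t : 0 < h -> x + h <= y - h -> ~ (x <= t <= y) -> plateau x y h t = 0.
Proof.
move=> h0 xy txy; rewrite /plateau; have [tx|tx] := ltP t x.
  by rewrite !smoothstep0 ?subrr// pmulr_lle0 ?invr_gt0//; lra.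
have ty : y < t by rewrite ltNge; apply/negP => ty; apply: txy; rewrite tx ty.
by rewrite !smoothstep1 ?subrr// ler_pdivlMr// mul1r; lra.
Qed.

End plateau.

(** * Integration on the unit interval *)

Section integral_tools.
Context (R : realType).
Notation mu := (@lebesgue_measure R).

Lemma measurable_I01 : measurable (I01 R).
Proof. exact: measurable_itv. Qed.

Lemma integrable_mul_bounded (D : set R) (f g : R -> R) (M : R) :
  measurable D -> mu.-integrable D (EFin \o f) -> measurable_fun D g ->
  (forall x, D x -> `|g x| <= M) -> mu.-integrable D (EFin \o (f \* g)).
Proof.
move=> mD fi mg gM.
have := @integrableMl _ _ _ mu D mD (EFin \o f) g fi mg; apply.
by exists M; split; [exact: num_real|move=> z Mz x Dx; exact: le_trans (gM _ Dx) (ltW Mz)].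
Qed.

Lemma integrable_cont (f : R -> R) a b : continuous f ->
  mu.-integrable `[a, b] (EFin \o f).
Proof.
move=> cf; apply: continuous_compact_integrable; first exact: segment_compact.
exact: continuous_subspaceT.
Qed.

Lemma continuous_itv_bounded (f : R -> R) a b : a <= b -> continuous f ->
  exists2 M, 0 <= M & forall x, a <= x <= b -> `|f x| <= M.
Proof.
move=> ab cf.
have [c cab cM] := @EVT_max R (fun x => `|f x|) a b ab
  (continuous_subspaceT (fun x => cvg_norm (cf x))).
exists `|f c|; first by [].
by move=> x xab; apply: cM; rewrite in_itv.
Qed.

Lemma Rintegral_ae_le (D : set R) (f g : R -> R) : measurable D ->
  mu.-integrable D (EFin \o f) -> mu.-integrable D (EFin \o g) ->
  (forall x, D x -> 0 <= g x) ->
  {ae mu, forall x, D x -> `|f x| <= g x} ->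
  `|\int[mu]_(x in D) f x| <= \int[mu]_(x in D) g x.
Proof.
move=> mD fi gi g0 fg; rewrite (le_trans (le_normr_Rintegral _ _))//.
have fi' : mu.-integrable D (EFin \o (fun x => `|f x|)) by exact: integrable_norm.
rewrite /Rintegral fine_le//; [exact: integrable_fin_num|exact: integrable_fin_num|].
apply: ae_ge0_le_integral => //; [exact: measurable_int fi'|exact: measurable_int gi].
Qed.

Lemma Rintegral_ftc (F : R -> R) a b : a <= b ->
  (forall x, derivable F x 1) -> continuous (derive1 F) ->
  \int[mu]_(x in `[a, b]) derive1 F x = F b - F a.
Proof.
move=> ab dF cF; have [<-|nab] := eqVneq a b.
  by rewrite set_itv1 Rintegral_set1 subrr.
have ltab : a < b by rewrite lt_neqAle nab.
have cont x : {for x, continuous F}.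
  by apply/differentiable_continuous/derivable1_diffP; exact: dF.
have cont' : {within `[a, b], continuous (derive1 F)} by exact: continuous_subspaceT.
have dab : derivable_oo_LRcontinuous F a b.
  split; first by move=> *; exact: dF.
    exact/cvg_at_right_filter/cont.
  exact/cvg_at_left_filter/cont.
by rewrite /Rintegral (continuous_FTC2 ltab cont' dab (fun _ _ => erefl)).
Qed.

End integral_tools.

Section curve_tools.
Context (R : realType) (d : nat).
Notation mu := (@lebesgue_measure R).
Implicit Types (c psi : R -> 'rV[R]_d).

Definition curve_integrable c := forall i : 'I_d,
  mu.-integrable (I01 R) (fun x => (c x 0 i)%:E).

Lemma measurable_dotv (D : set R) c psi :
  (forall i, measurable_fun D (fun x => c x 0 i)) ->
  (forall i, measurable_fun D (fun x => psi x 0 i)) ->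
  measurable_fun D (fun x => dotv (c x) (psi x)).
Proof.
move=> mc mp; rewrite /dotv; apply: measurable_sum => i.
by apply: measurable_funM.
Qed.

Lemma measurable_enorm (D : set R) c :
  (forall i, measurable_fun D (fun x => c x 0 i)) ->
  measurable_fun D (fun x => enorm (c x)).
Proof.
move=> mc; rewrite /enorm.
apply: (@measurableT_comp _ _ _ _ _ _ (@Num.sqrt R) _ (fun x => dotv (c x) (c x))).
  by apply: continuous_measurable_fun; exact: sqrt_continuous.
exact: measurable_dotv.
Qed.

Lemma measurable_curve c : curve_integrable c ->
  forall i, measurable_fun (I01 R) (fun x => c x 0 i).
Proof. by move=> ci i; have /integrableP[mc _] := ci i; exact/measurable_EFinP. Qed.

Lemma integrable_enorm c : curve_integrable c ->
  mu.-integrable (I01 R) (EFin \o (fun x => enorm (c x))).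
Proof.
move=> ci.
have me : measurable_fun (I01 R) (fun x => enorm (c x)).
  by apply: measurable_enorm => i; exact: measurable_curve.
apply: (@le_integrable _ _ _ mu (I01 R) _ _
   (fun x => \sum_(i < d) `|(c x 0 i)%:E|)%E) => //.
- exact: measurable_I01.
- exact/measurable_EFinP.
- move=> x _ /=; rewrite sumEFin /= lee_fin ger0_norm ?enorm_ge0//.
  by rewrite ger0_norm ?sumr_ge0// enorm_sum.
- apply: integrable_sum; first exact: measurable_I01.
  by move=> i _; apply: integrable_abse; exact: ci.
Qed.

Lemma curve_integrableD c psi : curve_integrable c -> curve_integrable psi ->
  curve_integrable (fun x => c x + psi x).
Proof.
move=> ci pi i; rewrite [X in mu.-integrable _ X](_ : _ =
  (fun x => (c x 0 i)%:E) \+ (fun x => (psi x 0 i)%:E))%E.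
  by apply: integrableD; [exact: measurable_I01|exact: ci|exact: pi].
by apply/funext => x /=; rewrite mxE.
Qed.

Lemma curve_integrableN c : curve_integrable c -> curve_integrable (fun x => - c x).
Proof.
move=> ci i; rewrite [X in mu.-integrable _ X](_ : _ = \- (fun x => (c x 0 i)%:E))%E.
  by apply: integrableN; exact: ci.
by apply/funext => x /=; rewrite mxE.
Qed.

Lemma curve_integrableB c psi : curve_integrable c -> curve_integrable psi ->
  curve_integrable (fun x => c x - psi x).
Proof. by move=> ci /curve_integrableN; exact: curve_integrableD. Qed.

Lemma curve_integrable_cst (v : 'rV[R]_d) : curve_integrable (fun=> v).
Proof. by move=> i; apply: (@integrable_cont _ (cst (v 0 i))); exact: cst_continuous. Qed.

Lemma integrable_dotv c psi : curve_integrable c ->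
  (forall i, continuous (fun x => psi x 0 i)) ->
  mu.-integrable (I01 R) (EFin \o (fun x => dotv (c x) (psi x))).
Proof.
move=> ci cp; rewrite [X in mu.-integrable _ X](_ : _ =
  (fun x => (\sum_(i < d) (EFin \o ((fun x => c x 0 i) \* (fun x => psi x 0 i))%R) x)%E)); last first.
  by apply/funext => x /=; rewrite sumEFin.
apply: integrable_sum; first exact: measurable_I01.
move=> i _; have [M M0 hM] := @continuous_itv_bounded R _ 0 1 ler01 (cp i).
apply: (@integrable_mul_bounded _ _ _ _ M); [exact: measurable_I01|exact: ci| |].
  by apply: measurable_funTS; apply: continuous_measurable_fun; exact: cp.
by move=> x; rewrite /I01/= in_itv/=; exact: hM.
Qed.

Lemma test_velocity_continuous psi : test_field psi ->
  forall i, continuous (fun x => velocity psi x 0 i).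
Proof.
move=> [_ [cp _]] i; have -> : (fun x => velocity psi x 0 i) = derive1 (fun y => psi y 0 i).
  by apply/funext => x; rewrite mxE.
exact: cp.
Qed.

Lemma test_velocity_bounded psi : test_field psi ->
  exists2 M, 0 <= M & forall x, I01 R x -> enorm (velocity psi x) <= M.
Proof.
move=> tp.
have /choice[M hM] : forall i, exists M, 0 <= M /\ forall x : R, 0 <= x <= 1 -> `|velocity psi x 0 i| <= M.
  move=> i; have [M M0 hM] := @continuous_itv_bounded R _ 0 1 ler01 (@test_velocity_continuous psi tp i).
  by exists M.
exists (\sum_i M i); first by apply: sumr_ge0 => i _; case: (hM i).
move=> x; rewrite /I01/= in_itv/= => xI; rewrite (le_trans (enorm_sum _))// ler_sum// => i _.
by case: (hM i) => _; apply.
Qed.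

Lemma integrable_test c psi : curve_integrable c -> test_field psi ->
  mu.-integrable (I01 R) (EFin \o (fun x => dotv (c x) (velocity psi x))).
Proof. by move=> ci tp; apply: integrable_dotv => //; exact: test_velocity_continuous. Qed.

(** For a fixed test field the pairing is Lipschitz in the L1 distance. Thus [len] is a supremum of
    L1-continuous functionals, the source of its lower semicontinuity. *)
Lemma distr_deriv_dist c c' psi M : curve_integrable c -> curve_integrable c' ->
  test_field psi -> (forall x, I01 R x -> enorm (velocity psi x) <= M) ->
  `|distr_deriv c psi - distr_deriv c' psi| <=
    M * \int[mu]_(x in I01 R) enorm (c x - c' x).
Proof.
move=> ci ci' tp hM; rewrite /distr_deriv opprK addrC -RintegralB; first last.
- exact: integrable_test.
- exact: integrable_test.
- exact: measurable_I01.
have ei : mu.-integrable (I01 R) (EFin \o (fun x => enorm (c x - c' x))).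
  by apply: integrable_enorm; exact: curve_integrableB.
rewrite -RintegralZl//; last exact: measurable_I01.
apply: Rintegral_ae_le.
- exact: measurable_I01.
- rewrite [X in mu.-integrable _ X](_ : _ = (EFin \o (fun x => dotv (c' x) (velocity psi x)))
    \- (EFin \o (fun x => dotv (c x) (velocity psi x))))%E; last by [].
  by apply: integrableB; [exact: measurable_I01|exact: integrable_test|exact: integrable_test].
- by apply: (integrableZl _ M ei); exact: measurable_I01.
- by move=> x Ix; rewrite mulr_ge0 ?enorm_ge0// (le_trans (enorm_ge0 _) (hM _ Ix)).
- apply: aeW => x Ix; rewrite -dotvNl -dotvDl.
  rewrite (le_trans (normr_dotv_le _ _))// mulrC enormBC.
  by rewrite ler_wpM2r ?enorm_ge0// hM.
Qed.

End curve_tools.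

(** * Control functions *)

Section len_control.
Context (R : realType) (d : nat).
Notation mu := (@lebesgue_measure R).
Implicit Types (c psi f : R -> 'rV[R]_d) (E : set R) (T : R -> R).

Definition controlled E T f :=
  forall x y, E x -> E y -> x <= y -> enorm (f y - f x) <= T y - T x.

Lemma ae_imp (P Q : set R) : (forall x, P x -> Q x) ->
  {ae mu, forall x, P x} -> {ae mu, forall x, Q x}.
Proof.
move=> PQ [N [mN N0 PN]]; exists N; split => // x Qx; apply: PN => Px.
by apply: Qx; exact: PQ.
Qed.

Lemma ae_and (P Q : set R) : {ae mu, forall x, P x} -> {ae mu, forall x, Q x} ->
  {ae mu, forall x, P x /\ Q x}.
Proof.
move=> [N [mN N0 PN]] [M [mM M0 QM]]; exists (N `|` M); split.
- exact: measurableU.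
- exact: null_set_setU.
- move=> x /not_andP[Px|Qx]; [left; exact: PN|right; exact: QM].
Qed.

Lemma ae_dense (P : set R) a b : {ae mu, forall x, P x} -> a < b ->
  exists2 x, P x & a < x < b.
Proof.
move=> [N [mN N0 PN]] ab; apply: contrapT => H.
have abN : `]a, b[%classic `<=` N.
  by move=> x; rewrite /= in_itv/= => xab; apply: PN => Px; apply: H; exists x.
have : (mu `]a, b[ <= mu N)%E by apply: le_measure => //; rewrite inE//; exact: measurable_itv.
by rewrite N0 lebesgue_measure_itv/= lte_fin ab -EFinB lee_fin leNgt subr_gt0 ab.
Qed.

Lemma is_derive_dotv_test (v : 'rV[R]_d) psi (t : R) : test_field psi ->
  is_derive t 1 (fun t => dotv v (psi t)) (dotv v (velocity psi t)).
Proof.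
move=> [dp _].
have -> : (fun t => dotv v (psi t)) = \sum_(i < d) (v 0 i *: (fun t => psi t 0 i)).
  by apply/funext => s; rewrite fct_sumE; apply: eq_bigr => i _; rewrite fctE.
have H i : is_derive t 1 (v 0 i *: (fun t => psi t 0 i)) (v 0 i *: velocity psi t 0 i).
  have h : is_derive t 1 (fun t => psi t 0 i) (velocity psi t 0 i).
    by apply: DeriveDef; [exact: dp|rewrite mxE derive1E].
  exact: is_deriveZ.
by have := is_derive_sum H.
Qed.

Lemma continuous_dotv (v : 'rV[R]_d) psi :
  (forall i, continuous (fun x => psi x 0 i)) -> continuous (fun t => dotv v (psi t)).
Proof.
move=> cp t; rewrite /dotv.
have -> : (fun t => \sum_(i < d) v 0 i * psi t 0 i) = \sum_(i < d) (fun t => v 0 i * psi t 0 i).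
  by apply/funext => s; rewrite fct_sumE.
have : forall x, {for x, continuous (\sum_(i < d) (fun t : R => v 0 i * psi t 0 i))}; last by apply.
elim/big_ind: _ => [x|f g cf cg x|i _ x].
- exact: cvg_cst.
- by apply: cvgD; [exact: cf|exact: cg].
- by apply: cvgM; [exact: cvg_cst|exact: cp].
Qed.

Lemma Rintegral_dotv_test (v : 'rV[R]_d) psi a b : test_field psi -> a <= b ->
  \int[mu]_(x in `[a, b]) dotv v (velocity psi x) = dotv v (psi b - psi a).
Proof.
move=> tp ab; have dd t := is_derive_dotv_test v t tp.
have -> : (fun x => dotv v (velocity psi x)) = derive1 (fun t => dotv v (psi t)).
  by apply/funext => t; rewrite derive1E derive_val.
rewrite Rintegral_ftc//; first by rewrite dotvDr dotvNr.
have -> : derive1 (fun t => dotv v (psi t)) = (fun x => dotv v (velocity psi x)).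
  by apply/funext => t; rewrite derive1E derive_val.
by apply: continuous_dotv => i; exact: test_velocity_continuous.
Qed.

Lemma test_velocity_out psi a b t : test_field psi ->
  (forall x, ~ (a <= x <= b) -> psi x = 0) -> ~ (a <= t <= b) -> velocity psi t = 0.
Proof.
move=> tp p0 tab; apply/rowP => i; rewrite !mxE derive1E.
rewrite (@near_eq_derive _ _ _ _ (cst 0)) ?derive_cst//.
have o : open (~` `[a, b]%classic) by apply: closed_openC; exact: interval_closed.
have : nbhs t (~` `[a, b]%classic) by apply: open_nbhs_nbhs; split => //=; rewrite in_itv.
by apply: filterS => x /= xab; rewrite p0 ?mxE//; move: xab; rewrite in_itv.
Qed.

Lemma integrable_I01_sub (f : R -> R) a b :
  0 <= a -> b <= 1 -> mu.-integrable (I01 R) (EFin \o f) ->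
  mu.-integrable `[a, b] (EFin \o f).
Proof.
move=> a0 b1; apply: integrableS; [exact: measurable_I01|exact: measurable_itv|].
move=> x; rewrite /I01/= !in_itv/= => /andP[ax xb].
by rewrite (le_trans a0 ax) (le_trans xb b1).
Qed.

Lemma Rintegral_split (f : R -> R) x y : 0 <= x -> x <= y -> y <= 1 ->
  mu.-integrable (I01 R) (EFin \o f) ->
  \int[mu]_(t in `[0, y]) f t =
  \int[mu]_(t in `[0, x]) f t + \int[mu]_(t in `[x, y]) f t.
Proof.
move=> x0 xy y1 fi; have fi' : mu.-integrable `[0, y] (EFin \o f).
  exact: integrable_I01_sub.
apply/eqP; rewrite addrC -subr_eq; apply/eqP.
rewrite (@Rintegral_itvB _ f (BLeft 0) (BRight y) x)//.
rewrite Rintegral_itv_obnd_cbnd//.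
apply: integrableS fi' => //; apply: subset_itvr; rewrite bnd_simp//.
Qed.

Lemma Rintegral_eq0 (f : R -> R) (D : set R) : (forall x, D x -> f x = 0) ->
  \int[mu]_(t in D) f t = 0.
Proof.
move=> f0; rewrite (@eq_Rintegral _ _ _ mu D (cst 0)).
  by rewrite /Rintegral integral0.
by move=> x /set_mem; exact: f0.
Qed.

Lemma Rintegral_cst_itv (k x y : R) : x <= y ->
  \int[mu]_(t in `[x, y]) k = k * (y - x).
Proof.
move=> xy; transitivity (k * fine (mu `[x, y]%classic)).
  by apply: Rintegral_cst; exact: measurable_itv.
rewrite lebesgue_measure_itv/= lte_fin; case: ltP => //= yx.
by rewrite (_ : y = x) ?subrr//; apply/eqP; rewrite eq_le yx xy.
Qed.

(** The function [A] below runs from 0 to [distr_deriv c psi], and its increments are dominated by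
    those of [T] up to a factor that tends to 1 with the mesh. Summing over a fine partition by
    points of [E] gives the bound. *)
Lemma len_le_control c E T : curve_integrable c ->
  {homo T : x y / x <= y} ->
  {ae mu, forall x, 0 < x < 1 -> E x} ->
  controlled (E `&` `]0, 1[) T c -> (len c <= (T 1 - T 0)%:E)%E.
Proof.
move=> ci mT aE cT; apply: ge_ereal_sup => _ /= [psi [tp psi1] <-]; rewrite lee_fin.
have [_ [_ [a0 [b0 [a00 b01 out0]]]]] := tp.
have [M M0 hM] := test_velocity_bounded tp.
(* Enlarging the support interval ensures [a < b]; the bounds supplied with a zero field may be in
   the wrong order. *)
pose a := Num.min a0 4^-1; pose b := Num.max b0 (3/4).
have a_gt0 : 0 < a by rewrite lt_min a00/=; lra.
have b_lt1 : b < 1 by rewrite gt_max b01/=; lra.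
have ab : a < b by rewrite gt_min !lt_max; apply/orP; right; apply/orP; right; lra.
have out x : ~ (a <= x <= b) -> psi x = 0.
  move=> xab; apply: out0 => /andP[h1 h2]; apply: xab.
  by rewrite ge_min h1 le_max h2.
have vout x := test_velocity_out tp out (t := x).
clearbody a b; pose G := E `&` `]0, 1[.
pose h t := dotv (c t) (velocity psi t).
have hi : mu.-integrable (I01 R) (EFin \o h) by exact: integrable_test.
pose A x := (- \int[mu]_(t in `[0, x]) h t) + dotv (c x) (psi x).
have step x y : G x -> G y -> x <= y -> `|A y - A x| <= (T y - T x) * (1 + M * (y - x)).
  move=> Gx Gy xy; have [_ x01] := Gx; have [_ y01] := Gy.
  move: (x01) (y01); rewrite /= !in_itv/= => /andP[x0 x1] /andP[y0 y1].
  have I_sub t : `[x, y]%classic t -> I01 R t.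
    rewrite /I01 /= !in_itv/= => /andP[xt ty].
    by rewrite (le_trans (ltW x0) xt) (le_trans ty (ltW y1)).
  have ki : mu.-integrable `[x, y] (EFin \o (fun t => dotv (c x) (velocity psi t))).
    apply: integrable_cont; apply: continuous_dotv => i; exact: test_velocity_continuous.
  have hxy : mu.-integrable `[x, y] (EFin \o h).
    by apply: integrable_I01_sub => //; exact: ltW.
  (* Subtracting the constant [c x] under the integral is compensated by the boundary terms, so only
     increments of [c] remain. *)
  have E1 : A y - A x = (- \int[mu]_(t in `[x, y]) (h t - dotv (c x) (velocity psi t)))
      + dotv (c y - c x) (psi y).
    rewrite RintegralB//; rewrite Rintegral_dotv_test//.
    rewrite /A (Rintegral_split (ltW x0) xy (ltW y1) hi).
    rewrite dotvDr dotvDl !dotvNr !dotvNl; ring.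
  rewrite E1 mulrDr mulr1 addrC (le_trans (ler_normD _ _))// lerD//.
    rewrite (le_trans (normr_dotv_le _ _))// -[leRHS]mulr1 ler_pM ?enorm_ge0//.
    exact: cT.
  rewrite normrN.
  have -> : (T y - T x) * (M * (y - x)) = \int[mu]_(t in `[x, y]) (M * (T y - T x)).
    by rewrite Rintegral_cst_itv//; ring.
  have Txy : 0 <= T y - T x by rewrite subr_ge0 mT.
  apply: Rintegral_ae_le.
  - exact: measurable_itv.
  - rewrite [X in mu.-integrable _ X](_ : _ = (EFin \o h) \-
      (EFin \o (fun t => dotv (c x) (velocity psi t))))%E; last by [].
    by apply: integrableB => //; exact: measurable_itv.
  - apply: integrable_cont; exact: cst_continuous.
  - by move=> *; exact: mulr_ge0.
  - apply: ae_imp aE => t Et txy; have It := I_sub _ txy.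
    move: (txy); rewrite /= in_itv/= => /andP[xt ty].
    have t01 : 0 < t < 1 by rewrite (lt_le_trans x0 xt) (le_lt_trans ty y1).
    have Gt : G t by split; [exact: Et|rewrite /= in_itv].
    rewrite /h -dotvNl -dotvDl (le_trans (normr_dotv_le _ _))// mulrC.
    apply: ler_pM; rewrite ?enorm_ge0//; first exact: hM.
    by rewrite (le_trans (cT _ _ Gx Gt xt))// lerD2r mT.
apply/ler_addgt0Pr => e e0.
pose D := T 1 - T 0.
have D0 : 0 <= D by rewrite subr_ge0 mT ?ler01.
(* A mesh below [a] and [1 - b] puts the first and last nodes outside the support; the third bound
   keeps the total excess [2 * M * D / N] below [e]. *)
pose r := Num.min (Num.min a (1 - b)) (e / (2 * M * D + 1)).
have q0 : 0 < 2 * M * D + 1 by rewrite ltr_wpDl// !mulr_ge0.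
have r0 : 0 < r by rewrite !lt_min a_gt0 subr_gt0 b_lt1 divr_gt0.
have [n nr] : exists n : nat, n.+1%:R^-1 < r.
  exists (Num.truncn (r^-1)).
  by rewrite invf_plt ?posrE// truncnS_gt.
set N : R := n.+1%:R; have N0 : 0 < N by rewrite ltr0n.
move: nr; rewrite !lt_min => /andP[/andP[na nb] ne].
have aG : {ae mu, forall x, 0 < x < 1 -> G x}.
  by apply: ae_imp aE => x Ex x01; split; [exact: Ex|rewrite /= in_itv].
(* One node of [G] per cell of length [1 / N]; consecutive nodes are then less than [2 / N]
   apart. *)
have /choice[x_ hx_] : forall j, exists x, (j < n.+1)%N -> G x /\ j%:R / N < x < j.+1%:R / N.
  move=> j; have [jn|jn] := leqP j n; last by exists 0; rewrite ltnNge jn.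
  have [|x Px xj] := @ae_dense _ (j%:R / N) (j.+1%:R / N) aG.
    by rewrite ltr_pM2r ?invr_gt0// ltr_nat.
  exists x => _; split => //; apply: Px; case/andP : xj => xj xj1.
  rewrite (le_lt_trans _ xj) ?(divr_ge0 (ler0n _ _) (ltW N0))//=.
  by rewrite (lt_le_trans xj1)// ler_pdivrMr// mul1r ler_nat.
have tele k : (k <= n)%N ->
  A (x_ k) - A (x_ 0%N) <= (T (x_ k) - T (x_ 0%N)) * (1 + M * (2 / N)).
  elim: k => [_|k IH kn]; first by rewrite !subrr mul0r.
  have [Gk /andP[k1 k2]] := hx_ k (ltnW kn).
  have [Gk' /andP[k1' k2']] := hx_ k.+1 kn.
  have kk : x_ k <= x_ k.+1 by rewrite ltW// (lt_trans k2).
  have dk : x_ k.+1 - x_ k <= 2 / N.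
    have -> : 2 / N = k.+2%:R / N - k%:R / N by rewrite -mulrBl -(addn2 k) natrD addrAC subrr add0r.
    by rewrite lerB// ltW.
  have := le_trans (ler_norm _) (step _ _ Gk Gk' kk).
  have Tk : 0 <= T (x_ k.+1) - T (x_ k) by rewrite subr_ge0 mT.
  have : (T (x_ k.+1) - T (x_ k)) * (1 + M * (x_ k.+1 - x_ k)) <=
         (T (x_ k.+1) - T (x_ k)) * (1 + M * (2 / N)).
    by rewrite ler_wpM2l// lerD2l ler_wpM2l.
  move: (IH (ltnW kn)) => H1 H2 H3; move: (le_trans H3 H2) H1.
  move: (1 + M * (2 / N)) => K.
  by rewrite -[T (x_ k.+1) - T (x_ 0%N)](subrKA (T (x_ k))) mulrDl; lra.
have [Gn /andP[n1 n2]] := hx_ n (ltnSn n).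
have [G0 /andP[z1 z2]] := hx_ 0%N (ltn0Sn n).
have x0a : x_ 0%N < a by rewrite (lt_trans z2)// mul1r.
have xnb : b < x_ n.
  rewrite (lt_trans _ n1)//; have -> : n%:R / N = 1 - N^-1.
    have -> : n%:R = N - 1 by rewrite /N -natr1 addrK.
    by rewrite mulrBl mul1r mulfV// gt_eqF.
  by rewrite ltrBrDl -ltrBrDr.
have xn1 : x_ n <= 1 by rewrite ltW// (lt_le_trans n2)// mulfV// gt_eqF.
have A0 : A (x_ 0%N) = 0.
  rewrite /A out; last by move=> /andP[ax _]; move: x0a; rewrite ltNge ax.
  rewrite dotvC dotv0l addr0 Rintegral_eq0 ?oppr0// => t; rewrite /= in_itv/= => /andP[_ tx].
  rewrite /h vout; first by rewrite dotvC dotv0l.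
  by move=> /andP[at' _]; move: (le_lt_trans tx x0a); rewrite ltNge at'.
have An : A (x_ n) = distr_deriv c psi.
  rewrite /A out; last by move=> /andP[_ ax]; move: xnb; rewrite ltNge ax.
  rewrite dotvC dotv0l addr0 /distr_deriv; congr (- _).
  rewrite /I01 [RHS](Rintegral_split (x := x_ n))//; last first.
    exact: ltW (lt_trans (lt_trans a_gt0 ab) xnb).
  rewrite [X in _ = _ + X]Rintegral_eq0 ?addr0//.
  move=> t; rewrite /= in_itv/= => /andP[tx _].
  rewrite vout; first by rewrite dotvC dotv0l.
  by move=> /andP[_ tb]; move: (lt_le_trans xnb tx); rewrite ltNge tb.
have := tele n (leqnn n); rewrite A0 An subr0 => H; rewrite (le_trans H)//.
have T1 : T (x_ n) - T (x_ 0%N) <= D.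
  by rewrite lerB// mT// ltW//; move: z1; rewrite mul0r.
apply: (@le_trans _ _ (D * (1 + M * (2 / N)))).
  by rewrite ler_wpM2r// addr_ge0// mulr_ge0// divr_ge0// ltW.
rewrite mulrDr mulr1 lerD2l.
have : N^-1 * (2 * M * D + 1) < e by rewrite -ltr_pdivlMr.
have : 0 < N^-1 by rewrite invr_gt0.
move: (N^-1) => v; move: D {D0 T1 r q0 ne r0 H} => D; lra.
Qed.

End len_control.

(** * Lebesgue points *)

Section lebesgue_values.
Context (R : realType).
Notation mu := (@lebesgue_measure R).

Lemma integrableRB (D : set R) (f g : R -> R) : measurable D ->
  mu.-integrable D (EFin \o f) -> mu.-integrable D (EFin \o g) ->
  mu.-integrable D (EFin \o (fun x => f x - g x)).
Proof.
move=> mD fi gi; rewrite [X in mu.-integrable _ X](_ : _ = (EFin \o f) \- (EFin \o g))%E//.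
exact: integrableB.
Qed.

Lemma integrable_Rsum (D : set R) n (f : 'I_n -> R -> R) : measurable D ->
  (forall i, mu.-integrable D (EFin \o f i)) ->
  mu.-integrable D (EFin \o (fun x => \sum_(i < n) f i x)).
Proof.
move=> mD fi; rewrite [X in mu.-integrable _ X](_ : _ =
  (fun x => \sum_(i < n) (EFin \o f i) x)%E).
  by apply: integrable_sum.
by apply/funext => x; rewrite /= sumEFin.
Qed.

Lemma Rintegral_sum (D : set R) n (f : 'I_n -> R -> R) : measurable D ->
  (forall i, mu.-integrable D (EFin \o f i)) ->
  \int[mu]_(x in D) (\sum_(i < n) f i x) = \sum_(i < n) \int[mu]_(x in D) f i x.
Proof.
move=> mD fi; rewrite [LHS]/Rintegral [X in fine X](_ : _ =
  (\sum_(i < n) \int[mu]_(x in D) f i x)%:E)//.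
transitivity (\sum_(i < n) \int[mu]_(x in D) (EFin \o f i) x)%E.
  rewrite -integral_sum//.
  by apply: eq_integral => x _; rewrite /= sumEFin.
rewrite -sumEFin; apply: eq_bigr => i _; rewrite fineK//.
have := @integrable_fin_num _ _ R mu D mD (EFin \o f i) (fi i). exact.
Qed.

Lemma fine_le_EFin (x : \bar R) (r : R) : (0 <= x)%E -> (x <= r%:E)%E -> fine x <= r.
Proof. by case: x => //=. Qed.

Lemma lebesgue_pt_I01 (g : R -> R) x e : 0 < x < 1 -> 0 < e ->
  mu.-integrable (I01 R) (EFin \o g) -> lebesgue_pt (g \_ (I01 R)) x ->
  \forall h \near 0^'+, \int[mu]_(t in `[x - h, x + h]) `|g t - g x| <= e * h.
Proof.
move=> /andP[x0 x1] e0 gi; rewrite /lebesgue_pt => L.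
(* The mean is over a ball of measure [2 * h], so [e / 2] for the mean becomes [e * h] for the
   integral. *)
have N0 : nbhs (0%E : \bar R) [set y | (y < (e / 2)%:E)%E].
  apply: open_nbhs_nbhs; split; first exact: open_ereal_lt_ereal.
  by rewrite /= lte_fin divr_gt0.
have {L N0} := L _ N0; rewrite nbhs_filterE => L.
near=> h.
have h0 : 0 < h by near: h; exact: nbhs_right_gt.
have hx : h < x by near: h; exact: nbhs_right_lt.
have hx1 : h < 1 - x by near: h; apply: nbhs_right_lt; rewrite subr_gt0.
have : (davg (g \_ (I01 R)) x h < (e / 2)%:E)%E by near: h; exact: L.
rewrite /davg /iavg lebesgue_measure_ball ?(ltW h0)//.
have sub t : ball x h t -> I01 R t.
  rewrite ball_itv /I01/= !in_itv/= => /andP[t1 t2].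
  by apply/andP; split; apply: ltW; lra.
have xI : I01 R x by apply: sub; exact: ballxx.
rewrite [X in (_ * X < _)%E -> _](_ : _ =
    (\int[mu]_(t in ball x h) (`|g t - g x|)%:E)%E); last first.
  apply: eq_integral => t /set_mem tb; rewrite /= /shift/= !patchE.
  by rewrite !mem_set//; exact: sub.
have mg : measurable_fun (I01 R) g by by apply/measurable_EFinP; case/integrableP : gi.
rewrite inver mulrn_eq0/= gt_eqF// lte_pdivrMl ?mulrn_wgt0// => H.
rewrite /Rintegral (@integral_itv_bndoo _ _ _ _ true false); last first.
  rewrite -ball_itv; apply/measurable_EFinP; apply: measurableT_comp => //.
  apply: measurable_funB; last exact: measurable_cst.
  by apply: measurable_funS mg => //; exact: measurable_I01.
apply: fine_le_EFin; first by apply: integral_ge0 => *; rewrite lee_fin.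
rewrite -ball_itv (le_trans (ltW H))// -EFinM lee_fin mulr2n; lra.
Unshelve. all: by end_near. Qed.

End lebesgue_values.

Section lebesgue_curve.
Context (R : realType) (d : nat).
Notation mu := (@lebesgue_measure R).
Implicit Types (c : R -> 'rV[R]_d).

(** A Lebesgue point, in the Euclidean norm and with the denominator cleared. It ties the value
    [c x] to the means that test fields can detect. *)
Definition lebesgue_value c (x : R) := forall e : R, 0 < e -> \forall h \near 0^'+,
  \int[mu]_(t in `[x - h, x + h]) enorm (c t - c x) <= e * h.

Lemma ae_lebesgue_value c : curve_integrable c ->
  {ae mu, forall x, 0 < x < 1 -> lebesgue_value c x}.
Proof.
move=> ci.
have H (i : 'I_d) : {ae mu, forall x, lebesgue_pt ((fun t => c t 0 i) \_ (I01 R)) x}.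
  apply: lebesgue_differentiation; apply: integrable_locally; first exact: measurable_I01.
  exact: ci.
have : {ae mu, forall x, forall n, forall i : 'I_d, val i = n ->
    lebesgue_pt ((fun t => c t 0 i) \_ (I01 R)) x}.
  apply: ae_foralln => n; have [nd|nd] := ltnP n d.
    apply: ae_imp (H (Ordinal nd)) => x hx i ni.
    by have -> : i = Ordinal nd by exact: val_inj.
  by apply: aeW => x i ni; move: nd; rewrite -ni leqNgt ltn_ord.
apply: ae_imp => x Lx x01 e e0.
(* The error is shared among the coordinates; [d.+1] keeps the quotient positive when [d] is 0. *)
have e'0 : 0 < e / d.+1%:R by rewrite divr_gt0// ltr0n.
have : \forall h \near 0^'+, forall i : 'I_d,
    \int[mu]_(t in `[x - h, x + h]) `|c t 0 i - c x 0 i| <= e / d.+1%:R * h.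
  apply: filter_forall => i; apply: lebesgue_pt_I01 => //; first exact: ci.
  exact: (Lx i).
move=> Hi; near=> h.
have h0 : 0 < h by near: h; exact: nbhs_right_gt.
have hx : h < x by near: h; apply: nbhs_right_lt; case/andP: x01.
have hx1 : h < 1 - x by near: h; apply: nbhs_right_lt; rewrite subr_gt0; case/andP: x01.
have Hi' : forall i : 'I_d, \int[mu]_(t in `[x - h, x + h]) `|c t 0 i - c x 0 i| <= e / d.+1%:R * h.
  by near: h; exact: Hi.
have xh0 : 0 <= x - h by rewrite subr_ge0 ltW.
have xh1 : x + h <= 1 by rewrite -lerBrDl ltW.
have ii (i : 'I_d) : mu.-integrable `[x - h, x + h] (EFin \o (fun t => `|c t 0 i - c x 0 i|)).
  apply: integrable_I01_sub => //; apply: integrable_norm.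
  apply: integrableRB; [exact: measurable_I01|exact: ci|].
  exact: (@curve_integrable_cst R d (c x) i).
apply: (@le_trans _ _ (\sum_(i < d) \int[mu]_(t in `[x - h, x + h]) `|c t 0 i - c x 0 i|)).
  rewrite -(@Rintegral_sum R _ _ (fun i t => `|c t 0 i - c x 0 i|))//.
  have ee : mu.-integrable `[x - h, x + h] (EFin \o (fun t => enorm (c t - c x))).
    apply: integrable_I01_sub => //; apply: integrable_enorm; apply: curve_integrableB => //.
    exact: curve_integrable_cst.
  apply: le_Rintegral => //.
    exact: (@integrable_Rsum R _ _ (fun i t => `|c t 0 i - c x 0 i|)).
  move=> t _; rewrite (le_trans (enorm_sum _))//.
  by apply: ler_sum => i _; rewrite !mxE.
apply: (@le_trans _ _ (\sum_(i < d) (e / d.+1%:R * h))); first by apply: ler_sum => i _; exact: Hi'.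
rewrite sumr_const card_ord -mulrnAl ler_wpM2r ?(ltW h0)// -mulr_natr.
by rewrite mulrAC ler_pdivrMr ?ltr0n// ler_wpM2l ?(ltW e0)// ler_nat.
Unshelve. all: by end_near. Qed.

End lebesgue_curve.

(** * Plateau fields evaluate increments at Lebesgue points *)

Section test_fields.
Context (R : realType) (d : nat).
Notation mu := (@lebesgue_measure R).
Implicit Types (c psi phi : R -> 'rV[R]_d) (x y h e : R) (u v : 'rV[R]_d).

Lemma Rintegral_subset (A B : set R) (f : R -> R) : measurable A -> measurable B ->
  A `<=` B -> mu.-integrable B (EFin \o f) -> (forall x, B x -> 0 <= f x) ->
  \int[mu]_(x in A) f x <= \int[mu]_(x in B) f x.
Proof.
move=> mA mB AB fi f0; rewrite /Rintegral fine_le//.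
- apply: (@integrable_fin_num _ _ R mu A mA (EFin \o f)).
  have h := @integrableS _ _ R mu B A (EFin \o f) mB mA AB fi; exact: h.
- exact: (@integrable_fin_num _ _ R mu B mB (EFin \o f)).
- apply: ge0_subset_integral => //; exact: measurable_int fi.
Qed.

(** The kernel has mass 1, support in [[s, s + h]] and height [2 / h], so the weighted mean of
    [c - v] is at most [2 / h * (e * h)]. *)
Lemma tent_average c v u s h e : curve_integrable c -> 0 < h -> 0 <= s -> s + h <= 1 ->
  enorm u <= 1 -> \int[mu]_(t in `[s, s + h]) enorm (c t - v) <= e * h ->
  `|\int[mu]_(t in I01 R) dotv (c t) ((h^-1 * tent ((t - s) / h)) *: u) - dotv v u| <= 2 * e.
Proof.
move=> ci h0 s0 sh1 u1 H.
pose K t := h^-1 * tent ((t - s) / h).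
have cK : continuous K by exact: continuous_tent_affine.
have hV : 0 < h^-1 by rewrite invr_gt0.
have intK : \int[mu]_(t in I01 R) K t = 1.
  pose F t : R := smoothstep ((t - s) / h).
  have dF (t : R) : is_derive t 1 F (K t) by exact: is_derive_smoothstep_affine.
  have EK : K = derive1 F by apply/funext => t; rewrite derive1E derive_val.
  rewrite EK Rintegral_ftc ?ler01//; last by rewrite -EK.
  rewrite /F smoothstep1 ?smoothstep0 ?subr0//; first by rewrite sub0r pmulr_lle0// oppr_le0.
  by rewrite ler_pdivlMr// mul1r; lra.
pose k w t : R := dotv w (K t *: u).
have cku i : continuous (fun t => (K t *: u) 0 i).
  have -> : (fun t => (K t *: u) 0 i) = (fun t => K t * u 0 i).
    by apply/funext => t; rewrite mxE.
  by move=> t; apply: cvgM; [exact: cK|exact: cvg_cst].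
have -> : dotv v u = \int[mu]_(t in I01 R) dotv v (K t *: u).
  rewrite (@eq_Rintegral _ _ _ mu _ (fun t => dotv v u * K t)).
    rewrite RintegralZl ?intK ?mulr1//; first exact: measurable_I01.
    exact: integrable_cont.
  by move=> t _; rewrite dotvZr mulrC.
have i1 : mu.-integrable (I01 R) (EFin \o (fun t => dotv (c t) (K t *: u))).
  exact: (@integrable_dotv R d c (fun t => K t *: u)).
have i2 : mu.-integrable (I01 R) (EFin \o (fun t => dotv v (K t *: u))).
  apply: (@integrable_dotv R d (fun=> v) (fun t => K t *: u)) => //.
  exact: curve_integrable_cst.
rewrite -RintegralB//; last exact: measurable_I01.
pose g t := dotv (c t) (K t *: u) - dotv v (K t *: u).
have gi : mu.-integrable (I01 R) (EFin \o g).
  by apply: integrableRB => //; exact: measurable_I01.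
have g0 t : t <= s \/ s + h <= t -> g t = 0.
  move=> ts; rewrite /g -dotvNl -dotvDl dotvZr /K tent_out ?mulr0 ?mul0r//.
  case: ts => ts; [left|right]; last by rewrite ler_pdivlMr// mul1r; lra.
  by rewrite pmulr_lle0//; lra.
have sh0 : 0 <= s + h by rewrite addr_ge0// ltW.
rewrite -/(Rintegral mu (I01 R) g) /I01.
rewrite (@Rintegral_split R g (s + h) 1)// (@Rintegral_split R g s (s + h)) ?lerDl ?(ltW h0)//.
rewrite [X in X + _ + _]Rintegral_eq0; last first.
  by move=> t; rewrite /= in_itv/= => /andP[_ ts]; apply: g0; left.
rewrite [X in _ + X]Rintegral_eq0; last first.
  by move=> t; rewrite /= in_itv/= => /andP[ts _]; apply: g0; right.
rewrite add0r addr0.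
have ei : mu.-integrable `[s, s + h] (EFin \o (fun t => enorm (c t - v))).
  apply: integrable_I01_sub => //; apply: integrable_enorm; apply: curve_integrableB => //.
  exact: curve_integrable_cst.
apply: (@le_trans _ _ (\int[mu]_(t in `[s, s + h]) (2 / h * enorm (c t - v)))); last first.
  rewrite RintegralZl//.
  have -> : 2 * e = 2 / h * (e * h) by field; exact: lt0r_neq0.
  by rewrite ler_wpM2l// mulr_ge0// ltW.
apply: Rintegral_ae_le => //.
- exact: integrable_I01_sub.
- exact: (integrableZl _ _ ei).
- by move=> t _; rewrite !mulr_ge0 ?enorm_ge0// ltW.
- apply: aeW => t _; rewrite /g -dotvNl -dotvDl dotvZr normrM.
  apply: ler_pM => //.
    rewrite /K normrM (ger0_norm (ltW hV)) ger0_norm ?tent_ge0// mulrC.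
    by rewrite ler_wpM2r ?(ltW hV)// tent_le2.
  by rewrite (le_trans (normr_dotv_le _ _))// ler_piMr ?enorm_ge0.
Qed.

Lemma test_fieldI psi (dpsi : R -> 'rV[R]_d) a b : 0 < a -> b < 1 ->
  (forall x, ~ (a <= x <= b) -> psi x = 0) ->
  (forall (i : 'I_d) (x : R), is_derive x 1 (fun y => psi y 0 i) (dpsi x 0 i)) ->
  (forall i : 'I_d, continuous (fun x => dpsi x 0 i : R)) ->
  test_field psi /\ velocity psi = dpsi.
Proof.
move=> a0 b1 out dp cp; have dE (i : 'I_d) : derive1 (fun y => psi y 0 i) = (fun x => dpsi x 0 i).
  by apply/funext => x; rewrite derive1E derive_val.
split.
  split; first by move=> i x; have := dp i x; case.
  split; first by move=> i; rewrite dE; exact: cp.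
  by exists a, b; split.
by apply/funext => x; apply/rowP => i; rewrite mxE dE.
Qed.

Lemma test_field_is_derive psi i (x : R) : test_field psi ->
  is_derive x 1 (fun y => psi y 0 i) (velocity psi x 0 i).
Proof.
by move=> [dp _]; apply: DeriveDef; [exact: dp|rewrite mxE derive1E].
Qed.

Lemma test_fieldD psi phi : test_field psi -> test_field phi ->
  test_field (fun t => psi t + phi t) /\
  velocity (fun t => psi t + phi t) = (fun t => velocity psi t + velocity phi t).
Proof.
move=> tp tf; have [_ [_ [a [b [a0 b1 out]]]]] := tp.
have [_ [_ [a' [b' [a0' b1' out']]]]] := tf.
apply: (@test_fieldI _ _ (Num.min a a') (Num.max b b')).
- by rewrite lt_min a0.
- by rewrite gt_max b1.
- move=> x xab; rewrite out ?out' ?addr0// => /andP[h1 h2]; apply: xab.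
    by rewrite ge_min le_max h1 h2 !orbT.
  by rewrite ge_min le_max h1 h2.
- move=> i x.
  have -> : (fun y => (psi y + phi y) 0 i) = (fun y => psi y 0 i) + (fun y => phi y 0 i).
    by apply/funext => y; rewrite mxE.
  rewrite mxE; have h1 := test_field_is_derive i x tp.
  by have h2 := test_field_is_derive i x tf; exact: is_deriveD.
- move=> i.
  have -> : (fun y => (velocity psi y + velocity phi y) 0 i) =
      (fun y => velocity psi y 0 i) + (fun y => velocity phi y 0 i).
    by apply/funext => y; rewrite mxE.
  by move=> x; apply: cvgD; exact: test_velocity_continuous.
Qed.

Lemma distr_derivD c psi phi : curve_integrable c -> test_field psi -> test_field phi ->
  distr_deriv c (fun t => psi t + phi t) = distr_deriv c psi + distr_deriv c phi.
Proof.
move=> ci tp tf; rewrite /distr_deriv (test_fieldD tp tf).2 -opprD -RintegralD//.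
- by congr (- _); apply: eq_Rintegral => x _; rewrite dotvDr.
- exact: measurable_I01.
- exact: integrable_test.
- exact: integrable_test.
Qed.

Definition plateau_field x y h u t := plateau x y h t *: u.

Lemma test_field_plateau x y h u : 0 < x -> y < 1 -> 0 < h -> x + h <= y - h ->
  test_field (plateau_field x y h u) /\
  velocity (plateau_field x y h u) = (fun t => dplateau x y h t *: u).
Proof.
move=> x0 y1 h0 xy; apply: (@test_fieldI _ _ x y) => //.
- by move=> t txy; rewrite /plateau_field plateau_out// scale0r.
- move=> i t; have hb := is_derive_plateau x y h t.
  have -> : (fun t => plateau_field x y h u t 0 i) = (u 0 i \*: plateau x y h).
    by apply/funext => s; rewrite mxE mulrC.
  by rewrite mxE mulrC; exact: is_deriveZ.
- move=> i.
  have -> : (fun t => (dplateau x y h t *: u) 0 i) = (fun t => dplateau x y h t * u 0 i).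
    by apply/funext => s; rewrite mxE.
  by move=> t; apply: cvgM; [exact: continuous_dplateau|exact: cvg_cst].
Qed.

Lemma plateau_field_le1 x y h u t : 0 < h -> x + h <= y - h -> enorm u <= 1 ->
  enorm (plateau_field x y h u t) <= 1.
Proof.
move=> h0 xy u1; have /andP[b0 b1] := plateau_itv t h0 xy.
by rewrite enormZ ger0_norm// mulr_ile1// enorm_ge0.
Qed.

(** The pairing is a mean of [c] just left of [y] minus a mean just right of [x]. At Lebesgue points
    each differs from the value by at most [2 * (e / 4)]. *)
Lemma plateau_lower c x y u e : curve_integrable c -> 0 < x -> x < y -> y < 1 ->
  lebesgue_value c x -> lebesgue_value c y -> enorm u <= 1 -> 0 < e ->
  exists h, [/\ 0 < h, x + h <= y - h &
    dotv (c y - c x) u - e <= distr_deriv c (plateau_field x y h u)].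
Proof.
have sides (a b h : R) : 0 < h -> h < (b - a) / 2 -> h < a -> h < 1 - b ->
    [/\ 0 <= a - h, a + h <= 1, 0 <= b - h, b + h <= 1 & a + h <= b - h].
  by move=> *; split; lra.
have combine (a b p q : R) : - (2 * (e / 4)) <= a - p -> b - q <= 2 * (e / 4) -> p - q - e <= a - b.
  lra.
move=> ci x0 xy y1 Lx Ly u1 e0.
have e4 : 0 < e / 4 by rewrite divr_gt0.
have {}Lx := Lx _ e4; have {}Ly := Ly _ e4.
have : \forall h \near 0^'+, [/\ 0 < h, x + h <= y - h &
    dotv (c y - c x) u - e <= distr_deriv c (plateau_field x y h u)]; last first.
  by move=> /(@filter_ex _ _ _) [h]; exists h.
have small : \forall h \near 0^'+, [/\ 0 < h, h < (y - x) / 2, h < x & h < 1 - y].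
  near=> h; split; near: h.
  - exact: nbhs_right_gt.
  - by apply: nbhs_right_lt; rewrite divr_gt0// subr_gt0.
  - exact: nbhs_right_lt.
  - by apply: nbhs_right_lt; rewrite subr_gt0.
apply: filterS3 small Lx Ly => h [h0 hxy hx hy] Lxh Lyh.
have [xl xr yl yr xyh] := sides x y h h0 hxy hx hy.
split => //.
have sub z s : z = c s -> 0 <= s - h -> s + h <= 1 ->
   \int[mu]_(t in `[s - h, s + h]) enorm (c t - z) <= e / 4 * h ->
   \int[mu]_(t in `[s, s + h]) enorm (c t - z) <= e / 4 * h /\
   \int[mu]_(t in `[s - h, s - h + h]) enorm (c t - z) <= e / 4 * h.
  move=> _ s0 s1 H.
  have ei : mu.-integrable `[s - h, s + h] (EFin \o (fun t => enorm (c t - z))).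
    apply: integrable_I01_sub => //; apply: integrable_enorm; apply: curve_integrableB => //.
    exact: curve_integrable_cst.
  split; rewrite (le_trans _ H)//; apply: Rintegral_subset => //; try (by move=> *; exact: enorm_ge0).
    by apply: subset_itvr; rewrite bnd_simp lerBlDr lerDl ltW.
  by apply: subset_itvl; rewrite bnd_simp subrK lerDl ltW.
have [Hx _] := sub _ x erefl xl xr Lxh.
have [_ Hy] := sub _ y erefl yl yr Lyh.
have Tx := @tent_average c (c x) u x h (e / 4) ci h0 (ltW x0) xr u1 Hx.
have yhh : y - h + h <= 1 by rewrite subrK ltW.
have Ty := @tent_average c (c y) u (y - h) h (e / 4) ci h0 yl yhh u1 Hy.
have [tb vb] := test_field_plateau u x0 y1 h0 xyh.
have cku (s : R) i : continuous (fun t : R => ((h^-1 * tent ((t - s) / h)) *: u) 0 i : R).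
  have -> : (fun t : R => ((h^-1 * tent ((t - s) / h)) *: u) 0 i) = (fun t : R => (h^-1 * tent ((t - s) / h)) * u 0 i).
    by apply/funext => t; rewrite mxE.
  by move=> t; apply: cvgM; [exact: continuous_tent_affine|exact: cvg_cst].
have -> : distr_deriv c (plateau_field x y h u) =
  \int[mu]_(t in I01 R) dotv (c t) ((h^-1 * tent ((t - (y - h)) / h)) *: u) -
  \int[mu]_(t in I01 R) dotv (c t) ((h^-1 * tent ((t - x) / h)) *: u).
  rewrite /distr_deriv vb.
  rewrite -[RHS]opprB -RintegralB; first last.
  - exact: (@integrable_dotv R d c (fun t => (h^-1 * tent ((t - (y - h)) / h)) *: u)).
  - exact: (@integrable_dotv R d c (fun t => (h^-1 * tent ((t - x) / h)) *: u)).
  - exact: measurable_I01.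
  congr (- _); apply: eq_Rintegral => t _.
  by rewrite -dotvNr -dotvDr -scalerBl.
rewrite dotvDl dotvNl; move: Tx Ty; rewrite !ler_norml => /andP[_ Tx] /andP[Ty _].
exact: combine.
Unshelve. all: by end_near. Qed.

End test_fields.

(** * Limits along ultrafilters and one-sided limits *)

Section vector_limits.
Context (R : realType) (d : nat).
Implicit Types (p q u : 'rV[R]_d).

(** Convergence in the Euclidean norm along an arbitrary filter, to serve sequences and ultrafilters
    alike. *)
Definition vcvg (K : Type) (F : set_system K) (f : K -> 'rV[R]_d) p :=
  forall e : R, 0 < e -> \forall k \near F, enorm (f k - p) < e.

Lemma vcvg_le (K : Type) (F : set_system K) (f : K -> 'rV[R]_d) p q (M : R) :
  ProperFilter F -> vcvg F f p -> (\forall k \near F, enorm (f k - q) <= M) ->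
  enorm (p - q) <= M.
Proof.
move=> FF fp fq; apply/ler_addgt0Pr => e e0.
have [k [k1 k2]] := filter_ex (filterI (fp e e0) fq).
by rewrite (le_trans (enorm_dist3 (f k) _ _))// (enormBC p) addrC lerD// ltW.
Qed.

(** A compact interval provides a cluster point, and an ultrafilter converges to each of its cluster
    points. *)
Lemma ultra_cvg_real (K : Type) (U : set_system K) (g : K -> R) (M : R) :
  UltraFilter U -> (\forall k \near U, `|g k| <= M) ->
  exists l : R, forall e : R, 0 < e -> \forall k \near U, `|g k - l| < e.
Proof.
move=> UU gM.
have [l [_ cl]] : (`[- M, M]%classic `&` cluster (g @ U)) !=set0.
  apply: (@segment_compact R (- M) M).
  by apply: filterS gM => k /=; rewrite in_itv/= ler_norml.
exists l => e e0.
have [//|Hn] := in_ultra_setVsetC [set k | `|g k - l| < e] UU.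
have : nbhs l (ball l e) by exact: nbhsx_ballx.
have gn : U (g @^-1` (~` ball l e)).
  by apply: filterS Hn => k /= gk bk; apply: gk; rewrite distrC.
by move=> /(cl _ _ gn) [x []].
Qed.

Lemma ultra_vcvg (K : Type) (U : set_system K) (f : K -> 'rV[R]_d) (M : R) :
  UltraFilter U -> (\forall k \near U, enorm (f k) <= M) -> exists p, vcvg U f p.
Proof.
move=> UU fM.
have /choice[l hl] : forall i : 'I_d, exists l : R,
    forall e : R, 0 < e -> \forall k \near U, `|f k 0 i - l| < e.
  move=> i; apply: ultra_cvg_real; apply: filterS fM => k.
  exact: le_trans (normr_enorm _ _).
exists (\row_i l i) => e e0.
have e'0 : 0 < e / d.+1%:R by rewrite divr_gt0// ltr0n.
have : \forall k \near U, forall i : 'I_d, `|f k 0 i - l i| < e / d.+1%:R.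
  by apply: filter_forall => i; exact: hl.
apply: filterS => k hk; rewrite (le_lt_trans (enorm_sum _))//.
apply: (@le_lt_trans _ _ (\sum_(i < d) e / d.+1%:R)).
  by apply: ler_sum => i _; rewrite !mxE ltW.
rewrite sumr_const card_ord -[X in X < _]mulr_natr mulrAC ltr_pdivrMr ?ltr0n//.
by rewrite ltr_pM2l// ltr_nat.
Qed.

End vector_limits.

Section monotone_limits.
Context (R : realType) (T : R -> R).
Hypothesis mT : {homo T : x y / x <= y}.

Definition lim_left x := sup [set T z | z in [set z | z < x]].
Definition lim_right x := inf [set T z | z in [set z | x < z]].

Let hsup x : has_sup [set T z | z in [set z | z < x]].
Proof.
split; first by exists (T (x - 1)), (x - 1) => //=; rewrite ltrBlDr ltrDl.
by exists (T x) => _ [z /= zx <-]; apply: mT; exact: ltW.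
Qed.

Let hinf x : has_inf [set T z | z in [set z | x < z]].
Proof.
split; first by exists (T (x + 1)), (x + 1) => //=; rewrite ltrDl.
by exists (T x) => _ [z /= zx <-]; apply: mT; exact: ltW.
Qed.

Lemma lim_left_ub x z : z < x -> T z <= lim_left x.
Proof. by move=> zx; apply: sup_upper_bound => //; exists z. Qed.

Lemma lim_right_lb x z : x < z -> lim_right x <= T z.
Proof. by move=> zx; apply: ge_inf; [case: (hinf x)|exists z]. Qed.

Lemma lim_left_le x K : (forall z, z < x -> T z <= K) -> lim_left x <= K.
Proof.
move=> H; apply: ge_sup; first by case: (hsup x).
by move=> _ [z zx <-]; exact: H.
Qed.

Lemma lim_right_ge x K : (forall z, x < z -> K <= T z) -> K <= lim_right x.
Proof.
move=> H; apply: lb_le_inf; first by case: (hinf x).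
by move=> _ [z zx <-]; exact: H.
Qed.

Lemma lim_left_adherent x e : 0 < e ->
  exists2 z, z < x & forall y, z <= y -> y < x -> lim_left x - e < T y.
Proof.
move=> e0; have [_ [z zx <-] ez] := sup_adherent e0 (hsup x).
by exists z => // y zy yx; rewrite (lt_le_trans ez)// mT.
Qed.

Lemma lim_right_adherent x e : 0 < e ->
  exists2 z, x < z & forall y, x < y -> y <= z -> T y < lim_right x + e.
Proof.
move=> e0; have [_ [z zx <-] ez] := inf_adherent e0 (hinf x).
by exists z => // y xy yz; rewrite (le_lt_trans _ ez)// mT.
Qed.

Lemma lim_left_self x : lim_left x <= T x.
Proof. by apply: lim_left_le => z zx; apply: mT; exact: ltW. Qed.

Lemma lim_right_self x : T x <= lim_right x.
Proof. by apply: lim_right_ge => z zx; apply: mT; exact: ltW. Qed.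

Lemma lim_right_left x y : x < y -> lim_right x <= lim_left y.
Proof.
move=> xy; have [|h1 h2] := @midf_lt R x y; first by [].
exact: le_trans (lim_right_lb h1) (lim_left_ub h2).
Qed.

Context (d : nat) (E : set R) (f : R -> 'rV[R]_d).
Hypothesis cT : controlled E T f.

(** A left limit with an explicit rate: the bound holds at every point of [E] on the left of [x],
    not only near [x], and can therefore be added to other control estimates. *)
Definition left_value x p := forall z, E z -> z < x -> enorm (p - f z) <= lim_left x - T z.
Definition right_value x p := forall z, E z -> x < z -> enorm (f z - p) <= T z - lim_right x.

Lemma left_value_ex x : (forall y, y < x -> exists2 z, E z & y < z < x) ->
  exists p, left_value x p.
Proof.
move=> dense; pose F : set_system R := within E x^'-.
have FF : ProperFilter F.
  split; last exact: within_filter.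
  rewrite /F /within /= => H.
  have [e /= e0 He] : nbhs x (fun z => z < x -> E z -> False) by exact: H.
  have [z Ez /andP[z1 z2]] := dense (x - e) ltac:(lra).
  apply: (He z) => //=; rewrite ltr_norml; lra.
have [U [UU FU]] := ultraFilterLemma FF.
have nearE y : y < x -> \forall z \near U, [/\ E z, y < z & z < x].
  move=> yx; apply: FU; rewrite /F /within /=.
  by near=> z => Ez; split; [exact: Ez|near: z; exact: nbhs_left_gt|near: z; exact: nbhs_left_lt].
have [z0 Ez0 /andP[_ z0x]] := dense (x - 1) ltac:(lra).
have [p fp] : exists p, vcvg U f p.
  apply: (@ultra_vcvg _ _ _ _ _ (enorm (f z0) + (lim_left x - T z0))) => //.
  apply: filterS (nearE z0 z0x) => z [Ez zz zx].
  have -> : f z = f z0 + (f z - f z0) by rewrite addrC subrK.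
  rewrite (le_trans (enormD _ _))// lerD2l (le_trans (cT Ez0 Ez (ltW zz)))//.
  by rewrite lerD2r lim_left_ub.
exists p => z Ez zx; apply: (vcvg_le _ fp).
apply: filterS (nearE z zx) => w [Ew zw wx].
by rewrite (le_trans (cT Ez Ew (ltW zw)))// lerD2r lim_left_ub.
Unshelve. all: by end_near. Qed.

Lemma right_value_ex x : (forall y, x < y -> exists2 z, E z & x < z < y) ->
  exists p, right_value x p.
Proof.
move=> dense; pose F : set_system R := within E x^'+.
have FF : ProperFilter F.
  split; last exact: within_filter.
  rewrite /F /within /= => H.
  have [e /= e0 He] : nbhs x (fun z => x < z -> E z -> False) by exact: H.
  have [z Ez /andP[z1 z2]] := dense (x + e) ltac:(lra).
  apply: (He z) => //=; rewrite ltr_norml; lra.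
have [U [UU FU]] := ultraFilterLemma FF.
have nearE y : x < y -> \forall z \near U, [/\ E z, x < z & z < y].
  move=> yx; apply: FU; rewrite /F /within /=.
  by near=> z => Ez; split; [exact: Ez|near: z; exact: nbhs_right_gt|near: z; exact: nbhs_right_lt].
have [z0 Ez0 /andP[z0x _]] := dense (x + 1) ltac:(lra).
have [p fp] : exists p, vcvg U f p.
  apply: (@ultra_vcvg _ _ _ _ _ (enorm (f z0) + (T z0 - lim_right x))) => //.
  apply: filterS (nearE z0 z0x) => z [Ez zz zx].
  have -> : f z = f z0 - (f z0 - f z) by rewrite opprB addrC subrK.
  rewrite (le_trans (enormB _ _))// lerD2l (le_trans (cT Ez Ez0 (ltW zx)))//.
  by rewrite lerD2l lerN2 lim_right_lb.
exists p => z Ez zx; rewrite enormBC; apply: (vcvg_le _ fp).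
apply: filterS (nearE z zx) => w [Ew zw wx].
by rewrite enormBC (le_trans (cT Ew Ez (ltW wx)))// lerD2l lerN2 lim_right_lb.
Unshelve. all: by end_near. Qed.

Lemma left_value_le x p y q : left_value y q -> right_value x p -> x < y ->
  (exists2 z, E z & x < z < y) -> enorm (q - p) <= lim_left y - lim_right x.
Proof.
move=> hq hp xy [z Ez /andP[xz zy]].
rewrite (le_trans (enorm_dist3 (f z) _ _))//.
have := hq z Ez zy; have := hp z Ez xz; lra.
Qed.

Lemma jump_le x p q : left_value x p -> right_value x q ->
  (forall y, y < x -> exists2 z, E z & y < z < x) ->
  (forall y, x < y -> exists2 z, E z & x < z < y) ->
  enorm (q - p) <= lim_right x - lim_left x.
Proof.
move=> hp hq dl dr; apply/ler_addgt0Pr => e e0.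
have e4 : 0 < e / 4 by rewrite divr_gt0.
have [z zx hz] := lim_left_adherent x e4; have [w xw hw] := lim_right_adherent x e4.
have [z' Ez' /andP[zz' z'x]] := dl z zx; have [w' Ew' /andP[xw' w'w]] := dr w xw.
have := hz z' (ltW zz') z'x; have := hw w' xw' (ltW w'w).
have := hp z' Ez' z'x; have := hq w' Ew' xw'.
have := cT Ez' Ew' (ltW (lt_trans z'x xw')).
have := enorm_dist3 (f w') q p; have := enorm_dist3 (f z') (f w') p.
rewrite (enormBC q (f w')) (enormBC (f z') p); lra.
Qed.

End monotone_limits.

(** * Curves of bounded variation *)

Section bv_control.
Context (R : realType) (d : nat).
Notation mu := (@lebesgue_measure R).
Implicit Types (c psi f : R -> 'rV[R]_d) (x y : R) (p q : 'rV[R]_d).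

Lemma left_ess_lim_unique c x p q :
  is_left_ess_lim c x p -> is_left_ess_lim c x q -> p = q.
Proof.
move=> hp hq; apply/eqP; rewrite -subr_eq0; apply/eqP/enorm0_eq0/eqP.
rewrite eq_le enorm_ge0 andbT; apply/ler_addgt0Pr => e e0; rewrite add0r.
have e2 : 0 < e / 2 by rewrite divr_gt0.
have [r r0 Hp] := hp _ e2; have [s s0 Hq] := hq _ e2.
have [|y [y1 y2] /andP[xy yx]] := @ae_dense _ _ (x - Num.min r s) x (ae_and Hp Hq).
  by rewrite ltrBlDr ltrDl lt_min r0.
have {}y1 : enorm (c y - p) < e / 2.
  by apply: y1; rewrite yx andbT (le_lt_trans _ xy)// lerB// ge_min lexx.
have {}y2 : enorm (c y - q) < e / 2.
  by apply: y2; rewrite yx andbT (le_lt_trans _ xy)// lerB// ge_min lexx orbT.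
rewrite (le_trans (enorm_dist3 (c y) _ _))// (enormBC p) (splitr e) ltW// ltrD//.
Qed.

Lemma right_ess_lim_unique c x p q :
  is_right_ess_lim c x p -> is_right_ess_lim c x q -> p = q.
Proof.
move=> hp hq; apply/eqP; rewrite -subr_eq0; apply/eqP/enorm0_eq0/eqP.
rewrite eq_le enorm_ge0 andbT; apply/ler_addgt0Pr => e e0; rewrite add0r.
have e2 : 0 < e / 2 by rewrite divr_gt0.
have [r r0 Hp] := hp _ e2; have [s s0 Hq] := hq _ e2.
have [|y [y1 y2] /andP[xy yx]] := @ae_dense _ _ x (x + Num.min r s) (ae_and Hp Hq).
  by rewrite ltrDl lt_min r0.
have {}y1 : enorm (c y - p) < e / 2.
  by apply: y1; rewrite xy/= (lt_le_trans yx)// lerD2l ge_min lexx.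
have {}y2 : enorm (c y - q) < e / 2.
  by apply: y2; rewrite xy/= (lt_le_trans yx)// lerD2l ge_min lexx orbT.
rewrite (le_trans (enorm_dist3 (c y) _ _))// (enormBC p) (splitr e) ltW// ltrD//.
Qed.

Lemma ess_left_eq c x p : x != 0 -> is_left_ess_lim c x p -> ess_left c x = p.
Proof.
move=> x0 hp; rewrite /ess_left (negbTE x0); apply: get_unique => // q hq.
exact: left_ess_lim_unique hp.
Qed.

Lemma ess_left0_eq c p : is_right_ess_lim c 0 p -> ess_left c 0 = p.
Proof.
move=> hp; rewrite /ess_left eqxx; apply: get_unique => // q hq.
exact: right_ess_lim_unique hp.
Qed.

Lemma ess_right_eq c x p : x != 1 -> is_right_ess_lim c x p -> ess_right c x = p.
Proof.
move=> x0 hp; rewrite /ess_right (negbTE x0); apply: get_unique => // q hq.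
exact: right_ess_lim_unique hp.
Qed.

Lemma ess_right1_eq c p : is_left_ess_lim c 1 p -> ess_right c 1 = p.
Proof.
move=> hp; rewrite /ess_right eqxx; apply: get_unique => // q hq.
exact: left_ess_lim_unique hp.
Qed.

Section limits_of_control.
Context (T : R -> R) (E : set R) (c f : R -> 'rV[R]_d).
Hypothesis mT : {homo T : x y / x <= y}.
Hypothesis aE : {ae mu, forall x, 0 < x < 1 -> E x}.
Hypothesis fc : forall x, 0 < x < 1 -> f x = c x.

Lemma left_value_ess x p : 0 < x <= 1 -> left_value T E f x p -> is_left_ess_lim c x p.
Proof.
move=> /andP[x0 x1] hp e e0.
have [z zx hz] := lim_left_adherent mT x e0.
have m0 : Num.max z 0 < x by rewrite gt_max zx.
exists (x - Num.max z 0); first by rewrite subr_gt0.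
apply: ae_imp aE => y Ey /andP[]; rewrite opprB addrC subrK gt_max => /andP[zy y0] yx.
have y01 : 0 < y < 1 by rewrite y0 (lt_le_trans yx x1).
rewrite -fc// enormBC (le_lt_trans (hp y (Ey y01) yx))//.
have := hz y (ltW zy) yx; lra.
Qed.

Lemma right_value_ess x p : 0 <= x < 1 -> right_value T E f x p -> is_right_ess_lim c x p.
Proof.
move=> /andP[x0 x1] hp e e0.
have [z zx hz] := lim_right_adherent mT x e0.
have m0 : x < Num.min z 1 by rewrite lt_min zx.
exists (Num.min z 1 - x); first by rewrite subr_gt0.
apply: ae_imp aE => y Ey /andP[xy]; rewrite addrC subrK lt_min => /andP[yz y1].
have y01 : 0 < y < 1 by rewrite y1 (le_lt_trans x0 xy).
rewrite -fc// (le_lt_trans (hp y (Ey y01) xy))//.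
have := hz y xy (ltW yz); lra.
Qed.

End limits_of_control.

(** The support ends at [x], so a field supported in [[x, y]] can be added without raising the
    pointwise norm above 1. *)
Definition admissible x psi := [/\ test_field psi, forall t, enorm (psi t) <= 1 &
  exists2 a, 0 < a & forall t, ~ (a <= t <= x) -> psi t = 0].

(* This is [|Dc|(]0, x[)], as [psi x = 0] for every admissible [psi]. *)
Definition var_upto c x := sup [set distr_deriv c psi | psi in admissible x].

(** Constant on either side of ]0, 1[, with the value of [len c] from 1 on: the total growth is
    [len c] by construction. *)
Definition var_fun c x :=
  if x <= 0 then 0 else if 1 <= x then fine (len c) else var_upto c x.

Lemma distr_deriv0 c : distr_deriv c (fun=> 0) = 0.
Proof.
rewrite /distr_deriv Rintegral_eq0 ?oppr0// => x _.
have -> : velocity (fun=> 0 : 'rV[R]_d) x = 0; last by rewrite dotvC dotv0l.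
apply/rowP => i; rewrite mxE [RHS]mxE.
have -> : (fun _ : R => (0 : 'rV[R]_d) 0 i) = cst 0 by apply/funext => y; rewrite mxE.
exact: derive1_cst.
Qed.

Lemma admissible0 x : admissible x (fun=> 0).
Proof.
split; last by exists 1.
  apply: (@test_fieldI _ _ _ (fun=> 0) 2^-1 2^-1 _ _ _ _ _).1 => //.
  - by rewrite invf_lt1// ltr1n.
  - move=> i y.
    have -> : (fun _ : R => (0 : 'rV[R]_d) 0 i) = cst 0 by apply/funext => z; rewrite mxE.
    by rewrite mxE; exact: is_derive_cst.
  - move=> i y.
    have -> : (fun _ : R => (0 : 'rV[R]_d) 0 i) = cst 0 by apply/funext => z; rewrite mxE.
    exact: cvg_cst.
by move=> t; rewrite enorm0 ler01.
Qed.

Lemma len_ge0 c : (0 <= len c)%E.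
Proof.
apply: ereal_sup_ubound; exists (fun=> 0); last by rewrite distr_deriv0.
by have [? ? _] := admissible0 0; split.
Qed.

Section of_BV.
Context (c : R -> 'rV[R]_d).
Hypothesis cBV : BV c.

Let ci : curve_integrable c. Proof. by case: cBV. Qed.

Lemma len_fineK : (fine (len c))%:E = len c.
Proof. by rewrite fineK// ge0_fin_numE ?len_ge0//; case: cBV. Qed.

Lemma distr_deriv_le_len psi : test_field psi -> (forall x, enorm (psi x) <= 1) ->
  distr_deriv c psi <= fine (len c).
Proof.
move=> tp p1; rewrite -lee_fin len_fineK; apply: ereal_sup_ubound.
by exists psi.
Qed.

Let hsup x : has_sup [set distr_deriv c psi | psi in admissible x].
Proof.
split; first by exists 0, (fun=> 0); [exact: admissible0|exact: distr_deriv0].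
by exists (fine (len c)) => _ [psi [tp p1 _] <-]; exact: distr_deriv_le_len.
Qed.

Lemma var_upto_ge0 x : 0 <= var_upto c x.
Proof.
apply: sup_upper_bound => //.
by exists (fun=> 0); [exact: admissible0|exact: distr_deriv0].
Qed.

Lemma var_upto_le_len x : var_upto c x <= fine (len c).
Proof.
apply: ge_sup; first by case: (hsup x).
by move=> _ [psi [tp p1 _] <-]; exact: distr_deriv_le_len.
Qed.

Lemma var_upto_mono x y : x <= y -> var_upto c x <= var_upto c y.
Proof.
move=> xy; apply: ge_sup; first by case: (hsup x).
move=> _ [psi [tp p1 [a a0 out]] <-]; apply: sup_upper_bound => //.
exists psi => //; split => //; exists a => // t aty; apply: out => /andP[h1 h2].
by apply: aty; rewrite h1 (le_trans h2).
Qed.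

(** Superadditivity: any field admissible up to [x] plus a plateau field on [[x, y]], in the
    direction [u] dual to [c y - c x], is admissible up to [y], and the pairings add. At [x] itself
    the plateau field vanishes. *)
Lemma var_upto_step x y : 0 < x -> x < y -> y < 1 ->
  lebesgue_value c x -> lebesgue_value c y ->
  enorm (c y - c x) <= var_upto c y - var_upto c x.
Proof.
move=> x0 xy y1 Lx Ly; rewrite lerBrDl -lerBrDr.
apply: ge_sup; first by case: (hsup x).
move=> _ [psi [tp p1 [a a0 out]] <-]; rewrite lerBrDr; apply/ler_addgt0Pr => e e0.
have [u u1 <-] := enorm_dual (c y - c x).
have [h [h0 xyh low]] := plateau_lower ci x0 xy y1 Lx Ly u1 e0.
have [tb _] := test_field_plateau u x0 y1 h0 xyh.
have tpb := (test_fieldD tp tb).1.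
have : distr_deriv c (fun t => psi t + plateau_field x y h u t) <= var_upto c y.
  apply: sup_upper_bound => //; eexists; last by [].
  split => //.
    move=> t; have [tx|xt] := leP t x.
      rewrite [plateau_field _ _ _ _ _](_ : _ = 0) ?addr0//.
      have [->|ntx] := eqVneq t x.
        rewrite /plateau_field /plateau !smoothstep0 ?subrr ?scale0r// ?mul0r//.
        by rewrite pmulr_lle0 ?invr_gt0//; lra.
      rewrite /plateau_field plateau_out ?scale0r// => /andP[xt _].
      by move: ntx; rewrite eq_le tx xt.
    rewrite out ?add0r; first exact: plateau_field_le1.
    by move=> /andP[_]; rewrite leNgt xt.
  exists (Num.min a x); first by rewrite lt_min a0.
  move=> t aty; rewrite out ?add0r; last first.
    by move=> /andP[h1 h2]; apply: aty; rewrite ge_min h1 (le_trans h2 (ltW xy)).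
  rewrite /plateau_field plateau_out ?scale0r// => /andP[h1 h2].
  by apply: aty; rewrite ge_min h1 orbT.
rewrite (distr_derivD ci tp tb); move: low; rewrite (dotvC u (c y - c x)).
move: (distr_deriv c psi) (distr_deriv c _) (dotv _ _) (var_upto c y).
by clear => A B C D; lra.
Qed.

Lemma var_fun_mono : {homo var_fun c : x y / x <= y}.
Proof.
move=> x y xy; rewrite /var_fun; case: (leP x 0) => x0; case: (leP y 0) => y0 //.
- case: (leP 1 y) => y1; last exact: var_upto_ge0.
  exact: fine_ge0 (len_ge0 c).
- by move: (lt_le_trans x0 xy); rewrite ltNge y0.
- case: (leP 1 x) => x1; case: (leP 1 y) => y1 //.
  + by move: (le_trans x1 xy); rewrite leNgt y1.
  + exact: var_upto_le_len.
  + exact: var_upto_mono.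
Qed.

Definition regular_pt x := 0 < x < 1 /\ lebesgue_value c x.

Lemma var_fun_control : controlled regular_pt (var_fun c) c.
Proof.
move=> x y [/andP[x0 x1] Lx] [/andP[y0 y1] Ly]; rewrite le_eqVlt => /predU1P[->|xy].
  by rewrite !subrr enorm0.
rewrite /var_fun (leNgt x 0) (leNgt 1 x) (leNgt y 0) (leNgt 1 y) x0 x1 y0 y1/=.
exact: var_upto_step.
Qed.

End of_BV.

(* [f] extends [c] from ]0, 1[ to the line by its essential limits at 0 and 1,
   so that the endpoints need no separate treatment. *)
Record var_control c (T : R -> R) (E : set R) f : Prop := VarControl {
  vc_mono : {homo T : x y / x <= y} ;
  vc_le0 : forall x, x <= 0 -> T x = 0 ;
  vc_ge1 : forall x, 1 <= x -> T x = fine (len c) ;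
  vc_ae : {ae mu, forall x, E x} ;
  vc_control : controlled E T f ;
  vc_eq : forall x, 0 < x < 1 -> f x = c x ;
  vc_leb : forall x, E x -> 0 < x < 1 -> lebesgue_value c x ;
  vc_left : forall x, I01 R x -> left_value T E f x (ess_left c x) ;
  vc_right : forall x, I01 R x -> right_value T E f x (ess_right c x) }.

Lemma BV_var_control c : BV c -> exists T E f, var_control c T E f.
Proof.
move=> cBV; have ci : curve_integrable c by case: cBV.
pose T := var_fun c; pose E0 := regular_pt c.
have mT : {homo T : x y / x <= y} by exact: var_fun_mono.
have cT0 : controlled E0 T c by exact: var_fun_control.
have T0 x : x <= 0 -> T x = 0 by rewrite /T /var_fun => ->.
have T1 x : 1 <= x -> T x = fine (len c).
  by rewrite /T /var_fun => x1; rewrite x1 leNgt (lt_le_trans ltr01 x1).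
have aE0 : {ae mu, forall x, 0 < x < 1 -> E0 x}.
  by apply: ae_imp (ae_lebesgue_value ci) => x Lx x01; split => //; exact: Lx.
have dense0 a b : 0 <= a -> a < b -> b <= 1 -> exists2 z, E0 z & a < z < b.
  move=> a0 ab b1; have [z Ez /andP[az zb]] := ae_dense aE0 ab.
  exists z; last by rewrite az.
  by apply: Ez; rewrite (le_lt_trans a0 az) (lt_le_trans zb b1).
(* The end values that extend [c] to the line have to exist first; they come from the control inside
   ]0, 1[. *)
have [p0 hp0] : exists p, right_value T E0 c 0 p.
  apply: (right_value_ex mT cT0) => y y0.
  have m1 : 0 < Num.min y 1 by rewrite lt_min y0 ltr01.
  have m2 : Num.min y 1 <= 1 by rewrite ge_min lexx orbT.
  have [z Ez /andP[z0 zy]] := dense0 _ _ (lexx 0) m1 m2.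
  by exists z => //; rewrite z0 (lt_le_trans zy)// ge_min lexx.
have [p1 hp1] : exists p, left_value T E0 c 1 p.
  apply: (left_value_ex mT cT0) => y y1.
  have m1 : 0 <= Num.max y 0 by rewrite le_max lexx orbT.
  have m2 : Num.max y 0 < 1 by rewrite gt_max y1 ltr01.
  have [z Ez /andP[z0 zy]] := dense0 _ _ m1 m2 (lexx 1).
  by exists z => //; rewrite zy andbT (le_lt_trans _ z0)// le_max lexx.
pose f x := if x <= 0 then p0 else if 1 <= x then p1 else c x.
(* Vacuous outside ]0, 1[, where every point is accepted because [f] is constant on either side. *)
pose E x := 0 < x < 1 -> lebesgue_value c x.
have f1 x : 1 <= x -> f x = p1 by move=> x1; rewrite /f x1 leNgt (lt_le_trans ltr01 x1).
have fc x : 0 < x < 1 -> f x = c x by move=> /andP[x0 x1]; rewrite /f !leNgt x0 x1.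
have aE : {ae mu, forall x, E x} by exact: ae_lebesgue_value.
have ER x : E x -> [\/ x <= 0, 1 <= x | E0 x].
  move=> Ex; case: (leP x 0) => x0; first by constructor 1.
  case: (leP 1 x) => x1; first by constructor 2.
  by constructor 3; split; [rewrite x0|apply: Ex; rewrite x0].
have Tp0 : 0 <= lim_right T 0 by have := lim_right_self mT 0; rewrite T0.
have Tm1 : lim_left T 1 <= fine (len c) by have := lim_left_self mT 1; rewrite T1.
have cT : controlled E T f.
  move=> x y /ER Ex /ER Ey xy.
  case: Ex => [x0|x1|Ex].
  - have -> : f x = p0 by rewrite /f x0.
    rewrite (T0 x x0) subr0.
    case: Ey => [y0|y1|Ey].
    + by rewrite /f y0 subrr enorm0 T0.
    + rewrite (f1 y y1).
      rewrite (T1 y y1).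
      have [z Ez z01] := dense0 _ _ (lexx 0) ltr01 (lexx 1).
      have := left_value_le hp1 hp0 ltr01 (ex_intro2 _ _ z Ez z01); lra.
    + have [/andP[y0 y1] _] := Ey.
      rewrite fc ?y0//; have := hp0 y Ey y0; lra.
  - have y1 := le_trans x1 xy.
    by rewrite !f1// subrr enorm0 !T1// subrr.
  - have [/andP[x0 x1] _] := Ex; rewrite (fc x) ?x0//.
    case: Ey => [y0|y1|Ey].
    + by move: (lt_le_trans x0 xy); rewrite ltNge y0.
    + rewrite (f1 y y1).
      rewrite (T1 y y1); have := hp1 x Ex x1; lra.
    + have [y01 _] := Ey; rewrite fc//; exact: cT0.
have denseL x y : y < x -> exists2 z, E z & y < z < x by exact: ae_dense.
have aE01 : {ae mu, forall x, 0 < x < 1 -> E x} by apply: ae_imp aE.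
have ess0 : is_right_ess_lim c 0 p0.
  by apply: (right_value_ess mT aE0 (f := c)) => //; rewrite lexx ltr01.
have ess1 : is_left_ess_lim c 1 p1.
  by apply: (left_value_ess mT aE0 (f := c)) => //; rewrite lexx ltr01.
exists T, E, f; split => //.
- move=> x; rewrite /I01/= in_itv/= => /andP[x0 x1].
  have [->|xn0] := eqVneq x 0.
    rewrite (ess_left0_eq ess0) => z Ez z0; rewrite /f (ltW z0) subrr enorm0.
    by rewrite subr_ge0 lim_left_ub.
  have [p hp] := left_value_ex mT cT (fun y yx => denseL x y yx).
  rewrite (@ess_left_eq c x p)//; apply: (left_value_ess mT aE01 fc) => //.
  by rewrite x1 lt_def xn0 x0.
- move=> x; rewrite /I01/= in_itv/= => /andP[x0 x1].
  have [->|xn1] := eqVneq x 1.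
    rewrite (ess_right1_eq ess1) => z Ez z1.
    rewrite (f1 z (ltW z1)) subrr enorm0.
    by rewrite subr_ge0 lim_right_lb.
  have [p hp] := right_value_ex mT cT (fun y xy => denseL y x xy).
  rewrite (@ess_right_eq c x p)//; apply: (right_value_ess mT aE01 fc) => //.
  by rewrite x0 lt_neqAle xn1 x1.
Qed.

End bv_control.

(** * Jumps, essential values and selections *)

Section control_consequences.
Context (R : realType) (d : nat).
Notation mu := (@lebesgue_measure R).
Implicit Types (c f g p : R -> 'rV[R]_d) (x y : R).

Lemma I01P x : I01 R x <-> 0 <= x <= 1.
Proof. by rewrite /I01/= in_itv. Qed.

Lemma ae_neq (x : R) : {ae mu, forall z, z <> x}.
Proof.
exists [set x]; split; [exact: measurable_set1|exact: lebesgue_measure_set1|].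
by move=> z /contrapT.
Qed.

Lemma len_le_control_I01 c S : curve_integrable c -> controlled (I01 R) S c ->
  (len c <= (S 1 - S 0)%:E)%E.
Proof.
move=> ci cS; pose cl x : R := Num.min (Num.max x 0) 1.
have clI x : I01 R (cl x).
  apply/I01P; rewrite /cl le_min ge_min lexx orbT andbT ler01 andbT.
  by rewrite le_max lexx orbT.
have clE x : I01 R x -> cl x = x.
  by move/I01P => /andP[x0 x1]; rewrite /cl (max_idPl x0); apply/min_idPl.
have Smono x y : I01 R x -> I01 R y -> x <= y -> S x <= S y.
  by move=> Ix Iy xy; rewrite -subr_ge0 (le_trans (enorm_ge0 _) (cS _ _ Ix Iy xy)).
have -> : S 1 - S 0 = S (cl 1) - S (cl 0).
  by rewrite !clE//; apply/I01P; rewrite !lexx ler01.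
apply: (@len_le_control R d c (I01 R) (S \o cl)) => //.
- move=> x y xy /=; apply: Smono => //; rewrite /cl.
  by rewrite le_min !ge_min lexx orbT andbT ge_max !le_max xy lexx orbT.
- by apply: aeW => x /andP[x0 x1]; apply/I01P; rewrite !ltW.
- move=> x y [Ix _] [Iy _] xy; rewrite /= !clE//; exact: cS.
Qed.

Section with_control.
Context (c : R -> 'rV[R]_d) (T : R -> R) (E : set R) (f : R -> 'rV[R]_d).
Hypothesis ci : curve_integrable c.
Hypothesis V : var_control c T E f.
Hypothesis lenT : (fine (len c))%:E = len c.

Let mT := vc_mono V.

Lemma vc_dense a b : a < b -> exists2 z, E z & a < z < b.
Proof. exact: ae_dense (vc_ae V). Qed.

Lemma vc_left_right x y : I01 R x -> I01 R y -> x < y ->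
  enorm (ess_left c y - ess_right c x) <= lim_left T y - lim_right T x.
Proof.
move=> Ix Iy xy; apply: (left_value_le (vc_left V Iy) (vc_right V Ix) xy).
exact: vc_dense.
Qed.

Lemma ess_jump_le x : I01 R x ->
  enorm (ess_right c x - ess_left c x) <= lim_right T x - lim_left T x.
Proof.
move=> Ix; apply: (jump_le mT (vc_control V) (vc_left V Ix) (vc_right V Ix)).
  by move=> y yx; exact: vc_dense.
by move=> y yx; exact: vc_dense.
Qed.

(* By [len_le_control] the total of any control is at least [len c]; a jump
   of [T] larger than that of [c] could be shrunk, contradicting this. *)
Lemma ess_jump_ge x : I01 R x ->
  lim_right T x - lim_left T x <= enorm (ess_right c x - ess_left c x).
Proof.
move=> Ix; have /I01P/andP[x0 x1] := Ix.
set J := enorm _; set k := lim_right T x - lim_left T x - J.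
have J0 : 0 <= J by exact: enorm_ge0.
suff : k <= 0 by rewrite /k; lra.
have Tl := lim_left_self mT x; have Tr := lim_right_self mT x.
pose S z := if z < x then T z else if z == x then lim_left T x else T z - k.
have Sl z : z < x -> S z = T z by rewrite /S => ->.
have Sx : S x = lim_left T x by rewrite /S ltxx eqxx.
have Sr z : x < z -> S z = T z - k by move=> xz; rewrite /S ltNge (ltW xz)/= gt_eqF.
have mS : {homo S : z w / z <= w}.
  move=> z w zw; have [zx|xz|zx] := ltgtP z x; have [wx|xw|wx] := ltgtP w x.
  - by rewrite !Sl// mT.
  - have := lim_left_ub mT zx; have := lim_right_lb mT xw.
    rewrite (Sl z zx) (Sr w xw) /k; lra.
  - by rewrite wx Sx Sl// lim_left_ub.
  - by move: (lt_le_trans xz zw); rewrite ltNge (ltW wx).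
  - by rewrite !Sr// lerD2r mT.
  - by move: xz; rewrite -wx ltNge zw.
  - by move: wx; rewrite -zx ltNge zw.
  - have := lim_right_lb mT xw; rewrite zx Sx (Sr w xw) /k; lra.
  - by rewrite zx wx.
have H : (len c <= (S 1 - S 0)%:E)%E.
  apply: (@len_le_control R d c (E `&` [set z | z <> x]) S) => //.
    apply: ae_imp (ae_and (vc_ae V) (ae_neq x)) => z [Ez zx] _.
    by split.
  move=> z w [[Ez zx] z01] [[Ew wx] w01] zw.
  have fz : f z = c z by apply: (vc_eq V); move: z01; rewrite /= in_itv.
  have fw : f w = c w by apply: (vc_eq V); move: w01; rewrite /= in_itv.
  rewrite -fz -fw.
  have [zx'|xz|//] := ltgtP z x; have [wx'|xw|//] := ltgtP w x.
  - by rewrite !Sl//; exact: (vc_control V).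
  - rewrite (Sl z zx') (Sr w xw).
    have h1 := vc_right V Ix Ew xw; have h2 := vc_left V Ix Ez zx'.
    have h3 := enorm_dist3 (ess_right c x) (f w) (f z).
    have h4 := enorm_dist3 (ess_left c x) (ess_right c x) (f z).
    by rewrite -/J in h4; rewrite /k; clearbody J; lra.
  - by move: (lt_le_trans xz zw); rewrite ltNge (ltW wx').
  - rewrite !Sr// (_ : T w - k - (T z - k) = T w - T z); last by lra.
    exact: (vc_control V).
move: H; rewrite -lenT lee_fin.
have S0 : S 0 = 0.
  have [x00|xp] := eqVneq x 0.
    rewrite -{1}x00 Sx; apply/eqP; rewrite eq_le; apply/andP; split.
      by apply: (le_trans Tl); rewrite (vc_le0 V) ?x00.
    have := @lim_left_ub _ T mT x (x - 1); rewrite (vc_le0 V (x := x - 1)); last by lra.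
    by apply; lra.
  by rewrite Sl ?(vc_le0 V)// lt_def xp x0.
rewrite S0 subr0; have [x11|xn] := eqVneq x 1.
  have S1 : S 1 = lim_left T x by rewrite -x11 Sx.
  have Tp1 : lim_right T x <= fine (len c).
    have := @lim_right_lb _ T mT x (x + 1); rewrite (vc_ge1 V (x := x + 1)); last by lra.
    by apply; lra.
  by rewrite S1 /k; lra.
have xl1 : x < 1 by rewrite lt_neqAle xn x1.
rewrite (Sr 1 xl1) (vc_ge1 V (lexx 1)); lra.
Qed.

(** One-sided means at [x] tend to the essential limit by definition of the latter, and to [c x] by
    the Lebesgue property. *)
Lemma ess_value x : E x -> 0 < x < 1 -> ess_left c x = c x /\ ess_right c x = c x.
Proof.
move=> Ex x01; have /andP[x0 x1] := x01.
have Ix : I01 R x by apply/I01P; rewrite !ltW.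
have Lx := vc_leb V Ex x01.
have ei (a b : R) : 0 <= a -> b <= 1 ->
    mu.-integrable `[a, b] (EFin \o (fun t => enorm (c t - c x))).
  move=> a0 b1; apply: integrable_I01_sub => //; apply: integrable_enorm.
  by apply: curve_integrableB => //; exact: curve_integrable_cst.
(* a limit value other than [c x] would bound the averages of
   [|c t - c x|] from below *)
have main (p : 'rV[R]_d) (D : R -> interval R) :
    (forall h, [set` D h] = `[x - h, x]%classic \/ [set` D h] = `[x, x + h]%classic) ->
    (forall e, 0 < e -> \forall h \near 0^'+, {ae mu, forall t, [set` D h] t -> enorm (c t - p) <= e}) ->
    p = c x.
  move=> hD hp; apply/eqP; rewrite -subr_eq0; apply/eqP/enorm0_eq0/eqP.
  rewrite eq_le enorm_ge0 andbT leNgt; apply/negP => n0.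
  set n := enorm (p - c x) in n0.
  (* On a half-window of length [h] the curve would stay within [n / 4] of [p], so at least
     [3 * (n / 4)] away from [c x]; the integral would be at least [3 * (n / 4) * h], against the
     bound [n / 4 * h]. *)
  have n4 : 0 < n / 4 by rewrite divr_gt0.
  have n3 : 0 <= 3 * (n / 4) by rewrite mulr_ge0// ltW.
  have : \forall h \near (0 : R)^'+, False; last by move=> /filter_ex [].
  near=> h.
  have h0 : 0 < h by near: h; exact: nbhs_right_gt.
  have hx : h < x by near: h; apply: nbhs_right_lt.
  have hx1 : h < 1 - x by near: h; apply: nbhs_right_lt; rewrite subr_gt0.
  have L : \int[mu]_(t in `[x - h, x + h]) enorm (c t - c x) <= n / 4 * h.
    by near: h; exact: Lx.
  have Hp : {ae mu, forall t, [set` D h] t -> enorm (c t - p) <= n / 4}.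
    by near: h; exact: hp.
  have [a [b [Dab ab xa bx]]] : exists a b, [/\ [set` D h] = `[a, b]%classic, b - a = h, x - h <= a & b <= x + h].
    by case: (hD h) => ->; [exists (x - h), x|exists x, (x + h)]; split => //; lra.
  have a0 : 0 <= a by lra.
  have b1 : b <= 1 by lra.
  have ab' : a <= b by lra.
  have L' : \int[mu]_(t in `[a, b]) enorm (c t - c x) <= n / 4 * h.
    apply: le_trans L; apply: Rintegral_subset => //.
    - by apply: subset_itv; rewrite bnd_simp; lra.
    - by apply: ei; lra.
    - by move=> *; exact: enorm_ge0.
  have : `|\int[mu]_(t in `[a, b]) (3 * (n / 4))| <= \int[mu]_(t in `[a, b]) enorm (c t - c x).
    apply: Rintegral_ae_le => //.
    - by apply: integrable_cont; exact: cst_continuous.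
    - exact: ei.
    - by move=> *; exact: enorm_ge0.
    - apply: ae_imp Hp => t Ht tab; have {}Ht := Ht ltac:(by rewrite Dab).
      rewrite (ger0_norm n3).
      have := enorm_dist3 (c t) p (c x); rewrite (enormBC p (c t)) -/n.
      by move: Ht; clearbody n; lra.
  rewrite Rintegral_cst_itv// ab (ger0_norm (mulr_ge0 n3 (ltW h0))).
  move=> H; have := le_trans H L'; rewrite leNgt => /negP; apply.
  by rewrite ltr_pM2r// ltr_pMl// ltr1n.
have xn0 : x != 0 by rewrite gt_eqF.
have xn1 : x != 1 by rewrite lt_eqF.
split.
- apply: (main _ (fun h => `[x - h, x])) => [h|e e0]; first by left.
  have aE01 : {ae mu, forall x, 0 < x < 1 -> E x} by apply: ae_imp (vc_ae V).
  have [r r0 Hr] := left_value_ess mT aE01 (vc_eq V) (x := x) ltac:(by rewrite x0 ltW) (vc_left V Ix) e0.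
  near=> h.
  have hr : h < r by near: h; apply: nbhs_right_lt.
  apply: ae_imp (ae_and Hr (ae_neq x)) => t [Ht tx]; rewrite /= in_itv/= => /andP[t1 t2].
  have tx' : t < x by rewrite lt_neqAle t2 andbT; apply/eqP.
  by apply/ltW/Ht; rewrite tx' andbT; lra.
- apply: (main _ (fun h => `[x, x + h])) => [h|e e0]; first by right.
  have aE01 : {ae mu, forall x, 0 < x < 1 -> E x} by apply: ae_imp (vc_ae V).
  have [r r0 Hr] := right_value_ess mT aE01 (vc_eq V) (x := x) ltac:(by rewrite x1 ltW) (vc_right V Ix) e0.
  near=> h.
  have hr : h < r by near: h; apply: nbhs_right_lt.
  apply: ae_imp (ae_and Hr (ae_neq x)) => t [Ht tx]; rewrite /= in_itv/= => /andP[t1 t2].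
  have tx' : x < t by rewrite lt_neqAle t1 andbT; apply/eqP => xt; exact: tx.
  by apply/ltW/Ht; rewrite tx'/=; lra.
Unshelve. all: by end_near. Qed.

(** [S] charges to [x] the part of the jump from the left limit to [p x]; the rest is charged to the
    increment that starts at [x]. At 1 the two limits agree by convention, so the total does not
    exceed [T 1]. *)
Lemma selection_control_aux p :
  (forall x, I01 R x -> segment (ess_left c x) (ess_right c x) (p x)) ->
  let S x := lim_left T x + enorm (p x - ess_left c x) in
  controlled (I01 R) S p /\ S 1 - S 0 <= fine (len c).
Proof.
move=> hp S; have I0 : I01 R 0 by apply/I01P; rewrite lexx ler01.
have I1 : I01 R 1 by apply/I01P; rewrite lexx ler01.
split; last first.
  have p1 : p 1 = ess_left c 1.
    by have := hp 1 I1; rewrite /ess_right eqxx {1}/ess_left oner_eq0 => /segmentxx ->; rewrite /ess_left oner_eq0.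
  have := lim_left_self mT 1; rewrite (vc_ge1 V (lexx 1)) => h1.
  have h0 : 0 <= lim_left T 0.
    have := @lim_left_ub _ T mT 0 (- 1); rewrite (vc_le0 V (x := -1)); last by lra.
    by apply; lra.
  rewrite /S p1 subrr enorm0; have := enorm_ge0 (p 0 - ess_left c 0); lra.
move=> x y Ix Iy; rewrite le_eqVlt => /predU1P[->|xy]; first by rewrite !subrr enorm0.
have h1 := segment_enorm (hp x Ix).
have h2 := ess_jump_le Ix; have h3 := vc_left_right Ix Iy xy.
have h4 := enorm_dist3 (ess_left c y) (p y) (p x).
have h5 := enorm_dist3 (ess_right c x) (ess_left c y) (p x).
rewrite /S; lra.
Qed.

End with_control.

Lemma selection_control c p : BV c ->
  (forall x, I01 R x -> segment (ess_left c x) (ess_right c x) (p x)) ->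
  exists2 S, controlled (I01 R) S p & S 1 - S 0 <= fine (len c).
Proof.
move=> cBV hp; have [T [E [f V]]] := BV_var_control cBV.
have [h1 h2] := selection_control_aux V hp.
by exists (fun x => lim_left T x + enorm (p x - ess_left c x)).
Qed.

End control_consequences.

(** * Strict convergence and selections of the jump segments *)

Section strict_limits.
Context (R : realType) (d : nat).
Notation mu := (@lebesgue_measure R).
Implicit Types (c f g w : R -> 'rV[R]_d) (x y a b : R) (p q : 'rV[R]_d).

Definition L1dist c w := \int[mu]_(x in I01 R) enorm (c x - w x).

Lemma integrable_dist c w : curve_integrable c -> curve_integrable w ->
  mu.-integrable (I01 R) (EFin \o (fun x => enorm (c x - w x))).
Proof. by move=> ci wi; apply: integrable_enorm; exact: curve_integrableB. Qed.

Lemma L1dist_ge0 c w : 0 <= L1dist c w.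
Proof. by apply: Rintegral_ge0 => *; exact: enorm_ge0. Qed.

Lemma L1dist_triangle c f w : curve_integrable c -> curve_integrable f -> curve_integrable w ->
  L1dist c w <= L1dist c f + L1dist f w.
Proof.
move=> ci fi wi; rewrite /L1dist -RintegralD; first last.
- exact: integrable_dist.
- exact: integrable_dist.
- exact: measurable_I01.
apply: le_Rintegral.
- exact: measurable_I01.
- exact: integrable_dist.
- rewrite [X in mu.-integrable _ X](_ : _ = (EFin \o (fun x => enorm (c x - f x))) \+
    (EFin \o (fun x => enorm (f x - w x))))%E//.
  by apply: integrableD; [exact: measurable_I01|exact: integrable_dist|exact: integrable_dist].
- by move=> x _; exact: enorm_dist3.
Qed.

Lemma Rintegral_cst_I01 (k : R) : \int[mu]_(x in I01 R) k = k.
Proof. by rewrite /I01 Rintegral_cst_itv ?ler01// subr0 mulr1. Qed.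

(** The competitor that waits at [p] during a window: whether it is longer than [c] tells whether
    [p] is off the path of [c]. *)
Definition splice a b p c x := if a < x < b then p else c x.

Lemma curve_integrable_splice a b p c : curve_integrable c ->
  curve_integrable (splice a b p c).
Proof.
move=> ci i; pose A := `]a, b[%classic : set R.
have mA : measurable A by exact: measurable_itv.
have h1 : mu.-integrable (I01 R) (EFin \o (fun x => c x 0 i - p 0 i)).
  apply: integrableRB; [exact: measurable_I01|exact: ci|].
  exact: (@curve_integrable_cst R d p i).
have h2 : mu.-integrable (I01 R)
    (EFin \o ((fun x => c x 0 i - p 0 i) \* (fun x => 1 - \1_A x))).
  apply: (@integrable_mul_bounded _ _ _ _ 1) => //; first exact: measurable_I01.
    apply: measurable_funB; first exact: measurable_cst.
    exact: measurable_indic.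
  by move=> x _; rewrite indicE; case: (_ \in _); rewrite ?subrr ?subr0 ?normr0 ?normr1.
have h3 := integrableRB (@measurable_I01 R) (@curve_integrable_cst R d (p) i)
  (integrableN h2).
rewrite [X in mu.-integrable _ X](_ : _ =
  (EFin \o (fun x => p 0 i - - ((c x 0 i - p 0 i) * (1 - \1_A x))))); last first.
  apply/funext => x /=; congr EFin; rewrite indicE /splice.
  have -> : (x \in A) = (a < x < b).
    by apply/idP/idP; rewrite inE /A/= in_itv.
  by case: (a < x < b) => /=; ring.
exact: h3.
Qed.

Lemma L1dist_splice a b p q c w : curve_integrable c -> curve_integrable w ->
  L1dist (splice a b p c) (splice a b q w) <= L1dist c w + enorm (p - q).
Proof.
move=> ci wi; rewrite /L1dist -[in leRHS](Rintegral_cst_I01 (enorm (p - q))) -RintegralD; first last.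
- by apply: integrable_cont; exact: cst_continuous.
- exact: integrable_dist.
- exact: measurable_I01.
apply: le_Rintegral.
- exact: measurable_I01.
- by apply: integrable_dist; exact: curve_integrable_splice.
- rewrite [X in mu.-integrable _ X](_ : _ = (EFin \o (fun x => enorm (c x - w x))) \+
    (EFin \o cst (enorm (p - q))))%E//.
  apply: integrableD; [exact: measurable_I01|exact: integrable_dist|].
  by apply: integrable_cont; exact: cst_continuous.
- by move=> x _; rewrite /splice; case: ifP => _; rewrite ?lerDr ?lerDl enorm_ge0.
Qed.

(** Stated with an upper bound [L] along a filter, so that it applies to sequences, to restricted
    sets of indices and to ultrafilters. *)
Lemma len_lsc (K : Type) (F : set_system K) (w_ : K -> R -> 'rV[R]_d) w (L : R) :
  ProperFilter F -> curve_integrable w ->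
  (\forall k \near F, curve_integrable (w_ k)) ->
  (forall e, 0 < e -> \forall k \near F, L1dist (w_ k) w < e) ->
  (forall e, 0 < e -> \forall k \near F, (len (w_ k) <= (L + e)%:E)%E) ->
  (len w <= L%:E)%E.
Proof.
move=> FF wi wki dw lw; apply: ge_ereal_sup => _ [psi [tp p1] <-].
rewrite lee_fin; apply/ler_addgt0Pr => e e0.
have [M M0 hM] := test_velocity_bounded tp.
have e1 : 0 < e / 2 by rewrite divr_gt0.
have e2 : 0 < e / 2 / (M + 1) by rewrite divr_gt0// ltr_wpDl.
have [k [[ki dk] lk]] := filter_ex (filterI (filterI wki (dw _ e2)) (lw _ e1)).
have := distr_deriv_dist ki wi tp hM; rewrite -/(L1dist (w_ k) w) => H1.
have H2 : distr_deriv (w_ k) psi <= L + e / 2.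
  rewrite -lee_fin; apply: le_trans lk; apply: ereal_sup_ubound.
  by exists psi.
have H3 : M * L1dist (w_ k) w <= e / 2.
  apply: (@le_trans _ _ ((M + 1) * (e / 2 / (M + 1)))).
    by apply: ler_pM => //; [exact: L1dist_ge0|rewrite lerDl|exact: ltW].
  by rewrite mulrC divfK// gt_eqF// ltr_wpDl.
move: H1 H2 H3; rewrite ler_norml => /andP[+ _].
move: (distr_deriv _ _) (distr_deriv _ _) (M * _) => A B C; lra.
Qed.

(** The spliced curve is a selection of [c], with value [p] at [y], precomposed with the monotone
    map collapsing the window to [y]. Neither operation lengthens. *)
Lemma len_splice_le c a b y p : BV c -> good_rep c -> I01 R y -> a < y < b ->
  segment (ess_left c y) (ess_right c y) p ->
  (len (splice a b p c) <= len c)%E.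
Proof.
move=> cBV cg Iy ayb hp.
pose q x := if x == y then p else c x.
have [|S cS SL] := @selection_control R d c q cBV.
  by move=> x Ix; rewrite /q; case: eqP => [->//|_]; exact: cg.
have Smono x x' : I01 R x -> I01 R x' -> x <= x' -> S x <= S x'.
  by move=> Ix Ix' xx; rewrite -subr_ge0 (le_trans (enorm_ge0 _) (cS _ _ Ix Ix' xx)).
pose r x := if a < x < b then y else x.
have rI x : I01 R x -> I01 R (r x) by rewrite /r; case: ifP.
have /I01P/andP[y0 y1] := Iy.
have rmono x x' : x <= x' -> r x <= r x'.
  move=> xx; rewrite /r; case/andP : ayb => ay yb.
  case: ifPn => [/andP[ax xb]|]; case: ifPn => [/andP[ax' xb']|] //.
    by rewrite (lt_le_trans ax xx)/= -leNgt => bx'; rewrite (le_trans (ltW yb)).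
  by rewrite (le_lt_trans xx xb') andbT -leNgt => xa; rewrite (le_trans xa)// ltW.
have E x : I01 R x -> splice a b p c x = q (r x).
  move=> Ix; rewrite /splice /q /r; case: ifPn => [_|xab]; first by rewrite eqxx.
  by case: eqP => // xy; move: xab; rewrite xy ayb.
have I0 : I01 R 0 by apply/I01P; rewrite lexx ler01.
have I1 : I01 R 1 by apply/I01P; rewrite lexx ler01.
rewrite -(len_fineK cBV); apply: (@le_trans _ _ (S (r 1) - S (r 0))%:E).
  apply: (@len_le_control_I01 _ _ _ (S \o r)); first by apply: curve_integrable_splice; case: cBV.
  by move=> x x' Ix Ix' xx; rewrite !E//; apply: cS; [exact: rI|exact: rI|exact: rmono].
rewrite lee_fin (le_trans _ SL)// lerB//; apply: Smono => //; try exact: rI.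
  by have /rI/I01P/andP[] := I1.
by have /rI/I01P/andP[] := I0.
Qed.

(* If [len (splice a b p c) <= len c], a control of [c] is obtained by gluing
   the control of the spliced curve outside [a, b] and that of [c] inside;
   comparing totals bounds what the spliced curve does on [a, b]. *)
Lemma splice_jump c T E f a b p : BV c -> var_control c T E f ->
  a < b -> (a < 0 \/ [/\ 0 < a, a < 1 & E a]) -> (1 < b \/ [/\ 0 < b, b < 1 & E b]) ->
  a < 1 -> 0 < b -> (len (splice a b p c) <= len c)%E ->
  (if 0 < a then enorm (p - c a) else 0) + (if b < 1 then enorm (c b - p) else 0)
   <= T b - T a.
Proof.
move=> cBV V ab ha hb a1 b0 lw; set w := splice a b p c.
have ci : curve_integrable c by case: cBV.
have wBV : BV w.
  by split; [exact: curve_integrable_splice|apply: le_lt_trans lw _; case: cBV].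
have [Tw [Ew [fw W]]] := BV_var_control wBV.
have mT := vc_mono V; have mW := vc_mono W.
have lenT := len_fineK cBV; have lenW := len_fineK wBV.
have lwc : fine (len w) <= fine (len c) by rewrite -lee_fin lenT lenW.
have wout x : ~~ (a < x < b) -> w x = c x by rewrite /w /splice => /negbTE ->.
have win x : a < x < b -> w x = p by rewrite /w /splice => ->.
have Ia : 0 < a -> I01 R a by move=> a0; apply/I01P; rewrite !ltW.
have Ib : b < 1 -> I01 R b by move=> b1; apply/I01P; rewrite !ltW.
have Ea : 0 < a -> E a.
  by case: ha => [a0 a00|[]//]; move: (lt_trans a0 a00); rewrite ltxx.
have Eb : b < 1 -> E b.
  by case: hb => [b1 b11|[]//]; move: (lt_trans b1 b11); rewrite ltxx.
have lwa : 0 < a -> ess_left w a = c a.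
  move=> a0; apply: ess_left_eq; first by rewrite gt_eqF.
  have [Ec _] := ess_value ci V (Ea a0) (introT andP (conj a0 a1)).
  have aE01 : {ae mu, forall x, 0 < x < 1 -> E x} by apply: ae_imp (vc_ae V).
  move=> e e0; have [r r0 Hr] :=
    left_value_ess mT aE01 (vc_eq V) (introT andP (conj a0 (ltW a1))) (vc_left V (Ia a0)) e0.
  exists r => //; apply: ae_imp Hr => y Hy yr; rewrite wout.
    by rewrite -Ec; exact: Hy.
  by move/andP : yr => [_ ya]; rewrite negb_and -leNgt (ltW ya).
have rwb : b < 1 -> ess_right w b = c b.
  move=> b1; apply: ess_right_eq; first by rewrite lt_eqF.
  have [_ Ec] := ess_value ci V (Eb b1) (introT andP (conj b0 b1)).
  have aE01 : {ae mu, forall x, 0 < x < 1 -> E x} by apply: ae_imp (vc_ae V).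
  move=> e e0; have [r r0 Hr] :=
    right_value_ess mT aE01 (vc_eq V) (introT andP (conj (ltW b0) b1)) (vc_right V (Ib b1)) e0.
  exists r => //; apply: ae_imp Hr => y Hy yr; rewrite wout.
    by rewrite -Ec; exact: Hy.
  by move/andP : yr => [yb _]; rewrite negb_and orbC -leNgt (ltW yb).
have rwa : 0 < a -> ess_right w a = p.
  move=> a0; apply: ess_right_eq; first by rewrite lt_eqF.
  move=> e e0; exists (b - a); first by rewrite subr_gt0.
  by apply: aeW => y; rewrite addrC subrK => yab; rewrite win// subrr enorm0.
have lwb : b < 1 -> ess_left w b = p.
  move=> b1; apply: ess_left_eq; first by rewrite gt_eqF.
  move=> e e0; exists (b - a); first by rewrite subr_gt0.
  by apply: aeW => y; rewrite opprB addrC subrK => yab; rewrite win// subrr enorm0.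
pose A := lim_left Tw a; pose B := lim_right Tw b.
(* The pieces are shifted so as to join at the left limit [A] and the right limit [B] of [Tw];
   thereby the jumps of [Tw] at [a] and [b] are left out of [S]. *)
pose S x := if x < a then Tw x else if x <= b then A + T x - T a else A + T b - T a + Tw x - B.
have S1 x : x < a -> S x = Tw x by rewrite /S => ->.
have S2 x : a <= x -> x <= b -> S x = A + T x - T a.
  by move=> ax xb; rewrite /S ltNge ax xb.
have S3 x : b < x -> S x = A + T b - T a + Tw x - B.
  by move=> bx; rewrite /S ltNge (ltW (lt_trans ab bx)) leNgt bx.
have mS : {homo S : x y / x <= y}.
  move=> x y xy.
  have [xa|ax] := ltP x a.
    have [ya|ay] := ltP y a; first by rewrite !S1// mW.
    have h := lim_left_ub mW xa; rewrite -/A in h.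
    have [yb|by_] := leP y b.
      have := mT _ _ ay; rewrite (S1 x xa) (S2 y ay yb); lra.
    have := lim_right_lb mW by_; rewrite -/B.
    have := mT _ _ (ltW ab); rewrite (S1 x xa) (S3 y by_); lra.
  have ay := le_trans ax xy.
  have [xb|bx] := leP x b.
    have [yb|by_] := leP y b.
      have := mT _ _ xy; rewrite (S2 x ax xb) (S2 y ay yb); lra.
    have := lim_right_lb mW by_; rewrite -/B.
    have := mT _ _ xb; rewrite (S2 x ax xb) (S3 y by_); lra.
  have by_ := lt_le_trans bx xy.
  have := mW _ _ xy; rewrite (S3 x bx) (S3 y by_); lra.
have H : (len c <= (S 1 - S 0)%:E)%E.
  apply: (@len_le_control R d c (E `&` Ew) S) => //.
    by apply: ae_imp (ae_and (vc_ae V) (vc_ae W)) => x [].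
  have inL x : Ew x -> 0 < x < 1 -> x < a -> enorm (c a - c x) <= A - Tw x.
    move=> Ewx x01 xa; have a0 : 0 < a by case/andP : x01 => x0 _; exact: lt_trans xa.
    have := vc_left W (Ia a0) Ewx xa; rewrite lwa// (vc_eq W x01) wout//.
    by rewrite negb_and -leNgt (ltW xa).
  have inR x : Ew x -> 0 < x < 1 -> b < x -> enorm (c x - c b) <= Tw x - B.
    move=> Ewx x01 bx; have b1 : b < 1 by case/andP : x01 => _ x1; exact: lt_trans x1.
    have := vc_right W (Ib b1) Ewx bx; rewrite rwb// (vc_eq W x01) wout//.
    by rewrite negb_and orbC -leNgt (ltW bx).
  have inM x y : E x -> E y -> 0 < x < 1 -> 0 < y < 1 -> x <= y -> enorm (c y - c x) <= T y - T x.
    by move=> Ex Ey x01 y01 xy; rewrite -!(vc_eq V)//; exact: (vc_control V).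
  move=> x y [[Ex Ewx] x01] [[Ey Ewy] y01] xy.
  have {}x01 : 0 < x < 1 by move: x01; rewrite /= in_itv.
  have {}y01 : 0 < y < 1 by move: y01; rewrite /= in_itv.
  have [xa|ax] := ltP x a.
    have a01 : 0 < a < 1 by rewrite a1 andbT; case/andP : x01 => x0 _; exact: lt_trans xa.
    have Ea' : E a by apply: Ea; case/andP : a01.
    have hx := inL x Ewx x01 xa.
    have [ya|ay] := ltP y a.
      rewrite (S1 x xa) (S1 y ya).
      have := vc_control W Ewx Ewy xy; rewrite !(vc_eq W)// !wout//.
        by rewrite negb_and -leNgt (ltW xa).
      by rewrite negb_and -leNgt (ltW ya).
    have [yb|by_] := leP y b.
      have := inM a y Ea' Ey a01 y01 ay; have := enorm_dist3 (c a) (c y) (c x).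
      rewrite (S1 x xa) (S2 y ay yb); lra.
    have b01 : 0 < b < 1 by rewrite b0/=; case/andP : y01 => _; exact: lt_trans.
    have Eb' : E b by apply: Eb; case/andP : b01.
    have := inM a b Ea' Eb' a01 b01 (ltW ab); have := inR y Ewy y01 by_.
    have := enorm_dist3 (c a) (c b) (c x); have := enorm_dist3 (c b) (c y) (c x).
    rewrite (S1 x xa) (S3 y by_); lra.
  have ay := le_trans ax xy.
  have [xb|bx] := leP x b.
    have [yb|by_] := leP y b.
      have := inM x y Ex Ey x01 y01 xy; rewrite (S2 x ax xb) (S2 y ay yb); lra.
    have b01 : 0 < b < 1 by rewrite b0/=; case/andP : y01 => _; exact: lt_trans.
    have Eb' : E b by apply: Eb; case/andP : b01.
    have := inM x b Ex Eb' x01 b01 xb; have := inR y Ewy y01 by_.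
    have := enorm_dist3 (c b) (c y) (c x).
    rewrite (S2 x ax xb) (S3 y by_); lra.
  have by_ := lt_le_trans bx xy.
  rewrite (S3 x bx) (S3 y by_).
  have := vc_control W Ewx Ewy xy; rewrite !(vc_eq W)// !wout//.
  - lra.
  - by rewrite negb_and orbC -leNgt (ltW bx).
  - by rewrite negb_and orbC -leNgt (ltW by_).
have S0 : S 0 = (if 0 < a then 0 else A - T a).
  case: ifPn => [a0|]; first by rewrite (S1 0 a0) (vc_le0 W).
  by rewrite -leNgt => a0; rewrite (S2 0 a0 (ltW b0)) (vc_le0 V (lexx 0)) addr0.
have A0 : a <= 0 -> A = 0.
  move=> a0; apply/eqP; rewrite eq_le; apply/andP; split.
    by rewrite /A (le_trans (lim_left_self mW a))// (vc_le0 W).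
  have := @lim_left_ub _ Tw mW a (a - 1); rewrite (vc_le0 W (x := a - 1)); last by lra.
  by apply; lra.
have B1 : 1 <= b -> B = fine (len w).
  move=> b1; apply/eqP; rewrite eq_le; apply/andP; split.
    have := @lim_right_lb _ Tw mW b (b + 1); rewrite (vc_ge1 W (x := b + 1)); last by lra.
    by apply; lra.
  by rewrite -(vc_ge1 W b1) /B lim_right_self.
(* [S] controls [c], so it grows by at least [len c]; as [len w <= len c], the growth [B - A] that
   was replaced is at most the growth of [T] put in its place. *)
have key : B - A <= T b - T a.
  move: H; rewrite -lenT lee_fin S0.
  have a_out : ~~ (0 < a) -> A = 0 /\ T a = 0.
    by rewrite -leNgt => a0; rewrite A0// (vc_le0 V).
  have [b1|b1] := ltP b 1.
    rewrite (S3 1 b1) (vc_ge1 W (lexx 1)).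
    case: ifPn => [_|/a_out[-> ->]]; lra.
  rewrite (S2 1 (ltW a1) b1) (vc_ge1 V (lexx 1)) (B1 b1) (vc_ge1 V b1).
  case: ifPn => [_|/a_out[-> ->]]; lra.
apply: le_trans key.
(* [B - A] contains the jump of [w] at [a], from [c a] to [p], and the jump at [b], from [p] to
   [c b]. *)
have hAB := lim_right_left mW ab.
have hA : A + (if 0 < a then enorm (p - c a) else 0) <= lim_right Tw a.
  case: ifPn => [a0|_]; last first.
    by rewrite addr0 (le_trans (lim_left_self mW a))// lim_right_self.
  have := ess_jump_le W (Ia a0); rewrite rwa// lwa// -/A; lra.
have hB : lim_left Tw b + (if b < 1 then enorm (c b - p) else 0) <= B.
  case: ifPn => [b1|_]; last first.
    by rewrite addr0 (le_trans (lim_left_self mW b))// lim_right_self.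
  have := ess_jump_le W (Ib b1); rewrite rwb// lwb// -/B; lra.
lra.
Qed.

End strict_limits.

(** * Stability of the jump segments under strict convergence *)

Section segment_limit.
Context (R : realType) (d : nat).
Notation mu := (@lebesgue_measure R).
Implicit Types (c f g w : R -> 'rV[R]_d) (x y a b : R) (p q : 'rV[R]_d).

(** Strict convergence along a filter. Lengths are bounded from above only, since the opposite bound
    follows from L1 convergence by [len_lsc]. *)
Definition strict_lim (K : Type) (F : set_system K) (c_ : K -> R -> 'rV[R]_d) c :=
  (forall e : R, 0 < e -> \forall k \near F, L1dist (c_ k) c < e) /\
  (forall e : R, 0 < e -> \forall k \near F, (len (c_ k) <= (fine (len c) + e)%:E)%E).

Lemma segment_limit (K : Type) (F : set_system K) (c_ : K -> R -> 'rV[R]_d) c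
    (y_ : K -> R) y (p_ : K -> 'rV[R]_d) p :
  ProperFilter F -> BV c -> (\forall k \near F, BV (c_ k) /\ good_rep (c_ k)) ->
  strict_lim F c_ c ->
  (\forall k \near F, I01 R (y_ k) /\
     segment (ess_left (c_ k) (y_ k)) (ess_right (c_ k) (y_ k)) (p_ k)) ->
  (forall e, 0 < e -> \forall k \near F, `|y_ k - y| < e) -> I01 R y ->
  vcvg F p_ p -> segment (ess_left c y) (ess_right c y) p.
Proof.
move=> FF cBV c_BV [cL cl] hy_ y_y Iy p_p.
have ci : curve_integrable c by case: cBV.
have [T [E [f V]]] := BV_var_control cBV.
have mT := vc_mono V; have lenT := len_fineK cBV.
have lenp a b : a < y -> y < b -> (len (splice a b p c) <= len c)%E.
  move=> ay yb; rewrite -lenT.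
  have m0 : 0 < Num.min (y - a) (b - y) by rewrite lt_min !subr_gt0 ay yb.
  have near_ab : \forall k \near F, a < y_ k < b.
    apply: filterS (y_y _ m0) => k; rewrite lt_min ltr_norml ltr_norml.
    by move=> /andP[/andP[h1 h2] /andP[h3 h4]]; apply/andP; split; lra.
  apply: (@len_lsc _ _ _ F (fun k => splice a b (p_ k) (c_ k))).
  - exact: curve_integrable_splice.
  - by apply: filterS c_BV => k [[ki _] _]; exact: curve_integrable_splice.
  - move=> e e0; have e2 : 0 < e / 2 by rewrite divr_gt0.
    apply: filterS2 (filterI (cL _ e2) (p_p _ e2)) c_BV => k [h1 h2] [[ki _] _].
    rewrite (le_lt_trans (L1dist_splice _ _ _ _ ki ci))//; lra.
  - move=> e e0; apply: filterS3 (filterI (cl _ e0) near_ab) hy_ c_BV => k [h1 h2] [h3 h4] [h5 h6].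
    by apply: le_trans h1; exact: (len_splice_le h5 h6 h3 h2 h4).
have /I01P/andP[y0 y1] := Iy.
have key a b (ay : a < y) (yb : y < b) := @splice_jump R d c T E f a b p cBV V (lt_trans ay yb).
have hl := vc_left V Iy; have hr := vc_right V Iy.
have J := ess_jump_ge ci V lenT Iy.
have pickL e : 0 < e -> 0 < y -> exists2 a, [/\ 0 < a, a < y & E a] & lim_left T y - e < T a.
  move=> e0 yp; have [z zy hz] := lim_left_adherent mT y e0.
  have [|a Ea /andP[za ay]] := vc_dense V (a := Num.max z 0) (b := y); first by rewrite gt_max zy.
  move: za; rewrite gt_max => /andP[za a0]; exists a => //; apply: hz => //; exact: ltW.
have pickR e : 0 < e -> y < 1 -> exists2 b, [/\ b < 1, y < b & E b] & T b < lim_right T y + e.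
  move=> e0 yp; have [z zy hz] := lim_right_adherent mT y e0.
  have [|b Eb /andP[yb bz]] := vc_dense V (a := y) (b := Num.min z 1); first by rewrite lt_min zy.
  move: bz; rewrite lt_min => /andP[bz b1]; exists b => //; apply: hz => //; exact: ltW.
have fc x : 0 < x -> x < 1 -> f x = c x by move=> x0 x1; apply: (vc_eq V); rewrite x0.
(* At an end the segment is a single point and the window overhangs [I]. With left end -1, where [T]
   vanishes, only the cost at [b] remains, and it is small because [T] does not jump where [c] does
   not. The case of 1 is symmetric. *)
have [y00|yn0] := eqVneq y 0.
  have q : ess_left c y = ess_right c y.
    by rewrite /ess_left /ess_right y00 eqxx eq_sym oner_eq0.
  have -> : p = ess_right c y; last by rewrite q; exact: segment_l.
  apply/eqP; rewrite -subr_eq0; apply/eqP/enorm0_eq0/eqP; rewrite eq_le enorm_ge0 andbT.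
  apply/ler_addgt0Pr => e e0; have e2 : 0 < e / 2 by rewrite divr_gt0.
  have yl1 : y < 1 by rewrite y00.
  have [b [b1 yb Eb] Tb] := pickR _ e2 yl1.
  have b0 : 0 < b by rewrite -y00.
  have ay : -1 < y by rewrite y00; lra.
  have := key (-1) b ay yb; rewrite ifF; last by apply/negbTE; rewrite -leNgt; lra.
  rewrite b1 add0r => H.
  have {}H : enorm (c b - p) <= T b - T (-1).
    by apply: H; [left; lra|right|lra| |exact: lenp].
  have h := hr b Eb yb; rewrite (fc b b0 b1) in h.
  have := enorm_dist3 (c b) p (ess_right c y); rewrite (enormBC p (c b)).
  move: J; rewrite q subrr enorm0.
  have := lim_left_self mT y; rewrite {2}y00 (vc_le0 V (lexx 0)).
  rewrite (vc_le0 V (x := -1)) in H; last by lra.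
  have := lim_right_self mT y; rewrite {1}y00 (vc_le0 V (lexx 0)).
  lra.
have [y11|yn1] := eqVneq y 1.
  have q : ess_right c y = ess_left c y.
    by rewrite /ess_left /ess_right y11 eqxx oner_eq0.
  have -> : p = ess_left c y; last by rewrite q; exact: segment_l.
  apply/eqP; rewrite -subr_eq0; apply/eqP/enorm0_eq0/eqP; rewrite eq_le enorm_ge0 andbT.
  apply/ler_addgt0Pr => e e0; have e2 : 0 < e / 2 by rewrite divr_gt0.
  have yl0 : 0 < y by rewrite y11.
  have [a [a0 ay Ea] Ta] := pickL _ e2 yl0.
  have a1 : a < 1 by rewrite -y11.
  have yb : y < 2 by rewrite y11; lra.
  have := key a 2 ay yb; rewrite a0 ifF; last by apply/negbTE; rewrite -leNgt; lra.
  rewrite addr0 => H.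
  have {}H : enorm (p - c a) <= T 2 - T a.
    by apply: H; [right|left; lra| |lra|exact: lenp].
  have h := hl a Ea ay; rewrite (fc a a0 a1) in h.
  have := enorm_dist3 (c a) p (ess_left c y); rewrite (enormBC (c a) (ess_left c y)).
  move: J; rewrite q subrr enorm0.
  have := lim_right_self mT y; rewrite {1}y11 (vc_ge1 V (lexx 1)).
  rewrite (vc_ge1 V (x := 2)) in H; last by lra.
  have := lim_left_self mT y; rewrite {2}y11 (vc_ge1 V (lexx 1)).
  lra.
have yp : 0 < y by rewrite lt_def yn0.
have yl1 : y < 1 by rewrite lt_neqAle yn1.
(* Four losses of [e / 4]: two between [T b - T a] and the jump of [T], and one each between [c a],
   [c b] and the one-sided limits. *)
apply: enorm_segment; apply/ler_addgt0Pr => e e0; have e4 : 0 < e / 4 by rewrite divr_gt0.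
have [a [a0 ay Ea] Ta] := pickL _ e4 yp; have [b [b1 yb Eb] Tb] := pickR _ e4 yl1.
have a1 := lt_trans ay yl1; have b0 := lt_trans yp yb.
have := key a b ay yb; rewrite a0 b1 => H.
have {}H : enorm (p - c a) + enorm (c b - p) <= T b - T a.
  by apply: H; [right|right| | |exact: lenp].
have h1 := hl a Ea ay; rewrite (fc a a0 a1) in h1.
have h2 := hr b Eb yb; rewrite (fc b b0 b1) in h2.
have := enorm_dist3 (c a) p (ess_left c y); rewrite (enormBC (c a) (ess_left c y)).
have := enorm_dist3 (c b) (ess_right c y) p; rewrite (enormBC (ess_right c y) (c b)).
lra.
Qed.

End segment_limit.

(** * Absolutely continuous functions *)

Section abs_cont_facts.
Context (R : realType).
Notation mu := (@lebesgue_measure R).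

Lemma abs_cont_unif (V : zmodType) (N : V -> R) (f : R -> V) : abs_cont N f ->
  forall e, 0 < e -> exists2 r, 0 < r &
    forall x y, 0 <= x -> x <= y -> y <= 1 -> y - x < r -> N (f y - f x) < e.
Proof.
move=> fN e e0; have [r r0 H] := fN e e0; exists r => // x y x0 xy y1 xyr.
have := H 1%N (fun=> x) (fun=> y); rewrite !big_ord1; apply => //.
by apply/trivIsetP => i j _ _; rewrite !ord1 eqxx.
Qed.

(** A monotone [g] maps disjoint intervals to disjoint intervals, so the moduli compose. *)
Lemma abs_cont_comp (V : zmodType) (N : V -> R) (f : R -> V) (g : R -> R) :
  abs_cont N f -> abs_cont Num.norm g ->
  (forall x, I01 R x -> I01 R (g x)) ->
  (forall x y, I01 R x -> I01 R y -> x <= y -> g x <= g y) ->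
  abs_cont N (f \o g).
Proof.
move=> fN gN gI gm e e0; have [r r0 H] := fN e e0; have [s s0 G] := gN r r0.
exists s => // n a b ab ti sab.
have Iab i : I01 R (a i) /\ I01 R (b i).
  have [h1 h2 h3] := ab i; split; apply/I01P.
    by rewrite h1 (le_trans h2).
  by rewrite (le_trans h1).
apply: (H n (g \o a) (g \o b)).
- move=> i /=; have [Ia Ib] := Iab i; have [_ h _] := ab i.
  have /gI/I01P/andP[-> _] := Ia; have /gI/I01P/andP[_ ->] := Ib.
  by rewrite gm.
- apply/trivIsetP => i j _ _ ij; apply/disjoints_subset => x /=.
  rewrite !in_itv/= => /andP[h1 h2] /andP[h3 h4].
  have [Iai Ibi] := Iab i; have [Iaj Ibj] := Iab j.
  have lt1 : a i < b j.
    rewrite ltNge; apply/negP => ba.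
    by have := gm _ _ Ibj Iai ba; rewrite leNgt (lt_trans h1).
  have lt2 : a j < b i.
    rewrite ltNge; apply/negP => ba.
    by have := gm _ _ Ibi Iaj ba; rewrite leNgt (lt_trans h3).
  have lti : a i < b i.
    rewrite ltNge; apply/negP => ba.
    by have := gm _ _ Ibi Iai ba; rewrite leNgt (lt_trans h1).
  have ltj : a j < b j.
    rewrite ltNge; apply/negP => ba.
    by have := gm _ _ Ibj Iaj ba; rewrite leNgt (lt_trans h3).
  have m : Num.max (a i) (a j) < Num.min (b i) (b j).
    by rewrite lt_min !gt_max lti lt1 lt2 ltj.
  have := midf_lt m; set z := (_ + _) / _; rewrite gt_max lt_min => -[/andP[z1 z2] /andP[z3 z4]].
  move/trivIsetP : ti => /(_ i j I I ij); move/disjoints_subset => /(_ z) /=.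
  by rewrite !in_itv/= z1 z2 z3 z4; apply.
- apply: (@le_lt_trans _ _ (\sum_(i < n) `|g (b i) - g (a i)|)).
    by apply: ler_sum => i _; exact: ler_norm.
  exact: (G n a b).
Qed.

(** Disjoint intervals listed from right to left: extending the range to the right is then a
    [cons]. *)
Let ordered (s : seq (R * R)) := pairwise (fun p q : R * R => q.2 <= p.1) s.

(** The induction cuts [W] at the left end of the head, the rightmost interval, below which all the
    others lie. *)
Let sum_length_le (W : set R) (s : seq (R * R)) (x : R) : measurable W -> ordered s ->
  (forall p, p \in s -> p.1 <= p.2 /\ p.2 <= x) ->
  (forall p, p \in s -> `]p.1, p.2[%classic `<=` W) ->
  ((\sum_(p <- s) (p.2 - p.1))%:E <= mu (W `&` `]-oo, x[))%E.
Proof.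
move=> mO; elim: s x => [|p s IH] x; first by rewrite big_nil.
rewrite /ordered pairwise_cons => /andP[ps os] hx sO; rewrite big_cons EFinD addeC.
have [p12 p2x] := hx p (mem_head _ _).
have {}IH := IH p.1 os.
have mA : measurable (W `&` `]-oo, p.1[) by apply: measurableI.
apply: (@le_trans _ _ (mu (W `&` `]-oo, p.1[) + mu `]p.1, p.2[)%E).
  apply: leeD.
    apply: IH => q qs; last by apply: sO; rewrite in_cons qs orbT.
    by split; [case: (hx q); rewrite ?in_cons ?qs ?orbT|exact: (allP ps)].
  rewrite lebesgue_measure_itv/= lte_fin; case: ltP => // h.
  by rewrite lee_fin subr_le0.
rewrite -measureU//; last first.
  by apply/disjoints_subset => y [_] /=; rewrite !in_itv/= => yp /andP[py _]; move: (lt_trans yp py); rewrite ltxx.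
apply: le_measure; rewrite ?inE; [exact: measurableU|exact: measurableI|].
move=> y [[Oy]|yp].
  move=> yp; split => //; move: yp; rewrite /= !in_itv/= => yp.
  exact: lt_le_trans (lt_le_trans yp p12) p2x.
split; first exact: (sO p (mem_head _ _)).
by move: yp; rewrite /= !in_itv/= => /andP[_ yp]; exact: lt_le_trans p2x.
Qed.

(** The exceptional null set is enclosed in an open [W] of measure below the modulus for [e]. Off
    [W] the decrease has slope at most [e] on a length at most 1; inside [W] it adds up to at most
    [e]. Hence the total [2 * e]. *)
Lemma abs_cont_nondecreasing (f : R -> R) : abs_cont Num.norm f ->
  {ae mu, forall x, I01 R x -> derivable f x 1 /\ 0 <= derive1 f x} ->
  forall x y, I01 R x -> I01 R y -> x <= y -> f x <= f y.
Proof.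
move=> fAC [N [mN N0 badN]] x0 y0 /I01P/andP[x00 x01] /I01P/andP[y00 y01] xy0.
suff H e : 0 < e -> - (2 * e) <= f y0 - f x0.
  rewrite -subr_ge0 leNgt; apply/negP => fneg.
  have := H (- (f y0 - f x0) / 4); rewrite divr_gt0 ?oppr_gt0// => /(_ isT).
  by move: (f y0 - f x0) fneg => D; lra.
move=> e0; have [r r0 Hr] := fAC e e0.
have Nfin : (mu N < +oo)%E by rewrite N0.
have [W [oO NO ON]] := lebesgue_regularity_outer mN Nfin r0.
have mO : measurable W by exact: open_measurable.
have muO : (mu W < r%:E)%E.
  apply: le_lt_trans ON; rewrite -[X in (_ <= mu X)%E]/(W `\` N).
  rewrite -{1}(setUIDK W N) measureU//; first last.
  - by apply/seteqP; split => x // [[_ Nx] [_ nNx]]; case: (nNx Nx).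
  - exact: measurableD.
  - exact: measurableI.
  rewrite -[leRHS]add0e; apply: leeD => //; rewrite -N0.
  by apply: le_measure; rewrite ?inE//; exact: measurableI.
have good x : I01 R x -> ~ W x -> exists2 t, 0 < t & forall y, `|y - x| < t ->
    (x <= y -> f y - f x >= - (e * (y - x))) /\ (y <= x -> f x - f y >= - (e * (x - y))).
  move=> Ix Ox; have [df df0] : derivable f x 1 /\ 0 <= derive1 f x.
    by apply: contrapT => H; apply: Ox; apply: NO; apply: badN => /(_ Ix).
  have dfx : h^-1 *: (f (h *: (1 : R) + x) - f x) @[h --> 0^'] --> derive1 f x.
    by rewrite derive1E; exact: df.
  move/cvgrPdist_lt : dfx => /(_ e e0) [t /= t0 Ht].
  exists t => // y yx; have [->|yxn] := eqVneq y x; first by rewrite !subrr mulr0 oppr0.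
  have := Ht (y - x); rewrite /= sub0r normrN => /(_ yx); rewrite subr_eq0 => /(_ yxn).
  rewrite /GRing.scale/= mulr1 subrK ltr_norml => /andP[h1 h2].
  have q : - e < (y - x)^-1 * (f y - f x) by lra.
  split => h.
    have p : 0 < y - x by rewrite subr_gt0 lt_def yxn.
    by move: q; rewrite ltr_pdivlMl// => /ltW; rewrite mulrN mulrC.
  have p : 0 < x - y by rewrite subr_gt0 lt_neqAle yxn.
  move: q; rewrite -opprB -(opprB (f x)) invrN mulrNN ltr_pdivlMl// => /ltW.
  by rewrite mulrN mulrC.
(* Continuous induction: between [x0] and [x] the function [f] decreases at rate
   at most [e], except on finitely many disjoint intervals inside [W], where
   absolute continuity bounds the decrease since [W] has small measure. *)
pose S := [set x | x0 <= x <= y0 /\ exists s : seq (R * R),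
  [/\ ordered s, forall p, p \in s -> [/\ x0 <= p.1, p.1 <= p.2 & p.2 <= x],
      forall p, p \in s -> `]p.1, p.2[%classic `<=` W &
      - (e * (x - x0)) - \sum_(p <- s) `|f p.2 - f p.1| <= f x - f x0]].
have Sx0 : S x0.
  split; first by rewrite lexx.
  by exists [::]; split => //; rewrite big_nil !subrr mulr0 oppr0 addr0.
have step1 x x' : S x -> x <= x' -> x' <= y0 -> - (e * (x' - x)) <= f x' - f x -> S x'.
  move=> [/andP[h1 h2] [s [os sx sO Hs]]] xx' xy' fx; split; first by rewrite (le_trans h1).
  exists s; split => //; first by move=> p /sx [? ? h]; split => //; exact: le_trans xx'.
  by move: (\sum_(p <- s) _) Hs => X; lra.
have step2 x x' : S x -> x <= x' -> x' <= y0 -> `]x, x'[%classic `<=` W -> S x'.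
  move=> [/andP[h1 h2] [s [os sx sO Hs]]] xx' xy' xO; split; first by rewrite (le_trans h1).
  exists ((x, x') :: s); split.
  - rewrite /ordered pairwise_cons; apply/andP; split => //.
    by apply/allP => p /sx [].
  - move=> p; rewrite in_cons => /predU1P[->|/sx [? ? h]]; split => //.
    exact: le_trans xx'.
  - by move=> p; rewrite in_cons => /predU1P[->//|/sO].
  - rewrite big_cons/=; have := ler_norm (- (f x' - f x)); rewrite normrN.
    have : e * (x - x0) <= e * (x' - x0) by rewrite ler_wpM2l ?(ltW e0)// lerB.
    by move: (\sum_(p <- s) _) Hs => X; lra.
have hS : has_sup S by split; [exists x0|exists y0 => x [/andP[]]].
set u := sup S.
have ux0 : x0 <= u by apply: sup_upper_bound.
have uy0 : u <= y0 by apply: ge_sup; [exists x0|move=> x [/andP[]]].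
have Iu : I01 R u by apply/I01P; rewrite (le_trans x00 ux0) (le_trans uy0 y01).
have pick t : 0 < t -> exists2 x, S x & u - t < x <= u.
  move=> t0; have [x Sx xt] := sup_adherent t0 hS.
  by exists x => //; rewrite xt/=; apply: sup_upper_bound.
have ballO : W u -> exists2 t, 0 < t & forall y, `|y - u| < t -> W y.
  move=> Ou; have [t /= t0 Ht] := open_nbhs_nbhs (conj oO Ou).
  by exists t => // y yu; apply: Ht; rewrite /ball/= distrC.
(* If [u] lies in [W], an interval ending at [u] joins the list; otherwise the slope estimate at [u]
   applies on its left. The same alternative then carries [S] beyond [u]. *)
have Su : S u.
  have [Ou|Ou] := pselect (W u).
    have [t t0 Ht] := ballO Ou; have [x Sx /andP[x1 x2]] := pick t t0.
    apply: (step2 x) => // z; rewrite /= in_itv/= => /andP[z1 z2].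
    by apply: Ht; rewrite ltr_norml; apply/andP; split; lra.
  have [t t0 Ht] := good u Iu Ou; have [x Sx /andP[x1 x2]] := pick t t0.
  apply: (step1 x) => //.
  have [|_ ->//] := Ht x; rewrite ltr_norml; apply/andP; split; lra.
have uE : u = y0.
  apply/eqP; rewrite eq_le uy0 leNgt; apply/negP => uy.
  suff [v uv Sv] : exists2 v, u < v & S v.
    by have := sup_upper_bound hS Sv; rewrite leNgt uv.
  have [Ou|Ou] := pselect (W u).
    have [t t0 Ht] := ballO Ou; exists (Num.min (u + t) y0).
      by rewrite lt_min uy ltrDl t0.
    apply: (step2 u) => //; rewrite ?le_min ?ge_min ?lerDl ?(ltW t0) ?uy0 ?lexx ?orbT//.
    move=> z; rewrite /= in_itv/= lt_min => /andP[z1 /andP[z2 _]].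
    by apply: Ht; rewrite ltr_norml; apply/andP; split; lra.
  have [t t0 Ht] := good u Iu Ou; exists (Num.min (u + t / 2) y0).
    by rewrite lt_min uy ltrDl divr_gt0.
  have m1 : u <= Num.min (u + t / 2) y0 by rewrite le_min uy0 lerDl divr_ge0// ltW.
  have m2 : Num.min (u + t / 2) y0 <= u + t / 2 by rewrite ge_min lexx.
  apply: (step1 u) => //; first by rewrite ge_min lexx orbT.
  have [|/(_ m1)//] := Ht (Num.min (u + t / 2) y0).
  by rewrite ltr_norml; apply/andP; split; lra.
move: Su; rewrite uE => -[_ [s [os sx sO Hs]]].
have sumr : \sum_(p <- s) (p.2 - p.1) < r.
  rewrite -lte_fin; apply: le_lt_trans muO; apply: le_trans.
    by apply: (sum_length_le (x := y0) mO os) => // p /sx [].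
  by apply: le_measure; rewrite ?inE//; apply: measurableI.
have sume : \sum_(p <- s) `|f p.2 - f p.1| < e.
  rewrite (big_nth (0, 0)) big_mkord.
  apply: (Hr (size s) (fun i => (nth (0, 0) s i).1) (fun i => (nth (0, 0) s i).2)).
  - move=> i; have [h1 h2 h3] := sx _ (mem_nth (0, 0) (ltn_ord i)).
    by split => //; [exact: le_trans h1|exact: le_trans y01].
  - have lt_disj (i j : 'I_(size s)) : (i < j)%N -> (nth (0, 0) s j).2 <= (nth (0, 0) s i).1.
      move=> ij; move/(pairwiseP (0, 0)) : os; apply; by rewrite ?inE.
    apply/trivIsetP => i j _ _ ij; apply/disjoints_subset => z /=.
    rewrite !in_itv/= => /andP[h1 h2] /andP[h3 h4].
    have [lij|lji|eij] := ltngtP i j.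
    + by have := lt_disj _ _ lij; rewrite leNgt (lt_trans h1 h4).
    + by have := lt_disj _ _ lji; rewrite leNgt (lt_trans h3 h2).
    + by move/eqP : ij; apply; exact: val_inj.
  - by move: sumr; rewrite (big_nth (0, 0)) big_mkord.
have : e * (y0 - x0) <= e by rewrite ler_piMr ?(ltW e0)//; lra.
by move: (\sum_(p <- s) `|_|) sume Hs => X; lra.
Qed.

Lemma Gammabar_nondecreasing (g : R -> R) : is_Gammabar g ->
  forall x y, I01 R x -> I01 R y -> x <= y -> g x <= g y.
Proof. by move=> [_ gAC _ _ dg]; exact: abs_cont_nondecreasing. Qed.

Lemma Gamma_Gammabar (g : R -> R) : is_Gamma g -> is_Gammabar g.
Proof.
move=> [h1 h2 h3 h4 h5]; split => //; apply: ae_imp h5 => x H Ix.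
by have [? /ltW] := H Ix.
Qed.

End abs_cont_facts.

Section curve_facts.
Context (R : realType) (d : nat).
Notation mu := (@lebesgue_measure R).
Implicit Types (c g h : R -> 'rV[R]_d) (x y : R) (p q : 'rV[R]_d).

Definition clamp x : R := Num.min (Num.max x 0) 1.

Lemma clamp_I01 x : I01 R (clamp x).
Proof.
apply/I01P; rewrite /clamp le_min ge_min lexx orbT andbT ler01 andbT.
by rewrite le_max lexx orbT.
Qed.

Lemma clamp_id x : I01 R x -> clamp x = x.
Proof.
by move/I01P => /andP[x0 x1]; rewrite /clamp (max_idPl x0); apply/min_idPl.
Qed.

Lemma clamp_mono x y : x <= y -> clamp x <= clamp y.
Proof.
by move=> xy; rewrite /clamp le_min !ge_min lexx orbT andbT ge_max !le_max xy lexx orbT.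
Qed.

Lemma I01_0 : I01 R 0. Proof. by apply/I01P; rewrite lexx ler01. Qed.
Lemma I01_1 : I01 R 1. Proof. by apply/I01P; rewrite lexx ler01. Qed.

Lemma within_I01_continuous (f : R -> R) :
  (forall x, I01 R x -> forall e, 0 < e -> exists2 r, 0 < r &
     forall y, I01 R y -> `|y - x| < r -> `|f y - f x| < e) ->
  {within `[0, 1], continuous f}.
Proof.
move=> fc; apply/subspace_continuousP => x Ix.
apply/cvgrPdist_lt => e e0; have [r r0 Hr] := fc x Ix e e0.
rewrite near_withinE; apply: filterS (nbhsx_ballx x r r0) => y xy Iy.
by rewrite distrC; apply: Hr => //; rewrite distrC.
Qed.

Lemma abs_cont_continuous (V : zmodType) (N : V -> R) (f : R -> V) :
  (forall u, N (- u) = N u) -> abs_cont N f ->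
  forall e, 0 < e -> exists2 r, 0 < r &
    forall x y, I01 R x -> I01 R y -> `|y - x| < r -> N (f y - f x) < e.
Proof.
move=> NN fN e e0; have [r r0 H] := abs_cont_unif fN e0; exists r => // x y.
move=> /I01P/andP[x0 x1] /I01P/andP[y0 y1] xy; have [le|/ltW le] := leP x y.
  by apply: H => //; rewrite ger0_norm ?subr_ge0// in xy.
by rewrite -opprB NN; apply: H => //; rewrite distrC ger0_norm ?subr_ge0// in xy.
Qed.

Lemma AC_continuous c : Defs.AC c -> forall e, 0 < e -> exists2 r, 0 < r &
  forall x y, I01 R x -> I01 R y -> `|y - x| < r -> enorm (c y - c x) < e.
Proof. by move=> cAC; apply: abs_cont_continuous cAC; exact: enormN. Qed.

Lemma AC_integrable c : Defs.AC c -> curve_integrable c.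
Proof.
move=> cAC i; apply: continuous_compact_integrable; first exact: segment_compact.
apply: (@within_I01_continuous (fun x => c x 0 i)) => x Ix e e0.
have [r r0 H] := AC_continuous cAC e0; exists r => // y Iy yx.
rewrite (le_lt_trans _ (H x y Ix Iy yx))//.
by have := normr_enorm (c y - c x) i; rewrite !mxE.
Qed.

Lemma controlled_le S g x y : controlled (I01 R) S g -> I01 R x -> I01 R y -> x <= y -> S x <= S y.
Proof. by move=> gctl Ix Iy xy; rewrite -subr_ge0 (le_trans (enorm_ge0 _) (gctl _ _ Ix Iy xy)). Qed.

Lemma controlled_osc S g x y : controlled (I01 R) S g -> I01 R x -> I01 R y ->
  enorm (g y - g x) <= S 1 - S 0.
Proof.
move=> gctl Ix Iy.
have h z : I01 R z -> S 0 <= S z /\ S z <= S 1.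
  move=> Iz; have /I01P/andP[z0 z1] := Iz.
  by split; apply: (controlled_le gctl) => //; [exact: I01_0|exact: I01_1].
have [h1 h2] := h x Ix; have [h3 h4] := h y Iy.
have [le|/ltW le] := leP x y; first by have := gctl x y Ix Iy le; lra.
by rewrite enormBC; have := gctl y x Iy Ix le; lra.
Qed.

(** Each coordinate is a difference of two nondecreasing functions, [u + v] and [v], hence
    measurable; it is bounded because its oscillation is. *)
Lemma controlled_integrable S g : controlled (I01 R) S g -> curve_integrable g.
Proof.
move=> gctl i.
pose u x : R := g (clamp x) 0 i; pose v x := S (clamp x).
have mv : {homo v : x y / x <= y}.
  by move=> x y xy; apply: (controlled_le gctl); [exact: clamp_I01|exact: clamp_I01|exact: clamp_mono].
have muv : {homo (fun x => u x + v x) : x y / x <= y}.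
  move=> x y xy; have := gctl _ _ (clamp_I01 x) (clamp_I01 y) (clamp_mono xy).
  have := normr_enorm (g (clamp y) - g (clamp x)) i; rewrite !mxE ler_norml => /andP[h _].
  rewrite /u /v; lra.
have m : measurable_fun (I01 R) (fun x => g x 0 i).
  apply: (@eq_measurable_fun _ _ _ _ _ (fun x => (u x + v x) - v x)).
    by move=> x /set_mem Ix; rewrite addrK /u clamp_id.
  apply: measurable_funB; apply: nondecreasing_measurable => //; exact: measurable_I01.
have b : forall x, I01 R x -> `|g x 0 i| <= enorm (g 0) + (S 1 - S 0).
  move=> x Ix; rewrite (le_trans (normr_enorm _ _))//.
  have -> : g x = g 0 + (g x - g 0) by rewrite addrC subrK.
  by rewrite (le_trans (enormD _ _))// lerD2l (controlled_osc gctl)//; exact: I01_0.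
have i1 : mu.-integrable (I01 R) (EFin \o cst (1 : R)).
  by apply: integrable_cont; exact: cst_continuous.
have := integrable_mul_bounded (@measurable_I01 R) i1 m b.
rewrite [X in mu.-integrable _ X -> _](_ : _ = (fun x => (g x 0 i)%:E))//.
by apply/funext => x /=; rewrite mul1r.
Qed.

(** On an interval of length 1 the integral is a mean, and two values of one selection differ by at
    most [len c]. *)
Lemma sup_bound c x p : BV c -> I01 R x -> segment (ess_left c x) (ess_right c x) p ->
  enorm p <= fine (len c) + \int[mu]_(y in I01 R) enorm (c y).
Proof.
move=> cBV Ix hp; have ci : curve_integrable c by case: cBV.
(* A single selection that takes the value [p] at [x] and agrees with [c] almost everywhere. *)
pose q y := if y == x then p else ess_left c y.
have [|S qctl SL] := @selection_control R d c q cBV.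
  by move=> y Iy; rewrite /q; case: eqP => [->//|_]; exact: segment_l.
have [T [E [f V]]] := BV_var_control cBV.
have ei := integrable_enorm ci.
have H : `|\int[mu]_(y in I01 R) enorm p| <= \int[mu]_(y in I01 R) (fine (len c) + enorm (c y)).
  apply: Rintegral_ae_le.
  - exact: measurable_I01.
  - by apply: integrable_cont; exact: cst_continuous.
  - rewrite [X in mu.-integrable _ X](_ : _ = (EFin \o cst (fine (len c))) \+
      (EFin \o (fun y => enorm (c y))))%E//.
    apply: integrableD; [exact: measurable_I01| |exact: ei].
    by apply: integrable_cont; exact: cst_continuous.
  - by move=> y _; rewrite addr_ge0 ?enorm_ge0// fine_ge0// len_ge0.
  - have := ae_and (ae_and (vc_ae V) (ae_neq x)) (ae_and (ae_neq (0:R)) (ae_neq (1:R))).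
    apply: ae_imp => y [[Ey yx] [y0 y1]] Iy.
    have /I01P/andP[y0' y1'] := Iy.
    have y01 : 0 < y < 1.
      by rewrite !lt_neqAle y0' y1' eq_sym !andbT; apply/andP; split; apply/eqP.
    have [Ec _] := ess_value ci V Ey y01.
    have qy : q y = c y by rewrite /q; case: eqP.
    have qx : q x = p by rewrite /q eqxx.
    rewrite (ger0_norm (enorm_ge0 _)) -qy -qx.
    have -> : q x = (q x - q y) + q y by rewrite subrK.
    by rewrite (le_trans (enormD _ _))// lerD2r (le_trans _ SL)// (controlled_osc qctl).
rewrite Rintegral_cst_I01 (ger0_norm (enorm_ge0 _)) in H.
rewrite (le_trans H)// RintegralD ?Rintegral_cst_I01//.
- exact: measurable_I01.
- by apply: integrable_cont; exact: cst_continuous.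
Qed.

Lemma continuous_ess c x : (forall e, 0 < e -> exists2 r, 0 < r &
     forall y, I01 R y -> `|y - x| < r -> enorm (c y - c x) < e) -> I01 R x ->
  ess_left c x = c x /\ ess_right c x = c x.
Proof.
move=> cc Ix; have /I01P/andP[x0 x1] := Ix.
have l : 0 < x -> is_left_ess_lim c x (c x).
  move=> xp e e0; have [r r0 H] := cc e e0.
  exists (Num.min r x); first by rewrite lt_min r0.
  apply: aeW => y /andP[h1 h2]; move: h1; rewrite ltrBlDr -ltrBlDl lt_min => /andP[h1 h3].
  apply: H; first by apply/I01P; apply/andP; split; lra.
  by rewrite ltr_norml; apply/andP; split; lra.
have r : x < 1 -> is_right_ess_lim c x (c x).
  move=> xp e e0; have [r r0 H] := cc e e0.
  exists (Num.min r (1 - x)); first by rewrite lt_min r0 subr_gt0.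
  apply: aeW => y /andP[h1 h2]; move: h2; rewrite -ltrBlDl lt_min => /andP[h2 h3].
  apply: H; first by apply/I01P; apply/andP; split; lra.
  by rewrite ltr_norml; apply/andP; split; lra.
have [x00|xn0] := eqVneq x 0.
  have r' : x < 1 by rewrite x00.
  split; first by rewrite {1}x00; apply: ess_left0_eq; rewrite -{1}x00; exact: r.
  by apply: ess_right_eq; [rewrite lt_eqF|exact: r].
have xp : 0 < x by rewrite lt_def xn0.
split; first by apply: ess_left_eq => //; exact: l.
have [x11|xn1] := eqVneq x 1.
  by rewrite {1}x11; apply: ess_right1_eq; rewrite -{1}x11; exact: l.
by apply: ess_right_eq => //; apply: r; rewrite lt_neqAle xn1.
Qed.

Lemma AC_ess c x : Defs.AC c -> I01 R x -> ess_left c x = c x /\ ess_right c x = c x.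
Proof.
move=> cAC Ix; apply: continuous_ess => // e e0.
by have [r r0 H] := AC_continuous cAC e0; exists r => // y Iy; exact: H.
Qed.

Lemma AC_good_rep c : Defs.AC c -> good_rep c.
Proof. by move=> cAC x Ix; have [-> ->] := AC_ess cAC Ix; exact: segment_l. Qed.

(** A monotone change of variable does not increase the growth of a control. It serves both ways:
    with [phi], to bound a composition, and with a right inverse of [phi], to recover the length of
    the original curve. *)
Lemma len_le_selection c (p : R -> 'rV[R]_d) (r : R -> R) h (E : set R) : BV c ->
  (forall x, I01 R x -> segment (ess_left c x) (ess_right c x) (p x)) ->
  (forall x, I01 R x -> I01 R (r x)) ->
  (forall x y, I01 R x -> I01 R y -> x <= y -> r x <= r y) ->
  curve_integrable h -> {ae mu, forall x, E x} ->
  (forall x, 0 < x < 1 -> E x -> h x = p (r x)) -> (len h <= len c)%E.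
Proof.
move=> cBV hp rI rm hi aE hE; have [S pctl SL] := selection_control cBV hp.
rewrite -(len_fineK cBV); apply: (@le_trans _ _ (S (r (clamp 1)) - S (r (clamp 0)))%:E).
  apply: (@len_le_control R d h E (fun x => S (r (clamp x)))) => //.
  - move=> x y xy; apply: (controlled_le pctl); try (by apply: rI; exact: clamp_I01).
    by apply: rm; [exact: clamp_I01|exact: clamp_I01|exact: clamp_mono].
  - by apply: ae_imp aE.
  - move=> x y [Ex x01] [Ey y01] xy.
    have {}x01 : 0 < x < 1 by move: x01; rewrite /= in_itv.
    have {}y01 : 0 < y < 1 by move: y01; rewrite /= in_itv.
    have Ix : I01 R x by apply/I01P; case/andP: x01 => *; rewrite !ltW.
    have Iy : I01 R y by apply/I01P; case/andP: y01 => *; rewrite !ltW.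
    rewrite !clamp_id// !hE//; apply: pctl; [exact: rI|exact: rI|exact: rm].
rewrite lee_fin (le_trans _ SL)// !clamp_id//; [|exact: I01_0|exact: I01_1].
have r1 := rI _ I01_1; have r0 := rI _ I01_0.
have /I01P/andP[_ h1] := r1; have /I01P/andP[h0 _] := r0.
by rewrite lerB// (controlled_le pctl)//; [exact: I01_1|exact: I01_0].
Qed.

(** Since [f] may be constant on intervals, preimages are chosen; monotonicity of the choice follows
    from that of [f]. *)
Lemma Gammabar_right_inverse (f : R -> R) : is_Gammabar f ->
  exists r : R -> R, [/\ forall y, I01 R y -> I01 R (r y), forall y, I01 R y -> f (r y) = y &
    forall x y, I01 R x -> I01 R y -> x <= y -> r x <= r y].
Proof.
move=> fG; have fm := Gammabar_nondecreasing fG; have [fI fAC f0 f1 _] := fG.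
have fc : {within `[0, 1], continuous f}.
  apply: within_I01_continuous => x Ix e e0.
  have [r r0 H] := abs_cont_continuous (@normrN _ _) fAC e0; exists r => // y Iy.
  exact: H.
have /choice[r hr] : forall y, exists x, I01 R y -> I01 R x /\ f x = y.
  move=> y; have [Iy|nIy] := pselect (I01 R y); last by exists 0.
  have [|x Ix fx] := @IVT R f 0 1 y ler01 fc.
    have /I01P/andP[y0 y1] := Iy.
    by rewrite f0 f1 (min_idPl ler01) (max_idPr ler01) y0 y1.
  by exists x => _; split.
exists r; split=> [y /hr[]|y /hr[]|x y Ix Iy]//.
have [Irx frx] := hr x Ix; have [Iry fry] := hr y Iy.
rewrite le_eqVlt => /predU1P[->//|xy]; rewrite leNgt; apply/negP => yx.
by have := fm _ _ Iry Irx (ltW yx); rewrite frx fry leNgt xy.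
Qed.

(** The nontrivial direction lacks a lower bound on the lengths. It comes from [len_lsc] applied
    along the indices at which that bound would fail. *)
Lemma strict_cvg_lim (c_ : nat -> R -> 'rV[R]_d) c : BV c ->
  (forall k, curve_integrable (c_ k)) ->
  strict_cvg c_ c <-> strict_lim \oo c_ c.
Proof.
move=> cBV cki; have ci : curve_integrable c by case: cBV.
have distE k :
    (\int[mu]_(x in I01 R) (enorm (c_ k x - c x))%:E)%E = (L1dist (c_ k) c)%:E.
  rewrite fineK//.
  have h := @integrable_fin_num _ _ R mu (I01 R) (@measurable_I01 R)
     (EFin \o (fun x => enorm (c_ k x - c x))) (integrable_dist (cki k) ci).
  exact: h.
have lenE := len_fineK cBV.
split=> [[c1 c2]|[c1 c2]]; split.
- move=> e e0.
  have N0 : nbhs (0%E : \bar R) [set y | (y < e%:E)%E].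
    by apply: open_nbhs_nbhs; split; [exact: open_ereal_lt_ereal|rewrite /= lte_fin].
  have H : \forall k \near \oo,
    (\int[mu]_(x in I01 R) (enorm (c_ k x - c x))%:E < e%:E)%E := c1 _ N0.
  by apply: filterS H => k /=; rewrite distE lte_fin.
- move=> e e0.
  have N0 : nbhs (len c) [set y | (y < (fine (len c) + e)%:E)%E].
    apply: open_nbhs_nbhs; split; first exact: open_ereal_lt_ereal.
    by rewrite /= -[X in (X < _)%E]lenE lte_fin ltrDl.
  have H : \forall k \near \oo, (len (c_ k) < (fine (len c) + e)%:E)%E := c2 _ N0.
  by apply: filterS H => k /= /ltW.
- apply: cvg_EFin; first by apply: nearW => k; rewrite distE.
  apply/cvgrPdist_lt => e e0; apply: filterS (c1 e e0) => k h.
  by rewrite /= distE/= sub0r normrN ger0_norm// L1dist_ge0.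
- have low e : 0 < e -> \forall k \near \oo, ((fine (len c) - e)%:E <= len (c_ k))%E.
    move=> e0; apply: contrapT => H.
    pose A := [set k | (len (c_ k) < (fine (len c) - e)%:E)%E].
    pose F : set_system nat := within A \oo.
    have FF : ProperFilter F.
      split; last exact: within_filter.
      move=> H2; have H3 : \forall k \near \oo, A k -> False := H2.
      apply: H; apply: filterS H3 => k /= hk.
      by rewrite leNgt; apply/negP.
    have inF (P : set nat) : (\forall k \near \oo, P k) -> F P.
      by move=> oP; apply: (@filterS _ \oo _ P) => // k Pk _.
    have FA : F A by have : \forall k \near \oo, A k -> A k by exact: nearW.
    have : (len c <= (fine (len c) - e)%:E)%E.
      apply: (@len_lsc R d nat F c_ c) => //.
      - exact/inF/nearW.
      - by move=> e' e'0; exact: inF (c1 _ e'0).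
      - move=> e' e'0; apply: filterS FA => k Ak.
        by apply: le_trans (ltW Ak) _; rewrite lee_fin lerDl ltW.
    by rewrite -[X in (X <= _)%E]lenE lee_fin; lra.
  have lf : \forall k \near \oo, (fine (len (c_ k)))%:E = len (c_ k).
    apply: filterS (c2 1 ltr01) => k hk; rewrite fineK// ge0_fin_numE ?len_ge0//.
    by rewrite (le_lt_trans hk)// ltry.
  rewrite -[X in _ --> X]lenE; apply: cvg_EFin; first by apply: filterS lf => k <-.
  apply/cvgrPdist_le => e e0.
  apply: filterS3 (low e e0) (c2 e e0) lf => k h1 h2 h3.
  by rewrite -h3 !lee_fin in h1 h2; rewrite /= ler_norml; apply/andP; split; lra.
Qed.

End curve_facts.

(** * The relaxed functional is below the matching functional *)

Section grid.
Context (R : realType) (d : nat).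
Notation mu := (@lebesgue_measure R).

(** Within a cell [u] moves by at most the growth of [S] there, and these growths telescope with
    weight [1 / n]. Convergence at finitely many nodes thus yields L1 convergence when variations
    are bounded. *)
Lemma grid_integral (S : R -> R) (u : R -> 'rV[R]_d) (n : nat) (eta : R) :
  (0 < n)%N -> controlled (I01 R) S u ->
  (forall j, (j <= n)%N -> enorm (u (j%:R / n%:R)) <= eta) ->
  \int[mu]_(x in I01 R) enorm (u x) <= eta + (S 1 - S 0) / n%:R.
Proof.
move=> n0 uS hu; have ui := controlled_integrable uS; have ei := integrable_enorm ui.
have N0 : (0 : R) < n%:R by rewrite ltr0n.
have Ij j : (j <= n)%N -> I01 R (j%:R / n%:R).
  by move=> jn; apply/I01P; rewrite divr_ge0//= ler_pdivrMr// mul1r ler_nat.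
suff H j : (j <= n)%N -> \int[mu]_(x in `[0, j%:R / n%:R]) enorm (u x) <=
    eta * (j%:R / n%:R) + (S (j%:R / n%:R) - S 0) / n%:R.
  by have := H n (leqnn n); rewrite divff ?gt_eqF// mulr1.
elim: j => [_|j IH jn]; first by rewrite !mul0r set_itv1 Rintegral_set1 subrr mulr0 mul0r addr0.
have jn' := ltnW jn; have Ia := Ij j jn'; have Ib := Ij _ jn.
pose a : R := j%:R / n%:R; pose b : R := j.+1%:R / n%:R; rewrite -/b.
have ab : b - a = n%:R^-1 by rewrite /a /b -mulrBl -addn1 natrD addrAC subrr add0r mul1r.
have lab : a <= b by rewrite -subr_ge0 ab invr_ge0 ltW.
have /I01P/andP[a0 a1] := Ia; have /I01P/andP[b0 b1] := Ib.
rewrite (Rintegral_split a0 lab b1 ei).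
have : \int[mu]_(x in `[a, b]) enorm (u x) <= (eta + (S b - S a)) * (b - a).
  rewrite -Rintegral_cst_itv//; apply: le_Rintegral.
  - exact: measurable_itv.
  - exact: integrable_I01_sub.
  - by apply: integrable_cont; exact: cst_continuous.
  - move=> t; rewrite /= in_itv/= => /andP[at_ tb].
    have It : I01 R t by apply/I01P; rewrite (le_trans a0) ?(le_trans tb).
    have -> : u t = u a + (u t - u a) by rewrite addrC subrK.
    rewrite (le_trans (enormD _ _))// lerD ?hu//.
    by rewrite (le_trans (uS _ _ Ia It at_))// lerD2r (controlled_le uS).
rewrite ab => Hab.
have -> : eta * b + (S b - S 0) / n%:R =
    (eta * a + (S a - S 0) / n%:R) + (eta + (S b - S a)) / n%:R.
  have -> : eta * b = eta * a + eta / n%:R by rewrite -ab -mulrDr addrC subrK.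
  ring.
by apply: lerD Hab; exact: IH.
Qed.

End grid.

Section limits_superior.
Context (R : realType).
Implicit Types (u : nat -> \bar R) (x y : \bar R).

Lemma limn_esup_le_near u x : (\forall k \near \oo, (u k <= x)%E) -> (limn_esup u <= x)%E.
Proof.
move=> H; apply: (@le_trans _ _ (ereal_sup (u @` [set k | (u k <= x)%E]))).
  by apply: ereal_inf_lbound; exists [set k | (u k <= x)%E].
by apply: ge_ereal_sup => _ [k /= uk <-].
Qed.

Lemma limn_einf_ge_near u x : (\forall k \near \oo, (x <= u k)%E) -> (x <= limn_einf u)%E.
Proof.
move=> H; rewrite /limn_einf leeNr; apply: limn_esup_le_near.
by apply: filterS H => k uk; rewrite leeN2.
Qed.

Lemma lee_from_real x y : (forall A : R, (y < A%:E)%E -> (x <= A%:E)%E) -> (x <= y)%E.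
Proof.
move: y => [y| |] H; last 2 first.
- exact: leey.
- move: x H => [x| |] H //.
    by have := H (x - 1)%R (ltNyr _); rewrite lee_fin leNgt ltrBlDr ltrDl ltr01.
  by have := H 0 (ltNyr _).
apply/lee_addgt0Pr => e e0; apply: H.
by rewrite lte_fin ltrDl.
Qed.

Lemma frequently_limn_esup u (A : R) : (A%:E < limn_esup u)%E ->
  forall P : set nat, (\forall k \near \oo, P k) -> exists2 k, P k & (A%:E < u k)%E.
Proof.
move=> Au P oP; apply: contrapT => H.
suff : (limn_esup u <= A%:E)%E by rewrite leNgt Au.
apply: limn_esup_le_near; apply: filterS oP => k Pk.
by rewrite leNgt; apply/negP => h; apply: H; exists k.
Qed.

End limits_superior.

Section matching.
Context (R : realType) (d : nat).
Notation mu := (@lebesgue_measure R).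
Implicit Types (c g h : R -> 'rV[R]_d).

(** Isolates [hatS], the only term not known to be finite, so that later estimates involve real
    lengths. *)
Lemma hatd_leE c1 c2 (A : R) : BV c1 -> BV c2 ->
  (hatd c1 c2 <= A%:E)%E =
  (((fine (len c1) + fine (len c2) - A) / 2)%:E <= hatS c1 c2)%E.
Proof.
move=> c1BV c2BV; rewrite /hatd -(len_fineK c1BV) -(len_fineK c2BV).
case: (hatS c1 c2) => [s| |] /=.
- by rewrite !lee_fin ler_pdivrMr// (mulrC s); apply/idP/idP; lra.
- by rewrite gt0_muley ?lte_fin// addeNy// leNye leey.
- by rewrite gt0_muleNy ?lte_fin//.
Qed.

Lemma dist_sqE c1 c2 : BV c1 -> BV c2 ->
  dist_sq c1 c2 = (fine (len c1) + fine (len c2) - 2 * matchS c1 c2)%:E.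
Proof. by move=> h1 h2; rewrite /dist_sq -(len_fineK h1) -(len_fineK h2). Qed.

Lemma strict_cvg_cst c : strict_cvg (fun=> c) c.
Proof.
split; last exact: cvg_cst.
have -> : (\int[mu]_(x in I01 R) (enorm (c x - c x))%:E = 0)%E; last exact: cvg_cst.
by under eq_integral do rewrite subrr enorm0; rewrite integral0.
Qed.

Lemma matchS_le_hatS c1 c2 : Defs.AC c1 -> Defs.AC c2 -> ((matchS c1 c2)%:E <= hatS c1 c2)%E.
Proof.
move=> h1 h2; apply: ereal_sup_ubound; exists (fun=> c1), (fun=> c2); split => //.
- exact: strict_cvg_cst.
- exact: strict_cvg_cst.
- apply/eqP; rewrite eq_le; apply/andP; split; last exact: limn_esup_le_near (nearW _ (fun=> lexx _)).
  by rewrite (le_trans _ (limn_einf_sup _))// limn_einf_ge_near//; exact: nearW.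
Qed.

Lemma len_comp c (f r : R -> R) : BV c -> good_rep c -> curve_integrable (c \o f) ->
  (forall x, I01 R x -> I01 R (f x)) ->
  (forall x y, I01 R x -> I01 R y -> x <= y -> f x <= f y) ->
  (len (c \o f) <= len c)%E.
Proof.
move=> cBV cg cfi fI fm.
by apply: (@len_le_selection _ _ c c f _ setT) => //; exact: aeW.
Qed.

(** For the lower bound on the length, [c] is itself [c \o f] composed with a monotone right inverse
    of [f]. *)
Lemma comp_Gammabar c (f : R -> R) : Defs.AC c -> BV c -> is_Gammabar f ->
  [/\ Defs.AC (c \o f), BV (c \o f) & len (c \o f) = len c].
Proof.
move=> cAC cBV fG; have fm := Gammabar_nondecreasing fG; have [fI fAC _ _ _] := fG.
have cfAC : Defs.AC (c \o f) by exact: abs_cont_comp.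
have cfi := AC_integrable cfAC.
have le1 : (len (c \o f) <= len c)%E by apply: len_comp => //; exact: AC_good_rep.
have cfBV : BV (c \o f) by split => //; apply: le_lt_trans le1 _; case: cBV.
split => //; apply/eqP; rewrite eq_le le1/=.
have [r [rI fr rm]] := Gammabar_right_inverse fG.
apply: (@len_le_selection _ _ (c \o f) (c \o f) r _ setT) => //.
- exact: AC_good_rep.
- by case: cBV.
- exact: aeW.
- move=> x /andP[x0 x1] _ /=; rewrite fr//; apply/I01P; rewrite !ltW//.
Qed.

(** Besides the membership of the compositions, it suffices that constant sequences compete in
    [hatS]. *)
Lemma relaxed_le_matching :
  functional_le (@relaxed_functional R d) (@matching_functional R d).
Proof.
move=> c1 c2 f1 f2; rewrite /matching_functional; case: asboolP => [|_]; last exact: leey.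
move=> [c1AC c2AC f1G f2G].
have sub (c : bv_curve R d) (f : Gammabar R) : Defs.AC c ->
    exists2 g : bv_curve R d, reparam c f g & bv_fun g = c \o f /\ Defs.AC g.
  move=> cAC; have [gAC gBV gl] := comp_Gammabar cAC (bv_funP c) (gammabar_funP f).
  exists (BVCurve gBV (AC_good_rep gAC)); last by split.
  split=> // x Ix /=; have [fI _ _ _ _] := gammabar_funP f.
  by have [-> ->] := AC_ess cAC (fI x Ix); exact: segment_l.
have [g1 hg1 [E1 g1AC]] := sub c1 f1 c1AC; have [g2 hg2 [E2 g2AC]] := sub c2 f2 c2AC.
rewrite -E1 -E2 dist_sqE; [|exact: bv_funP|exact: bv_funP].
apply: (@le_trans _ _ (hatd g1 g2)).
  by apply: ereal_inf_lbound; exists g1 => //; exists g2.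
rewrite hatd_leE; [|exact: bv_funP|exact: bv_funP].
rewrite (_ : (_ / 2) = matchS g1 g2); last by field.
exact: matchS_le_hatS.
Qed.

End matching.

(** * Lower semicontinuity of the relaxed functional *)

Section lower_semicontinuity.
Context (R : realType) (d : nat).
Notation mu := (@lebesgue_measure R).
Implicit Types (c g h : R -> 'rV[R]_d).

Lemma invS_small (e : R) : 0 < e -> \forall m \near \oo, (m.+1%:R^-1 : R) < e.
Proof. by move=> e0; have := near_infty_natSinv_lt (PosNum e0). Qed.

Lemma invS_gt0 (m : nat) : 0 < (m.+1%:R^-1 : R).
Proof. by rewrite invr_gt0 ltr0n. Qed.

Lemma strict_lim_invS (h_ : nat -> R -> 'rV[R]_d) g (K : R) : 0 < K ->
  (forall m, L1dist (h_ m) g < K * m.+1%:R^-1) ->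
  (forall m, (len (h_ m) <= (fine (len g) + K * m.+1%:R^-1)%:E)%E) ->
  strict_lim \oo h_ g.
Proof.
move=> K0 h1 h2; split=> e e0.
  apply: filterS (invS_small (divr_gt0 e0 K0)) => m hm.
  by rewrite (lt_trans (h1 m))// mulrC -ltr_pdivlMr.
apply: filterS (invS_small (divr_gt0 e0 K0)) => m hm.
by rewrite (le_trans (h2 m))// lee_fin lerD2l mulrC -ler_pdivlMr// ltW.
Qed.

(** A level strictly below a limit superior is exceeded at arbitrarily late indices, in particular
    at one where both approximations are already within [e]. *)
Lemma hatS_near c1 c2 (A : R) : BV c1 -> BV c2 -> (A%:E < hatS c1 c2)%E ->
  forall e, 0 < e -> exists h : (R -> 'rV[R]_d) * (R -> 'rV[R]_d),
  [/\ Defs.AC h.1 /\ Defs.AC h.2,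
     L1dist h.1 c1 < e /\ (len h.1 <= (fine (len c1) + e)%:E)%E,
     L1dist h.2 c2 < e /\ (len h.2 <= (fine (len c2) + e)%:E)%E &
     A < matchS h.1 h.2].
Proof.
move=> c1BV c2BV /ereal_sup_gt[_ [h1_ [h2_ [hAC s1 s2 ->]]] Al] e e0.
have [a1 a2] := (strict_cvg_lim c1BV (fun k => AC_integrable (hAC k).1)).1 s1.
have [b1 b2] := (strict_cvg_lim c2BV (fun k => AC_integrable (hAC k).2)).1 s2.
have [k [[k1 k2] [k3 k4]]] := frequently_limn_esup Al
  (filterI (filterI (a1 e e0) (a2 e e0)) (filterI (b1 e e0) (b2 e e0))).
rewrite lte_fin => kA; exists (h1_ k, h2_ k).
exact: And4 (hAC k) (conj k1 k2) (conj k3 k4) kA.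
Qed.

(** For each [m], first an index [k] close to the limit, then an absolutely continuous pair close to
    the curves of index [k]; the two errors [1 / m.+1] add up, whence the factor 2. The outcome is a
    genuine sequence, as [hatS] demands, although [U] is only a filter. *)
Lemma hatS_limit (U : set_system nat) (g1_ g2_ : nat -> R -> 'rV[R]_d) g1 g2 (A : R) :
  ProperFilter U -> BV g1 -> BV g2 ->
  (\forall k \near U, BV (g1_ k) /\ BV (g2_ k)) ->
  strict_lim U g1_ g1 -> strict_lim U g2_ g2 ->
  (\forall k \near U, (A%:E < hatS (g1_ k) (g2_ k))%E) -> (A%:E <= hatS g1 g2)%E.
Proof.
move=> UU g1BV g2BV g_BV [L1 l1] [L2 l2] hA.
have close (g gk h : R -> 'rV[R]_d) (e : R) : BV g -> BV gk -> Defs.AC h ->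
   L1dist gk g < e -> (len gk <= (fine (len g) + e)%:E)%E ->
   L1dist h gk < e -> (len h <= (fine (len gk) + e)%:E)%E ->
   L1dist h g < 2 * e /\ (len h <= (fine (len g) + 2 * e)%:E)%E.
  move=> gBV gkBV hAC a1 a2 b1 b2; split.
    rewrite (le_lt_trans (L1dist_triangle (AC_integrable hAC) (proj1 gkBV) (proj1 gBV)))//.
    by rewrite mulr2n mulrDl mul1r ltrD.
  apply: le_trans b2 _; rewrite -(len_fineK gkBV) lee_fin in a2.
  by rewrite lee_fin mulr2n mulrDl mul1r addrA lerD2r.
have /choice[h hh] : forall m : nat, exists h : (R -> 'rV[R]_d) * (R -> 'rV[R]_d),
    [/\ Defs.AC h.1 /\ Defs.AC h.2,
        L1dist h.1 g1 < 2 * m.+1%:R^-1 /\ (len h.1 <= (fine (len g1) + 2 * m.+1%:R^-1)%:E)%E,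
        L1dist h.2 g2 < 2 * m.+1%:R^-1 /\ (len h.2 <= (fine (len g2) + 2 * m.+1%:R^-1)%:E)%E &
        A < matchS h.1 h.2].
  move=> m; have e0 := invS_gt0 m; set e : R := m.+1%:R^-1 in e0 *.
  have [k [[[k1 k2] [k3 k4]] [kA [b1 b2]]]] := filter_ex (filterI
     (filterI (filterI (L1 e e0) (l1 e e0)) (filterI (L2 e e0) (l2 e e0))) (filterI hA g_BV)).
  have [h [[h1 h2] [p1 p2] [p3 p4] hA']] := hatS_near b1 b2 kA e0.
  by exists h; split => //; [exact: (close _ _ _ _ g1BV b1)|exact: (close _ _ _ _ g2BV b2)].
have hAC m : Defs.AC (h m).1 /\ Defs.AC (h m).2 by case: (hh m).
have two : (0 : R) < 2 by [].
have S1 : strict_cvg (fun m => (h m).1) g1.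
  apply: (strict_cvg_lim g1BV (fun m => AC_integrable (hAC m).1)).2.
  by apply: (strict_lim_invS two) => m; case: (hh m) => _ [].
have S2 : strict_cvg (fun m => (h m).2) g2.
  apply: (strict_cvg_lim g2BV (fun m => AC_integrable (hAC m).2)).2.
  by apply: (strict_lim_invS two) => m; case: (hh m) => _ _ [].
apply: (@le_trans _ _ (limn_esup (fun m => (matchS (h m).1 (h m).2)%:E))).
  rewrite (le_trans _ (limn_einf_sup _))//; apply: limn_einf_ge_near; apply: nearW => m.
  by rewrite lee_fin ltW//; case: (hh m).
apply: ereal_sup_ubound; exists (fun m => (h m).1), (fun m => (h m).2); split => //.
Qed.

Definition regular c (y : R) := ess_left c y = c y /\ ess_right c y = c y.

Lemma ae_regular c : BV c -> {ae mu, forall y, 0 < y < 1 -> regular c y}.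
Proof.
move=> cBV; have [T [E [f V]]] := BV_var_control cBV.
by apply: ae_imp (vc_ae V) => y Ey y01; exact: (ess_value (proj1 cBV) V Ey y01).
Qed.

Lemma strict_lim_cst (K : Type) (F : set_system K) c : Filter F -> BV c ->
  strict_lim F (fun=> c) c.
Proof.
move=> FF cBV; split => e e0; apply: nearW => _.
  rewrite /L1dist Rintegral_eq0// => x _; by rewrite subrr enorm0.
by rewrite -[X in (X <= _)%E](len_fineK cBV) lee_fin lerDl ltW.
Qed.

Lemma uniform_I01P (f_ : nat -> R -> R) (f : R -> R) :
  {uniform I01 R, f_ @ \oo --> f} <->
  (forall e, 0 < e -> \forall k \near \oo, forall x, I01 R x -> `|f_ k x - f x| < e).
Proof.
split => [fu e e0|H P].
  have N : nbhs (f : {uniform` I01 R -> R}) [set g | forall x, I01 R x -> `|g x - f x| < e].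
    apply/uniform_nbhs; exists [set p : R * R | `|p.1 - p.2| < e]; split.
      exact: entourage_ball (PosNum e0).
    by move=> g /= gH x Ix; rewrite distrC; exact: gH.
  exact: fu _ N.
move=> /uniform_nbhs [E [entE EP]].
have [e /= e0 He] : exists2 e : R, 0 < e & forall p : R * R, `|p.1 - p.2| < e -> E p.
  have := entE; rewrite -entourage_ballE => -[e /= e0 He]; by exists e.
have := H e e0; apply: filterS => k hk; apply: (EP (f_ k)) => x Ix.
by apply: (He (f x, f_ k x)); rewrite /= distrC; exact: hk.
Qed.

(** Limit values of [g] at [x] exist by [sup_bound] and lie in the segment of [c] at [f x], by
    [segment_limit] for the constant sequence [c]. That segment is a point. *)
Lemma regular_continuous c g (f : R -> R) (x : R) : BV c -> good_rep c -> is_Gammabar f ->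
  (forall z, I01 R z -> segment (ess_left c (f z)) (ess_right c (f z)) (g z)) ->
  I01 R x -> regular c (f x) ->
  g x = c (f x) /\ (forall e : R, 0 < e -> exists2 r : R, 0 < r &
     forall z, I01 R z -> `|z - x| < r -> enorm (g z - g x) < e).
Proof.
move=> cBV cg fG hg Ix [rl rr]; have [fI fAC _ _ _] := fG.
have gx : g x = c (f x) by have := hg x Ix; rewrite rl rr => /segmentxx.
split => // e e0; apply: contrapT => H.
pose A := [set z | I01 R z /\ e <= enorm (g z - g x)].
pose F : set_system R := within A (nbhs x).
have FF : ProperFilter F.
  split; last exact: within_filter.
  rewrite /F /within /= => -[r /= r0 Hr]; apply: H; exists r => // z Iz zx.
  rewrite ltNge; apply/negP => ez; apply: (Hr z) => //.
  by rewrite /= distrC.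
have [U [UU FU]] := ultraFilterLemma FF.
have UA : \forall z \near U, A z by apply: FU; rewrite /F /within /=; exact: nearW.
have Ux r : 0 < r -> \forall z \near U, `|z - x| < r.
  move=> r0; apply: FU; rewrite /F /within /=; exists r => //= z zx _.
  by rewrite distrC.
have [p gp] : exists p, vcvg U g p.
  apply: (@ultra_vcvg _ _ _ _ _ (fine (len c) + \int[mu]_(y in I01 R) enorm (c y))).
  apply: filterS UA => z [Iz _]; apply: sup_bound (hg z Iz) => //; exact: fI.
have : segment (ess_left c (f x)) (ess_right c (f x)) p.
  apply: (@segment_limit R d R U (fun=> c) c f (f x) g p) => //.
  - exact: nearW.
  - exact: strict_lim_cst.
  - by apply: filterS UA => z [Iz _]; split; [exact: fI|exact: hg].
  - move=> t t0; have [r r0 Hr] := abs_cont_continuous (@normrN _ _) fAC t0.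
    by apply: filterS2 UA (Ux r r0) => z [Iz _] zx; exact: Hr.
  - exact: fI.
rewrite rl rr => /segmentxx pE.
have [z [[Iz ez] h]] := filter_ex (filterI UA (gp e e0)).
by move: h; rewrite pE -gx ltNge ez.
Qed.

End lower_semicontinuity.

(** * Compactness of reparametrised curves *)

Section limit_curves.
Context (R : realType) (d : nat).
Notation mu := (@lebesgue_measure R).

Lemma near_ord (U : set_system nat) (n : nat) (P : nat -> nat -> Prop) : Filter U ->
  (forall j, (j <= n)%N -> \forall k \near U, P j k) ->
  \forall k \near U, forall j, (j <= n)%N -> P j k.
Proof.
move=> UU H.
have : \forall k \near U, forall j : 'I_n.+1, P j k.
  by apply: filter_forall => j; apply: H; rewrite -ltnS.
by apply: filterS => k h j jn; have := h (Ordinal (jn : (j < n.+1)%N)).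
Qed.

(** [g_ k - g] is controlled by [S_ k + S], whose growth is at most [W]; the grid is chosen with
    [W / n] below [e / 4], and its finitely many nodes converge simultaneously. *)
Lemma strict_lim_L1_near (U : set_system nat) (g_ : nat -> R -> 'rV[R]_d) (g : R -> 'rV[R]_d)
    (S_ : nat -> R -> R) (S : R -> R) (V : R) : ProperFilter U ->
  (\forall k \near U, controlled (I01 R) (S_ k) (g_ k) /\ S_ k 1 - S_ k 0 <= V) ->
  controlled (I01 R) S g ->
  (forall x, I01 R x -> vcvg U (fun k => g_ k x) (g x)) ->
  forall e, 0 < e -> \forall k \near U, L1dist (g_ k) g < e.
Proof.
move=> UU hS cS hg e e0.
pose W := V + (S 1 - S 0).
have W0 : 0 < `|W| + 1 by rewrite ltr_wpDl.
have [m mW] := filter_ex (invS_small (divr_gt0 e0 (mulr_gt0 (ltr0n R 4) W0))).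
pose n := m.+1; have n0 : (0 : R) < n%:R by rewrite ltr0n.
have Wn : W / n%:R <= e / 4.
  move: mW; rewrite -/n ltr_pdivlMr ?mulr_gt0// => h.
  have : W / n%:R <= (`|W| + 1) / n%:R.
    by rewrite ler_pM2r ?invr_gt0// (le_trans (ler_norm _))// lerDl.
  by move: h; rewrite mulrC -mulrA; move: (_ / _) (W / _) => a b; lra.
have grid : \forall k \near U, forall j, (j <= n)%N ->
    enorm (g_ k (j%:R / n%:R) - g (j%:R / n%:R)) <= e / 4.
  apply: near_ord => j jn.
  have Ij : I01 R (j%:R / n%:R).
    by apply/I01P; rewrite divr_ge0//= ler_pdivrMr// mul1r ler_nat.
  have e4 : 0 < e / 4 by rewrite divr_gt0.
  by apply: filterS (hg _ Ij _ e4) => k /ltW.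
apply: filterS2 hS grid => k [kS kV] hk.
have cu : controlled (I01 R) (fun x => S_ k x + S x) (fun x => g_ k x - g x).
  move=> x y Ix Iy xy.
  have -> : g_ k y - g y - (g_ k x - g x) = (g_ k y - g_ k x) - (g y - g x).
    by apply/rowP => i; rewrite !mxE; ring.
  have h1 := kS x y Ix Iy xy; have h2 := cS x y Ix Iy xy.
  have h3 := enormB (g_ k y - g_ k x) (g y - g x); lra.
have := @grid_integral R d (fun x => S_ k x + S x) _ n (e / 4) isT cu hk.
rewrite -/(L1dist (g_ k) g) => h; apply: (le_lt_trans h).
have : (S_ k 1 + S 1 - (S_ k 0 + S 0)) / n%:R <= W / n%:R.
  by rewrite ler_pM2r ?invr_gt0// /W; lra.
lra.
Qed.
(** Selection in the manner of Helly: at every point of [I] both the values and the controls are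
    bounded, so both converge along the ultrafilter. *)
Lemma curve_limit (U : set_system nat) (c_ g_ : nat -> bv_curve R d) (c : bv_curve R d)
    (f_ : nat -> Gammabar R) (f : Gammabar R) : UltraFilter U ->
  strict_lim U (fun k => c_ k : R -> 'rV[R]_d) c ->
  (forall e, 0 < e -> \forall k \near U, forall x, I01 R x -> `|f_ k x - f x| < e) ->
  (\forall k \near U, reparam (c_ k) (f_ k) (g_ k)) ->
  exists2 g : bv_curve R d, reparam c f g & strict_lim U (fun k => g_ k : R -> 'rV[R]_d) g.
Proof.
move=> UU cs fs gs; have [c1 c2] := cs.
have cBV := bv_funP c; have ci : curve_integrable c by case: cBV.
have fG := gammabar_funP f; have [fI fAC f0 f1 _] := fG.
have fkI k x : I01 R x -> I01 R (f_ k x)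
  by move=> Ix; have [h _ _ _ _] := gammabar_funP (f_ k); exact: h.
set V := fine (len c) in c2.
have lenk e : 0 < e -> \forall k \near U, fine (len (g_ k)) <= V + e.
  move=> e0; apply: filterS2 (c2 e e0) gs => k h [_ lg].
  by rewrite -lee_fin (len_fineK (bv_funP (g_ k))) lg.
have gbound : \forall k \near U, forall x, I01 R x ->
    enorm (g_ k x) <= V + 1 + (L1dist c (fun=> 0) + 1).
  apply: filterS3 gs (lenk 1 ltr01) (c1 1 ltr01) => k [h1 h2] h3 h4 x Ix.
  have cki : curve_integrable (c_ k) by case: (bv_funP (c_ k)).
  have := sup_bound (bv_funP (c_ k)) (fkI k x Ix) (h1 x Ix).
  have := L1dist_triangle cki ci (@curve_integrable_cst R d 0).
  have -> : L1dist (c_ k) (fun=> 0) = \int[mu]_(y in I01 R) enorm (c_ k y).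
    by rewrite /L1dist; under eq_Rintegral do rewrite subr0.
  rewrite -h2; move: h3 h4; move: (fine _) (enorm _) (\int[_]_(_ in _) _) => u v w.
  by move: (L1dist _ _) (L1dist _ _) => y z; lra.
have /choice[g0 g0E] : forall x, exists p, I01 R x -> vcvg U (fun k => g_ k x) p.
  move=> x; have [Ix|nIx] := pselect (I01 R x); last by exists 0.
  have [|p hp] := @ultra_vcvg R d _ U (fun k => g_ k x) (V + 1 + (L1dist c (fun=> 0) + 1)) UU.
    by apply: filterS gbound => k; exact.
  by exists p.
(* A control matters only up to a constant; fixing it to be 0 at 0 makes the family bounded. *)
have /choice[S_ hS_] : forall k, exists S, controlled (I01 R) S (g_ k) /\
    S 0 = 0 /\ S 1 <= fine (len (g_ k)).
  move=> k; have [S Sg S1] := selection_control (bv_funP (g_ k)) (@bv_fun_good _ _ (g_ k)).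
  exists (fun x => S x - S 0); rewrite subrr; split => // x y Ix Iy xy.
  by have := Sg x y Ix Iy xy; lra.
have Sbound : \forall k \near U, forall x, I01 R x -> `|S_ k x| <= V + 1.
  apply: filterS (lenk 1 ltr01) => k h x Ix; have [h1 [h2 h3]] := hS_ k.
  have /I01P/andP[x0 x1] := Ix.
  have := controlled_le h1 (I01_0 R) Ix x0; have := controlled_le h1 Ix (I01_1 R) x1.
  by rewrite h2 ler_norml => a b; apply/andP; split; lra.
have /choice[S SE] : forall x, exists l, I01 R x ->
    forall e, 0 < e -> \forall k \near U, `|S_ k x - l| < e.
  move=> x; have [Ix|nIx] := pselect (I01 R x); last by exists 0.
  have [|l hl] := @ultra_cvg_real R _ U (fun k => S_ k x) (V + 1) UU.
    by apply: filterS Sbound => k; exact.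
  by exists l.
have cSg : controlled (I01 R) S g0.
  move=> x y Ix Iy xy; apply/ler_addgt0Pr => e e0.
  have e4 : 0 < e / 4 by rewrite divr_gt0.
  have [k [[k1 k2] [k3 k4]]] := filter_ex (filterI (filterI (SE x Ix _ e4) (SE y Iy _ e4))
     (filterI (g0E x Ix _ e4) (g0E y Iy _ e4))).
  have h := (hS_ k).1 x y Ix Iy xy.
  have h1 := enorm_dist3 (g_ k y) (g0 y) (g0 x).
  have h2 := enorm_dist3 (g_ k x) (g_ k y) (g0 x).
  move: k1 k2; rewrite !ltr_norml => /andP[a1 a2] /andP[a3 a4].
  rewrite (enormBC (g0 y) (g_ k y)) in h1; rewrite /= in k3 k4 a1 a2 a3 a4; lra.
have S10 : S 1 - S 0 <= V.
  apply/ler_addgt0Pr => e e0; have e3 : 0 < e / 3 by rewrite divr_gt0.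
  have [k [[k1 k2] k3]] := filter_ex (filterI
    (filterI (SE 0 (I01_0 R) _ e3) (SE 1 (I01_1 R) _ e3)) (lenk _ e3)).
  have [_ [h1 h2]] := hS_ k.
  by move: k1 k2; rewrite h1 !ltr_norml => /andP[a1 a2] /andP[a3 a4]; lra.
have gi := controlled_integrable cSg.
have gl : (len g0 <= len c)%E.
  by rewrite (le_trans (len_le_control_I01 gi cSg))// -(len_fineK cBV) lee_fin.
have gBV : BV g0 by split => //; apply: le_lt_trans gl _; case: cBV.
have gL1 : forall e, 0 < e -> \forall k \near U, L1dist (g_ k) g0 < e.
  apply: (@strict_lim_L1_near _ _ _ S_ S (V + 1)) => //.
  by apply: filterS (lenk 1 ltr01) => k h; have [h1 [-> h2]] := hS_ k; split => //; lra.
have hseg x : I01 R x -> segment (ess_left c (f x)) (ess_right c (f x)) (g0 x).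
  move=> Ix.
  apply: (@segment_limit R d nat U (fun k => c_ k) c (fun k => f_ k x) (f x) (fun k => g_ k x)) => //.
  - by apply: nearW => k; split; [exact: bv_funP|exact: bv_fun_good].
  - by apply: filterS gs => k [h _]; split; [exact: fkI|exact: h].
  - by move=> e e0; apply: filterS (fs e e0) => k; exact.
  - exact: fI.
  - exact: g0E.
(* For the missing inequality, [c] is almost everywhere [g0] composed with the right inverse [r]. *)
have lE : len g0 = len c.
  apply/eqP; rewrite eq_le gl/=.
  have [r [rI fr rm]] := Gammabar_right_inverse fG.
  (* That [g0] is a good representative is proved later, from this very equality of lengths. Until
     then [g0] is a legitimate selection only where it is known to be continuous; elsewhere
     [ess_left g0] stands in. *)
  pose p x := if pselect (I01 R x /\ regular c (f x)) then g0 x else ess_left g0 x.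
  apply: (@len_le_selection R d g0 p r c [set y | 0 < y < 1 -> regular c y]) => //.
  - move=> x Ix; rewrite /p; case: pselect => [[? rx]|?]; last exact: segment_l.
    have [_ gc] := regular_continuous cBV (@bv_fun_good _ _ c) fG hseg Ix rx.
    by have [-> ->] := continuous_ess gc Ix; exact: segment_l.
  - exact: ae_regular.
  - move=> y y01 hy; have ry : regular c y := hy y01.
    have Iy : I01 R y by apply/I01P; case/andP: y01 => *; rewrite !ltW.
    rewrite /p; case: pselect => /= [?|[]]; last by split; [exact: rI|rewrite fr].
    have ry' : regular c (f (r y)) by rewrite fr.
    have [-> _] := regular_continuous cBV (@bv_fun_good _ _ c) fG hseg (rI y Iy) ry'.
    by rewrite fr.
have gs0 : strict_lim U (fun k => g_ k : R -> 'rV[R]_d) g0.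
  split=> [|e e0]; first exact: gL1.
  by rewrite lE; apply: filterS (lenk e e0) => k; rewrite -lee_fin (len_fineK (bv_funP (g_ k))).
have gg : good_rep g0.
  move=> x Ix; apply: (@segment_limit R d nat U (fun k => g_ k) g0 (fun=> x) x (fun k => g_ k x)) => //.
  - by apply: nearW => k; split; [exact: bv_funP|exact: bv_fun_good].
  - by apply: nearW => k; split => //; exact: bv_fun_good.
  - by move=> e e0; apply: nearW => k; rewrite subrr normr0.
  - exact: g0E.
by exists (BVCurve gBV gg).
Qed.

End limit_curves.

Section lower_semicontinuous.
Context (R : realType) (d : nat).
Notation mu := (@lebesgue_measure R).

(** The substitute for passing to a subsequence: [B] becomes eventual, and whatever was eventual
    remains so. *)
Lemma ultra_frequently (B : set nat) : ~ (\forall k \near \oo, ~ B k) ->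
  exists U : set_system nat, [/\ UltraFilter U, \forall k \near U, B k &
    forall P : set nat, (\forall k \near \oo, P k) -> \forall k \near U, P k].
Proof.
move=> nB; pose F : set_system nat := within B \oo.
have FF : ProperFilter F.
  split; last exact: within_filter.
  by move=> H; apply: nB; have H3 : \forall k \near \oo, B k -> False := H; exact: H3.
have [U [UU FU]] := ultraFilterLemma FF; exists U; split => // [|P oP]; apply: FU.
  by have : \forall k \near \oo, B k -> B k by exact: nearW.
by apply: (@filterS _ \oo _ P) => // k Pk _.
Qed.

Lemma ultra_limn_einf (u : nat -> \bar R) (A : R) : (limn_einf u < A%:E)%E ->
  exists U : set_system nat, [/\ UltraFilter U, \forall k \near U, (u k < A%:E)%E &
    forall P : set nat, (\forall k \near \oo, P k) -> \forall k \near U, P k].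
Proof.
move=> uA; apply: ultra_frequently => H; move: uA; rewrite ltNge => /negP; apply.
by apply: limn_einf_ge_near; apply: filterS H => k /negP; rewrite -leNgt.
Qed.

Lemma strict_cvg_len (c_ : nat -> R -> 'rV[R]_d) (c : R -> 'rV[R]_d) : BV c -> strict_cvg c_ c ->
  forall e, 0 < e -> \forall k \near \oo, ((fine (len c) - e)%:E < len (c_ k))%E.
Proof.
move=> cBV [_ c2] e e0.
have N0 : nbhs (len c) [set y | ((fine (len c) - e)%:E < y)%E].
  apply: open_nbhs_nbhs; split; first exact: open_ereal_gt_ereal.
  by rewrite /= -[X in (_ < X)%E](len_fineK cBV) lte_fin ltrBlDr ltrDl.
exact: c2 _ N0.
Qed.

Lemma relaxed_lsc : lsc (@relaxed_functional R d).
Proof.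
move=> c1_ c2_ f1_ f2_ c1 c2 f1 f2 s1 s2 /uniform_I01P u1 /uniform_I01P u2.
apply: lee_from_real => A /ultra_limn_einf[U [UU hA Uoo]].
have /choice[g_ hg] : forall k, exists g : bv_curve R d * bv_curve R d,
    (relaxed_functional (c1_ k) (c2_ k) (f1_ k) (f2_ k) < A%:E)%E ->
    [/\ reparam (c1_ k) (f1_ k) g.1, reparam (c2_ k) (f2_ k) g.2 &
      (hatd g.1 g.2 < A%:E)%E].
  move=> k.
  have [h|h] := boolP (relaxed_functional (c1_ k) (c2_ k) (f1_ k) (f2_ k) < A%:E)%E; last first.
    by exists (c1, c2).
  have [_ [g1 r1 [g2 r2 <-]] gA] := ereal_inf_lt h.
  by exists (g1, g2).
have lim (c_ : nat -> bv_curve R d) (c : bv_curve R d) : strict_cvg (fun k => c_ k) c ->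
    strict_lim U (fun k => c_ k : R -> 'rV[R]_d) c.
  move=> s; have [a1 a2] := (strict_cvg_lim (bv_funP c) (fun k => (bv_funP (c_ k)).1)).1 s.
  by split => e e0; apply: Uoo; [exact: a1|exact: a2].
have hG : \forall k \near U, [/\ reparam (c1_ k) (f1_ k) (g_ k).1, reparam (c2_ k) (f2_ k) (g_ k).2 &
      (hatd (g_ k).1 (g_ k).2 < A%:E)%E] by apply: filterS hA => k; exact: hg.
have [|g1 r1 l1] := curve_limit UU (lim _ _ s1) (fun e e0 => Uoo _ (u1 e e0)) (g_ := fun k => (g_ k).1).
  by apply: filterS hG => k [].
have [|g2 r2 l2] := curve_limit UU (lim _ _ s2) (fun e e0 => Uoo _ (u2 e e0)) (g_ := fun k => (g_ k).2).
  by apply: filterS hG => k [].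
apply: (@le_trans _ _ (hatd g1 g2)).
  by apply: ereal_inf_lbound; exists g1 => //; exists g2.
(* The slack [e] pays for the lengths occurring in [hatd]: those of index [k] may fall short of the
   limits by up to [e / 2] each. *)
apply/lee_addgt0Pr => e e0; rewrite -EFinD hatd_leE; [|exact: bv_funP|exact: bv_funP].
apply: (@hatS_limit R d U (fun k => (g_ k).1) (fun k => (g_ k).2)) => //.
- exact: bv_funP.
- exact: bv_funP.
- by apply: nearW => k; split; exact: bv_funP.
have e2 : 0 < e / 2 by rewrite divr_gt0.
have n1 := Uoo _ (strict_cvg_len (bv_funP c1) s1 e2).
have n2 := Uoo _ (strict_cvg_len (bv_funP c2) s2 e2).
apply: filterS3 n1 n2 hG => k k1 k2 [[_ q1] [_ q2] q3].
move: r1 r2 => [_ r1] [_ r2].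
have := hatd_leE A (bv_funP (g_ k).1) (bv_funP (g_ k).2).
rewrite (ltW q3) => /esym; apply: lt_le_trans; rewrite lte_fin.
move: k1 k2; rewrite -q1 -q2 -r1 -r2 => k1 k2.
rewrite -(len_fineK (bv_funP (g_ k).1)) lte_fin in k1.
rewrite -(len_fineK (bv_funP (g_ k).2)) lte_fin in k2.
rewrite ltr_pM2r ?invr_gt0//; move: k1 k2.
by move: (fine _) (fine _) (fine _) (fine _) => x1 y1 x2 y2; lra.
Qed.
End lower_semicontinuous.

(** * Recovery sequences *)

Section perturbation.
Context (R : realType).
Notation mu := (@lebesgue_measure R).
Implicit Types (f : R -> R) (t x y : R).

(** Dividing by [1 + t] restores the value 1 at 1. The identity outside [I] makes the map injective
    on the line, so that recovery holds as an equality of total functions. *)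
Definition perturb f t x := if 0 <= x <= 1 then (f x + t * x) / (1 + t) else x.

Lemma perturbE f t x : I01 R x -> perturb f t x = (f x + t * x) / (1 + t).
Proof. by move=> /I01P Ix; rewrite /perturb Ix. Qed.

Lemma perturb_dist f t x : 0 < t -> I01 R x -> I01 R (f x) -> `|perturb f t x - f x| <= t.
Proof.
move=> t0 Ix /I01P/andP[y0 y1]; rewrite perturbE//; have /I01P/andP[x0 x1] := Ix.
have t1 : 0 < 1 + t by rewrite addr_gt0.
have -> : (f x + t * x) / (1 + t) - f x = t * (x - f x) / (1 + t).
  by field; rewrite gt_eqF.
rewrite normrM normfV (gtr0_norm t1) ler_pdivrMr// normrM (gtr0_norm t0) ler_pM2l//.
by rewrite ler_norml; apply/andP; split; lra.
Qed.

(** This lower slope makes the inverse Lipschitz, hence absolutely continuous, even where [f] is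
    flat. *)
Lemma perturb_expand f t x y : is_Gammabar f -> 0 < t -> I01 R x -> I01 R y -> x <= y ->
  t / (1 + t) * (y - x) <= perturb f t y - perturb f t x.
Proof.
move=> fG t0 Ix Iy xy; rewrite !perturbE//; have fm := Gammabar_nondecreasing fG Ix Iy xy.
have t1 : 0 < 1 + t by rewrite addr_gt0.
rewrite -mulrBl mulrAC ler_pM2r ?invr_gt0//.
by move: fm; move: (f x) (f y) => a b; lra.
Qed.

Lemma perturb_Gamma f t : is_Gammabar f -> 0 < t -> is_Gamma (perturb f t).
Proof.
move=> [fI fAC f0 f1 df] t0; have t1 : 0 < 1 + t by rewrite addr_gt0.
have i0 := I01_0 R; have i1 := I01_1 R.
split.
- move=> x Ix; rewrite perturbE//.
  have /I01P/andP[x0 x1] := Ix; have /I01P/andP[y0 y1] := fI x Ix.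
  have tx : 0 <= t * x by rewrite mulr_ge0// ltW.
  have tx1 : t * x <= t by rewrite ler_piMr// ltW.
  apply/I01P/andP; split; first by apply: divr_ge0; [exact: addr_ge0|exact: ltW].
  by rewrite ler_pdivrMr// mul1r; move: (f x) (t * x) y1 tx1 => u v; lra.
- move=> e e0; have e2 : 0 < e / 2 by rewrite divr_gt0.
  have [r r0 Hr] := fAC _ e2; exists (Num.min r (e / 2)); first by rewrite lt_min r0.
  move=> n a b ab tr; rewrite lt_min => /andP[sr se].
  have h := Hr n a b ab tr sr.
  apply: (@le_lt_trans _ _ (\sum_(i < n) `|f (b i) - f (a i)| + \sum_(i < n) (b i - a i))); last first.
    lra.
  rewrite -big_split/=; apply: ler_sum => i _; have [a0 aibi b1] := ab i.
  have Ia : I01 R (a i) by apply/I01P; rewrite a0 (le_trans aibi).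
  have Ib : I01 R (b i) by apply/I01P; rewrite b1 (le_trans a0).
  rewrite !perturbE// -mulrBl normrM normfV (gtr0_norm t1) ler_pdivrMr//.
  have -> : f (b i) + t * b i - (f (a i) + t * a i) = (f (b i) - f (a i)) + t * (b i - a i) by ring.
  have d0 : 0 <= b i - a i by rewrite subr_ge0.
  rewrite (le_trans (ler_normD _ _))// normrM (gtr0_norm t0) (ger0_norm d0).
  have : 0 <= `|f (b i) - f (a i)| * t by rewrite mulr_ge0// ltW.
  by move: `|_| d0 => u; move: (b i - a i) => v d0; nra.
- by rewrite perturbE// f0 mulr0 addr0 mul0r.
- by rewrite perturbE// f1 mulr1 divff// gt_eqF.
(* The ends are discarded because [perturb] changes formula there while derivatives are
   two-sided. *)
- apply: ae_imp (ae_and df (ae_and (ae_neq 0) (ae_neq 1))) => x [dx [/eqP xn0 /eqP xn1]] Ix.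
  have [dfx fx0] := dx Ix; have /I01P/andP[x0 x1] := Ix.
  have {}x0 : 0 < x by rewrite lt_def xn0.
  have {}x1 : x < 1 by rewrite lt_neqAle xn1.
  pose g : R -> R := (1 + t)^-1 \*: (f + (fun z : R => t *: z)).
  have gE : {near x, g =1 perturb f t}.
    have : \forall z \near x, 0 < z < 1.
      have : nbhs x `]0, 1[%classic by apply: near_in_itvoo; rewrite in_itv/= x0.
      by apply: filterS => z; rewrite /= in_itv.
    apply: filterS => z /andP[z0 z1]; rewrite perturbE; last by apply/I01P; rewrite !ltW.
    by rewrite /g /= mulrC.
  have did : is_derive x (1 : R) (fun z : R => t *: z) (t *: 1).
    exact: is_deriveZ.
  have Df : is_derive x (1 : R) f (derive1 f x) by rewrite derive1E; exact: DeriveDef.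
  have Dg : is_derive x (1 : R) g ((1 + t)^-1 *: (derive1 f x + t *: 1)).
    exact: is_deriveZ (is_deriveD Df did).
  split; first by apply: near_eq_derivable gE _; exact: ex_derive.
  rewrite derive1E -(near_eq_derive _ gE) derive_val.
  by rewrite mulr_gt0 ?invr_gt0// scaler1 ltr_wpDl.
Qed.

Lemma perturb_inverse f t : is_Gammabar f -> 0 < t -> exists r : R -> R,
  [/\ cancel (perturb f t) r, (forall y, I01 R y -> I01 R (r y) /\ perturb f t (r y) = y),
   abs_cont Num.norm r & forall x y, I01 R x -> I01 R y -> x <= y -> r x <= r y].
Proof.
move=> fG t0; have pG := perturb_Gamma fG t0; have [pI _ _ _ _] := pG.
have t1 : 0 < 1 + t by rewrite addr_gt0.
have [r [rI pr rm]] := Gammabar_right_inverse (Gamma_Gammabar pG).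
pose q y := if 0 <= y <= 1 then r y else y.
have qE y : I01 R y -> q y = r y by move=> /I01P Iy; rewrite /q Iy.
have tt : 0 < t / (1 + t) by rewrite divr_gt0.
exists q; split => [x|y Iy|e e0|x y Ix Iy xy].
- have [Ix|nIx] := pselect (I01 R x); last first.
    have nx : (0 <= x <= 1) = false by apply/negP => /I01P.
    by rewrite /perturb nx /q nx.
  have Ipx := pI _ Ix; rewrite qE//; have prx := pr _ Ipx; have Ir := rI _ Ipx.
  apply/eqP; rewrite eq_le !leNgt; apply/andP; split; apply/negP => lt.
    have := perturb_expand fG t0 Ix Ir (ltW lt); rewrite prx subrr leNgt mulr_gt0//.
    by rewrite subr_gt0.
  have := perturb_expand fG t0 Ir Ix (ltW lt); rewrite prx subrr leNgt mulr_gt0//.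
  by rewrite subr_gt0.
- by rewrite qE//; split; [exact: rI|exact: pr].
- exists (t / (1 + t) * e); first by rewrite mulr_gt0.
  move=> n a b ab _; rewrite -ltr_pdivrMl// mulr_sumr; apply: le_lt_trans.
  apply: ler_sum => i _; have [a0 aibi b1] := ab i.
  have Ia : I01 R (a i) by apply/I01P; rewrite a0 (le_trans aibi).
  have Ib : I01 R (b i) by apply/I01P; rewrite b1 (le_trans a0).
  rewrite !qE// ler_pdivlMl// ger0_norm ?subr_ge0 ?rm//.
  by have := perturb_expand fG t0 (rI _ Ia) (rI _ Ib) (rm _ _ Ia Ib aibi); rewrite !pr.
- by rewrite !qE// rm.
Qed.

End perturbation.

Section recovery.
Context (R : realType) (d : nat).
Notation mu := (@lebesgue_measure R).

(** Along indices violating the claim, the parameters tend to some [x] with [f x = y]. As [y] is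
    regular, [g] is continuous at [x], its segment there is the point [c y], and the values are
    forced towards it. *)
Lemma recovery_pointwise (c g : bv_curve R d) (f : Gammabar R) (h_ : nat -> R -> 'rV[R]_d)
    (x_ : nat -> R) (y : R) :
  reparam c f g -> (forall m, Defs.AC (h_ m) /\ BV (h_ m)) -> strict_lim \oo h_ g ->
  (forall m, I01 R (x_ m)) -> (forall e, 0 < e -> \forall m \near \oo, `|f (x_ m) - y| < e) ->
  regular c y -> vcvg \oo (fun m => h_ m (x_ m)) (c y).
Proof.
move=> [gf gl] hAC hs xI xy ry e e0; apply: contrapT => H.
have fG := gammabar_funP f; have [fI fAC _ _ _] := fG; have gBV := bv_funP g.
have [|U [UU UB Uoo]] := @ultra_frequently [set m | e <= enorm (h_ m (x_ m) - c y)].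
  move=> B; apply: H; apply: filterS B => m /= /negP; by rewrite -ltNge.
have hsU : strict_lim U h_ g by split => e' e'0; apply: Uoo; [exact: hs.1|exact: hs.2].
have [|x hx] := @ultra_cvg_real R _ U x_ 1 UU.
  by apply: nearW => m; have /I01P/andP[a b] := xI m; rewrite ger0_norm.
have Ix : I01 R x.
  apply/I01P/andP; split; apply/ler_addgt0Pr => r r0; have [m /=] := filter_ex (hx r r0);
    have /I01P/andP[a b] := xI m; rewrite ltr_norml => /andP[u v]; lra.
have fx : f x = y.
  apply/eqP; rewrite -subr_eq0 -normr_le0; apply/ler_addgt0Pr => r r0; rewrite add0r.
  have r2 : 0 < r / 2 by rewrite divr_gt0.
  have [s s0 Hs] := abs_cont_continuous (@normrN _ _) fAC r2.
  have [m [m1 m2]] := filter_ex (filterI (hx s s0) (Uoo _ (xy _ r2))).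
  have m3 := Hs x (x_ m) Ix (xI m) m1.
  move: m2 m3; rewrite /= !ltr_norml ler_norml => /andP[a1 a2] /andP[a3 a4].
  by apply/andP; split; lra.
have ci : curve_integrable g by case: gBV.
have [|p hp] := @ultra_vcvg R d _ U (fun m => h_ m (x_ m))
    (fine (len g) + 1 + (L1dist g (fun=> 0) + 1)) UU.
  apply: filterS2 (hsU.1 1 ltr01) (hsU.2 1 ltr01) => m m1 m2.
  have [a b] := hAC m; have hi := AC_integrable a.
  have := sup_bound b (xI m) (AC_good_rep a (xI m)).
  have := L1dist_triangle hi ci (@curve_integrable_cst R d 0).
  have -> : L1dist (h_ m) (fun=> 0) = \int[mu]_(y in I01 R) enorm (h_ m y).
    by rewrite /L1dist; under eq_Rintegral do rewrite subr0.
  rewrite -(len_fineK b) lee_fin in m2.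
  move: m1 m2; move: (fine _) (fine _) (enorm _) (\int[_]_(_ in _) _) => u u' v w.
  by move: (L1dist _ _) (L1dist _ _) => a' b'; lra.
have rfx : regular c (f x) by rewrite fx.
have [gx gc] := regular_continuous (bv_funP c) (@bv_fun_good _ _ c) fG gf Ix rfx.
have : segment (ess_left g x) (ess_right g x) p.
  apply: (@segment_limit R d nat U h_ g x_ x (fun m => h_ m (x_ m))) => //.
  - by apply: nearW => m; have [a b] := hAC m; split => //; exact: AC_good_rep.
  - by apply: nearW => m; split => //; apply: AC_good_rep => //; exact: (hAC m).1.
have [-> ->] := continuous_ess gc Ix; move=> /segmentxx pE.
have [m [m1 m2]] := filter_ex (filterI UB (hp e e0)).
by move: m2; rewrite /= pE gx fx ltNge => /negP; apply.
Qed.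

(** Convergence is now along [\oo], so dominated convergence applies, with [M + enorm (c x)] as
    dominating function. *)
Lemma dominated_L1 (c_ : nat -> R -> 'rV[R]_d) (c : R -> 'rV[R]_d) (M : R) :
  (forall m, curve_integrable (c_ m)) -> curve_integrable c ->
  (forall m x, I01 R x -> enorm (c_ m x) <= M) ->
  {ae mu, forall x, I01 R x -> vcvg \oo (fun m => c_ m x) (c x)} ->
  forall e, 0 < e -> \forall m \near \oo, L1dist (c_ m) c < e.
Proof.
move=> cmi ci cM cc e e0.
pose u m x := enorm (c_ m x - c x).
have ui m : mu.-integrable (I01 R) (EFin \o u m) by exact: integrable_dist.
have gi : mu.-integrable (I01 R) (EFin \o (fun x => M + enorm (c x))).
  rewrite [X in mu.-integrable _ X](_ : _ = (cst M%:E \+ (EFin \o (fun x => enorm (c x))))%E)//.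
  apply: integrableD => //; first exact: measurable_I01.
    by apply: (@integrable_cont _ (cst M)); exact: cst_continuous.
  exact: integrable_enorm.
have um m : measurable_fun (I01 R) (EFin \o u m) by have /integrableP[] := ui m.
have u0 : {ae mu, forall x, I01 R x -> (EFin \o u m) x @[m --> \oo] --> (cst 0%E : R -> \bar R) x}.
  apply: ae_imp cc => x hx Ix /=; apply: cvg_EFin; first exact: nearW.
  apply/cvgrPdist_lt => r r0; apply: filterS (hx Ix r r0) => m.
  by rewrite /= sub0r normrN ger0_norm ?enorm_ge0.
have ub : {ae mu, forall x, forall m, I01 R x -> (`|(EFin \o u m) x| <= (M + enorm (c x))%:E)%E}.
  apply: aeW => x m Ix; rewrite /= lee_fin ger0_norm ?enorm_ge0//.
  by rewrite (le_trans (enormB _ _))// lerD2r cM.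
have [_ _] := @dominated_convergence _ _ R mu (I01 R) (@measurable_I01 R)
  (fun m => EFin \o u m) (cst 0%E) _ um (measurable_cst _) u0 gi ub.
rewrite integral0 => lim0.
have N0 : nbhs (0%E : \bar R) [set z | (z < e%:E)%E].
  by apply: open_nbhs_nbhs; split; [exact: open_ereal_lt_ereal|rewrite /= lte_fin].
have H : \forall m \near \oo, (\int[mu]_(x in I01 R) (u m x)%:E < e%:E)%E := lim0 _ N0.
apply: filterS H => m; rewrite -lte_fin /L1dist /Rintegral fineK//.
have h := @integrable_fin_num _ _ R mu (I01 R) (@measurable_I01 R) (EFin \o u m) (ui m).
exact: h.
Qed.

Lemma recovery (c g : bv_curve R d) (f : Gammabar R) (h_ : nat -> R -> 'rV[R]_d) :
  reparam c f g -> (forall m, Defs.AC (h_ m)) ->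
  (forall m, L1dist (h_ m) g < m.+1%:R^-1) ->
  (forall m, (len (h_ m) <= (fine (len g) + m.+1%:R^-1)%:E)%E) ->
  exists (c_ : nat -> bv_curve R d) (f_ : nat -> Gammabar R),
  [/\ forall m, Defs.AC (c_ m) /\ is_Gamma (f_ m), strict_cvg (fun m => c_ m) c,
     {uniform I01 R, (fun k => f_ k : R -> R) @ \oo --> (f : R -> R)} &
     forall m, c_ m \o f_ m = h_ m].
Proof.
move=> cfg hAC hL1 hlen; have [gf gl] := cfg.
have fG := gammabar_funP f; have [fI fAC _ _ _] := fG.
have gBV := bv_funP g; have cBV := bv_funP c.
have hi m := AC_integrable (hAC m).
have hBV m : BV (h_ m) by split; [exact: hi|apply: le_lt_trans (hlen m) _; exact: ltry].
have hs : strict_lim \oo h_ g.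
  by apply: (@strict_lim_invS _ _ _ _ 1) => // m; rewrite mul1r.
pose t m : R := m.+1%:R^-1; have t0 m : 0 < t m := invS_gt0 R m.
pose F m := perturb f (t m).
have FG m : is_Gamma (F m) by exact: perturb_Gamma.
have /choice[r hr] : forall m, exists r : R -> R,
  [/\ cancel (F m) r, (forall y, I01 R y -> I01 R (r y) /\ F m (r y) = y),
   abs_cont Num.norm r & forall x y, I01 R x -> I01 R y -> x <= y -> r x <= r y].
  by move=> m; exact: perturb_inverse.
have rI m y : I01 R y -> I01 R (r m y) by move=> Iy; have [_ h _ _] := hr m; case: (h y Iy).
have hrAC m : Defs.AC (h_ m \o r m).
  by have [_ _ h1 h2] := hr m; apply: abs_cont_comp => //; [exact: hAC|exact: rI].
have hrlen m : (len (h_ m \o r m) <= len (h_ m))%E.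
  have [_ _ h1 h2] := hr m; apply: len_comp => //; [exact: AC_good_rep|exact: AC_integrable|exact: rI].
have hrBV m : BV (h_ m \o r m).
  by split; [exact: AC_integrable|apply: le_lt_trans (hrlen m) _; case: (hBV m)].
exists (fun m => BVCurve (hrBV m) (AC_good_rep (hrAC m))).
exists (fun m => MkGammabar (Gamma_Gammabar (FG m))); split.
- by move=> m; split; [exact: hrAC|exact: FG].
- apply: (strict_cvg_lim cBV (fun m => (hrBV m).1)).2.
  split; last first.
    (* Composition with the inverse does not lengthen [h_ m], and the limit length is right because
       [len g = len c]. *)
    move=> e e0; apply: filterS (hs.2 e e0) => m hm.
    by rewrite -gl; exact: le_trans (hrlen m) hm.
  apply: (@dominated_L1 _ _ (fine (len g) + 1 + (L1dist g (fun=> 0) + 1))).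
  + by move=> m; case: (hrBV m).
  + by case: cBV.
  + move=> m x Ix; have := sup_bound (hBV m) (rI m x Ix) (AC_good_rep (hAC m) (rI m x Ix)).
    have := L1dist_triangle (hi m) (proj1 gBV) (@curve_integrable_cst R d 0).
    have -> : L1dist (h_ m) (fun=> 0) = \int[mu]_(y in I01 R) enorm (h_ m y).
      by rewrite /L1dist; under eq_Rintegral do rewrite subr0.
    have := hL1 m; have := hlen m; rewrite -(len_fineK (hBV m)) lee_fin.
    have : t m <= 1 by rewrite invf_le1 ?ler1n// ltr0n.
    rewrite /= -/(t m); move: (t m) (enorm _) (fine (len (h_ m))) (fine (len g)) => u v w z.
    by move: (\int[_]_(_ in _) _) (L1dist _ _) (L1dist _ _) => i j k; lra.
  + apply: ae_imp (ae_and (ae_regular cBV) (ae_and (ae_neq 0) (ae_neq 1)))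
      => y [ry [/eqP yn0 /eqP yn1]] Iy.
    have /I01P/andP[y0 y1] := Iy.
    have {}ry : regular c y by apply: ry; rewrite lt_def yn0 y0 lt_neqAle yn1 y1.
    (* [y] is the image of [r m y] under [F m], which lies within [t m] of [f]; so [f (r m y)] tends
       to [y]. *)
    apply: (@recovery_pointwise c g f h_ (fun m => r m y)) => // [m|e e0]; first exact: rI.
    apply: filterS (invS_small e0) => m hm.
    have [_ h _ _] := hr m; have [Iry ryE] := h y Iy.
    rewrite -[in X in _ - X]ryE distrC (le_lt_trans _ hm)//; apply: perturb_dist => //; exact: fI.
- apply/uniform_I01P => e e0; apply: filterS (invS_small e0) => m hm x Ix.
  by rewrite (le_lt_trans _ hm)//; apply: perturb_dist => //; exact: fI.
- by move=> m; apply/funext => x /=; have [h _ _ _] := hr m; rewrite h.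
Qed.

(** On the recovery sequences the matching functional is evaluated at the approximants [h]
    themselves, whatever the curves and reparametrisations behind them; lower semicontinuity of [G]
    then gives the bound in the limit. *)
Lemma relaxed_greatest (G : functional R d) :
  functional_le G (@matching_functional R d) -> lsc G ->
  functional_le G (@relaxed_functional R d).
Proof.
move=> GF Glsc c1 c2 f1 f2; apply: le_ereal_inf_tmp => _ [g1 r1 [g2 r2 <-]].
apply: lee_from_real => A /ltW; rewrite hatd_leE; [|exact: bv_funP|exact: bv_funP].
move=> hA; apply/lee_addgt0Pr => e e0; rewrite -EFinD.
have g1BV := bv_funP g1; have g2BV := bv_funP g2.
(* The strict inequality costs [e / 4] in [hatS], that is [e / 2] in the functional; two lengths in
   excess by less than [e / 8] each leave the total below [e]. *)
have {}hA : (((fine (len g1) + fine (len g2) - A) / 2 - e / 4)%:E < hatS g1 g2)%E.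
  by apply: lt_le_trans hA; rewrite lte_fin gtrBl divr_gt0.
have /choice[h hh] := fun m => hatS_near g1BV g2BV hA (invS_gt0 R m).
have [c1_ [f1_ [h1 s1 u1 e1]]] := recovery (h_ := fun m => (h m).1) r1
  (fun m => let: And4 a _ _ _ := hh m in a.1)
  (fun m => let: And4 _ a _ _ := hh m in a.1) (fun m => let: And4 _ a _ _ := hh m in a.2).
have [c2_ [f2_ [h2 s2 u2 e2]]] := recovery (h_ := fun m => (h m).2) r2
  (fun m => let: And4 a _ _ _ := hh m in a.2)
  (fun m => let: And4 _ _ a _ := hh m in a.1) (fun m => let: And4 _ _ a _ := hh m in a.2).
apply: le_trans (Glsc _ _ _ _ _ _ _ _ s1 s2 u1 u2) _.
apply: le_trans (limn_einf_sup _) _; apply: limn_esup_le_near.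
have e8 : 0 < e / 8 by rewrite divr_gt0.
apply: filterS (invS_small e8) => m hm.
apply: (le_trans (GF _ _ _ _)).
rewrite /matching_functional asboolT; last first.
  by split; [exact: (h1 m).1|exact: (h2 m).1|exact: (h1 m).2|exact: (h2 m).2].
rewrite e1 e2; have [[a1 a2] [b1 b2] [b3 b4] hS] := hh m.
have BVh (w v : R -> 'rV[R]_d) (x : R) : Defs.AC v -> (len v <= (fine (len w) + x)%:E)%E ->
    BV v /\ fine (len v) <= fine (len w) + x.
  move=> vAC vl; have vBV : BV v by split; [exact: AC_integrable|apply: le_lt_trans vl _; exact: ltry].
  by split => //; rewrite -lee_fin len_fineK.
have [B1 l1] := BVh g1 _ _ a1 b2; have [B2 l2] := BVh g2 _ _ a2 b4.
rewrite dist_sqE// lee_fin; move: hS hm l1 l2; move: (matchS _ _) (m.+1%:R^-1) => S b.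
by move: (fine _) (fine _) (fine _) (fine _) => x y z w; lra.
Qed.

End recovery.

Theorem proposition3 (R : realType) (d : nat) :
  is_lsc_hull (matching_functional (R := R) (d := d))
              (relaxed_functional (R := R) (d := d)).
Proof.
split; [exact: relaxed_le_matching|exact: relaxed_lsc|exact: relaxed_greatest].
Qed.
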